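(* Let $n\ge2$ and let ${\bf a}=\{a_j\}_{j\in\mathbb{N}}\in\ell^1$ with $0<a_j<1$ for all $j\in\mathbb{N}$. For $\delta\in(-\infty,1)$ let $A_\delta=(1-\delta 1_{C^{(n)}_{\bf a}})I_n$ on $\mathbb{R}^n$. If $\delta\in(-\infty,0]$, then the intrinsic distance and differential structures of $A_\delta$ coincide; if $\delta\in(0,1)$, then the intrinsic distance and differential structures of $A_\delta$ do not coincide.
   Context: For ${\bf a}=\{a_j\}$ with $0<a_j<1$ the Cantor set $C_{\bf a}\subset[0,1]$ is defined as follows: $I_1,I_2$ are the two closed intervals obtained by removing from $I=[0,1]$ the middle open interval of length $a_1$; for $m\ge2$, $I_{i_1\cdots i_{m-1}1}$ and $I_{i_1\cdots i_{m-1}2}$ are the two closed intervals obtained by removing from $I_{i_1\cdots i_{m-1}}$ the middle open interval of length $a_m|I_{i_1\cdots i_{m-1}}|$; and $C_{\bf a}=\bigcap_{m\in\mathbb{N}}\bigcup_{i_1,\dots,i_m\in\{1,2\}}I_{i_1\cdots i_m}$. Set $C^{(n)}_{\bf a}=C_{\bf a}\times\cdots\times C_{\bf a}$ ($n$ factors). $1_E$ is the characteristic function of $E$ and $I_n$ the identity matrix. For a uniformly elliptic measurable $A:\mathbb{R}^n\to\mathbb{R}^{n\times n}$, the intrinsic distance is $d_A(x,y)=\sup\{u(x)-u(y)\}$, the supremum being over all $u\in C(\mathbb{R}^n)\cap W^{1,2}_{\mathrm{loc}}(\mathbb{R}^n)$ with $\langle A(z)\nabla u(z),\nabla u(z)\rangle\le1$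 for almost every $z$; and $\mathrm{Lip}_{d_A}u(x)=\limsup_{y\to x}\frac{|u(y)-u(x)|}{d_A(x,y)}$. The intrinsic distance and differential structures of $A$ are said to coincide if for every Lipschitz function $u$ on $\mathbb{R}^n$ one has $(\mathrm{Lip}_{d_A}u(x))^2=\langle A(x)\nabla u(x),\nabla u(x)\rangle$ for almost every $x\in\mathbb{R}^n$. *)

(* Defs.v *)
From HB Require Import structures.
From mathcomp Require Import all_boot all_order all_algebra.
From mathcomp Require Import all_classical all_reals all_analysis.

Set Implicit Arguments.
Unset Strict Implicit.
Unset Printing Implicit Defensive.

Import Order.TTheory GRing.Theory Num.Theory.
Import numFieldNormedType.Exports.

Local Open Scope classical_set_scope.
Local Open Scope ring_scope.

(* The Borel sigma-algebra of R^n, in the form of the sigma-algebra generated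
   by the coordinate functions, as for [n.-tuple T] in the library. *)
Section measurable_rV.
Context {d} {T : measurableType d}.
Variable n : nat.

Let coors : 'I_n -> 'rV[T]_n -> T := fun i x => x ord0 i.

Let rV_set0 : g_sigma_preimage coors set0.
Proof. exact: sigma_algebra0. Qed.

Let rV_setC A : g_sigma_preimage coors A -> g_sigma_preimage coors (~` A).
Proof. exact: sigma_algebraC. Qed.

Let rV_bigcup (F : _^nat) : (forall i, g_sigma_preimage coors (F i)) ->
  g_sigma_preimage coors (\bigcup_i (F i)).
Proof. exact: sigma_algebra_bigcup. Qed.

HB.instance Definition _ := @isMeasurable.Build (measure_tuple_display d)
  'rV[T]_n (g_sigma_preimage coors) rV_set0 rV_setC rV_bigcup.

End measurable_rV.

Lemma measurable_coord d (T : measurableType d) n (i : 'I_n) :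
  measurable_fun [set: 'rV[T]_n] (fun x => x ord0 i).
Proof.
move=> _ Y mY; rewrite setTI; apply: sub_sigma_algebra => /=.
rewrite -bigcup_seq/=; exists i => /=; first by rewrite mem_index_enum.
by exists Y => //; rewrite setTI.
Qed.

Lemma measurable_fun_rVP d1 d2 (T1 : measurableType d1) (T2 : measurableType d2)
    n (f : T1 -> 'rV[T2]_n) :
  measurable_fun [set: T1] f <->
  forall i, measurable_fun [set: T1] (fun x => f x ord0 i).
Proof.
split=> [mf i|mf].
  exact: (measurableT_comp (measurable_coord i) mf).
move=> _ Y mY; rewrite setTI.
have /(_ _ mY) : @measurable _ 'rV[T2]_n `<=` [set A | measurable (f @^-1` A)].
  apply: smallest_sub.
    split => /=.
    - by rewrite preimage_set0; exact: measurable0.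
    - by move=> A mA; rewrite setTD preimage_setC; exact: measurableC.
    - by move=> F mF; rewrite preimage_bigcup; exact: bigcupT_measurable.
  case: n => [|n] in f mf Y mY *; first by rewrite big_ord0.
  rewrite -bigcup_mkord_ord; apply: bigcup_sub => i Ii A [B mB <-] /=.
  by rewrite setTI; have := mf (inord i) measurableT B mB; rewrite setTI.
exact.
Qed.

Section lebesgue_measure_rV.
Context {R : realType}.

Definition rV_cons n (p : measurableTypeR R * 'rV[R]_n) : 'rV[R]_n.+1 :=
  row_mx (const_mx p.1 : 'rV[R]_1) p.2.

Lemma measurable_rV_cons n : measurable_fun setT (@rV_cons n).
Proof.
apply/measurable_fun_rVP => i.
case: (split_ordP (i : 'I_(1 + n))) => j ->.
- rewrite [X in measurable_fun _ X](_ : _ = fst); first exact: measurable_fst.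
  apply/funext => p.
  by rewrite [LHS](row_mxEl (const_mx p.1 : 'rV_1) p.2 ord0 j) mxE.
- rewrite [X in measurable_fun _ X](_ : _ = (fun v : 'rV[R]_n => v ord0 j) \o snd).
    by apply: measurableT_comp => //; exact: measurable_coord.
  by apply/funext => p; exact: (row_mxEr (const_mx p.1 : 'rV_1) p.2 ord0 j).
Qed.

Definition lebesgue_measure_rVS n
    (mu : {sigma_finite_measure set 'rV[R]_n -> \bar R}) :
    set 'rV[R]_n.+1 -> \bar R :=
  pushforward (@lebesgue_measure R \x mu)%E (@rV_cons n).

HB.instance Definition _ n mu := Measure.copy (@lebesgue_measure_rVS n mu)
  (measure_function_pushforward__canonical__measure_function_Measure
      [the {measure set (measurableTypeR R * 'rV[R]_n) -> \bar R} of 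
         (lebesgue_measure \x mu)%E] (@measurable_rV_cons n)).

Lemma sigma_finite_lebesgue_measure_rVS n
    (mu : {sigma_finite_measure set 'rV[R]_n -> \bar R}) :
  sigma_finite setT (lebesgue_measure_rVS mu).
Proof.
have /sigma_finiteP[F [TF ndF Foo]] := sigma_finiteT (@lebesgue_measure R).
have /sigma_finiteP[G [TG ndG Goo]] := sigma_finiteT mu.
pose h (v : 'rV[R]_n.+1) : measurableTypeR R * 'rV[R]_n := 
  (v ord0 ord0, rsubmx (v : 'rV[R]_(1 + n))).
have hK : cancel (@rV_cons n) h.
  move=> [x v]; rewrite /h /rV_cons row_mxKr; congr (_, _).
  rewrite /= (_ : ord0 = lshift n ord0 :> 'I_(1 + n)); last exact/val_inj.
  by rewrite [LHS](row_mxEl (const_mx x : 'rV_1) v ord0 ord0) mxE.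
have mh : measurable_fun setT h.
  apply/measurable_fun_pair; first exact: measurable_coord.
  apply/measurable_fun_rVP => j.
  rewrite [X in measurable_fun _ X](_ : _ = 
    (fun v : 'rV[R]_n.+1 => v ord0 (rshift 1 j))).
    exact: measurable_coord.
  by apply/funext => v; rewrite /= mxE.
exists (fun k => h @^-1` (F k `*` G k)).
  rewrite -preimage_bigcup predeqE => v; split=> // _.
  have [k _ Fk] : (\bigcup_i F i) (h v).1 by rewrite -TF.
  have [l _ Gl] : (\bigcup_i G i) (h v).2 by rewrite -TG.
  exists (maxn k l) => //; split.
  - by move: Fk; exact/subsetPset/ndF/leq_maxl.
  - by move: Gl; exact/subsetPset/ndG/leq_maxr.
move=> k; have [mF Fkoo] := Foo k; have [mG Gkoo] := Goo k; split.
  by rewrite -[X in measurable X]setTI; apply: mh => //; exact: measurableX.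
rewrite /lebesgue_measure_rVS /pushforward -comp_preimage.
rewrite (_ : h \o _ = id) ?preimage_id; last exact/funext.
by rewrite product_measure1E// lte_mul_pinfty// ge0_fin_numE.
Qed.

HB.instance Definition _ n mu := Measure_isSigmaFinite.Build _ _ _
  (@lebesgue_measure_rVS n mu) (sigma_finite_lebesgue_measure_rVS mu).

(* The product of n copies of the one-dimensional Lebesgue measure; on R^0 it is
   the unit mass. *)
Fixpoint lebesgue_measure_rV n :
    {sigma_finite_measure set 'rV[R]_n -> \bar R} :=
  match n with
  | 0 => [the {sigma_finite_measure set 'rV[R]_0 -> \bar R} of \d_(0 : 'rV[R]_0)]
  | m.+1 => [the {sigma_finite_measure set 'rV[R]_m.+1 -> \bar R} of
              lebesgue_measure_rVS (lebesgue_measure_rV m)]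
  end.

End lebesgue_measure_rV.

Section sobolev.
Context {R : realType} {n : nat}.
Implicit Types (u f phi : 'rV[R]_n -> R) (g : 'rV[R]_n -> 'rV[R]_n).

Local Notation mu := (@lebesgue_measure_rV R n).

Definition partial (i : 'I_n) f : 'rV[R]_n -> R := 'D_(delta_mx ord0 i) f.

Definition grad f : 'rV[R]_n -> 'rV[R]_n := fun x => \row_i partial i f x.

(* Requiring every iterated partial derivative to be differentiable everywhere
   is C^oo: differentiability of one order gives continuity of the one below. *)
Definition smooth f :=
  forall (s : seq 'I_n) (x : 'rV[R]_n), differentiable (foldr partial f s) x.

Definition test_function phi :=
  smooth phi /\ compact (closure [set x | phi x != 0]).

Definition L2loc f :=
  measurable_fun [set: 'rV[R]_n] f /\
  forall K : set 'rV[R]_n, compact K ->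
    (\int[mu]_(x in K) ((f x) ^+ 2)%:E < +oo)%E.

Definition weak_gradient u g :=
  forall phi, test_function phi -> forall i : 'I_n,
    \int[mu]_x (u x * partial i phi x) = - \int[mu]_x (g x ord0 i * phi x).

(* u is in W^{1,2}_loc and its distributional gradient is (the class of) g. *)
Definition W12loc u g :=
  [/\ L2loc u, forall i : 'I_n, L2loc (fun x => g x ord0 i) & weak_gradient u g].

End sobolev.

Section intrinsic.
Context {R : realType} {n : nat}.
Variable A : 'rV[R]_n -> 'M[R]_n.
Implicit Types (u : 'rV[R]_n -> R) (x y z v : 'rV[R]_n).

Local Notation mu := (@lebesgue_measure_rV R n).

(* <A(z) v, v>; vectors are rows, so that A(z) v is the transpose of
   A z *m v^T. *)
Definition energy z v : R := (v *m A z *m v^T) ord0 ord0.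

Definition admissible u :=
  continuous u /\
  exists g, W12loc u g /\ {ae mu, forall z, energy z (g z) <= 1}.

Definition intrinsic_dist x y : \bar R :=
  ereal_sup [set (u x - u y)%:E | u in admissible].

(* For uniformly elliptic A the distance is finite, and positive off the diagonal,
   so the conventions for division in [\bar R] play no role. *)
Definition intrinsic_Lip u x : \bar R :=
  limf_esup (fun y => `|u y - u x|%:E / intrinsic_dist x y)%E x^'.

(* A Lipschitz function is differentiable almost everywhere (Rademacher), and its
   pointwise gradient [grad u] is then also its distributional gradient. The
   library norm of 'rV[R]_n is the sup norm, which defines the same Lipschitz
   functions as the Euclidean one. *)
Definition structures_coincide :=
  forall u, lipschitz u ->
    {ae mu, forall x, (intrinsic_Lip u x ^+ 2)%E = (energy x (grad u x))%:E}.

End intrinsic.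

Section cantor_sets.
Context {R : realType}.
Implicit Types (a : R^nat) (I : R * R) (w : seq bool).

(* The interval [I.1, I.2] minus its middle open interval of relative length t:
   the left part for [false] (the letter 1), the right one for [true] (2). *)
Definition cantor_child (t : R) I (b : bool) : R * R :=
  let c := (I.1 + I.2) / 2 in
  let h := t * (I.2 - I.1) / 2 in
  if b then (c + h, I.2) else (I.1, c - h).

Fixpoint cantor_descend a k I w : R * R :=
  if w is b :: w' then cantor_descend a k.+1 (cantor_child (a k) I b) w' else I.

(* I_w, for w = i_1 ... i_m; sequences start at 0, so the ratio a_j used at step
   j is [a j.-1]. *)
Definition cantor_interval a w : set R :=
  let I := cantor_descend a 0 (0, 1) w in `[I.1, I.2].

Definition cantor_set_of a : set R :=
  \bigcap_(m in [set m | (0 < m)%N])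
    \bigcup_(w in [set w : seq bool | size w = m]) cantor_interval a w.

Definition cantor_product n a : set 'rV[R]_n :=
  [set x | forall i, cantor_set_of a (x ord0 i)].

Definition cantor_matrix n a (delta : R) : 'rV[R]_n -> 'M[R]_n :=
  fun x => (1 - delta * \1_(cantor_product a) x)%:M.

End cantor_sets.

(* Main.v *)
Require Import Defs.
From HB Require Import structures.
From mathcomp Require Import all_boot all_order all_algebra.
From mathcomp Require Import all_classical all_reals all_analysis measurable_realfun.
From mathcomp Require Import ring lra.

Set Implicit Arguments.
Unset Strict Implicit.
Unset Printing Implicit Defensive.

Import Order.TTheory GRing.Theory Num.Theory.
Import numFieldNormedType.Exports.

Local Open Scope classical_set_scope.
Local Open Scope ring_scope.

(** Write c = sqrt (1 - delta) and let C be the n-fold product of the Cantor set.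
    An admissible function has a weak gradient of length at most 1 off C and at
    most 1 / c on C.  Summability of the ratios gives the Cantor set a positive
    measure, so C has positive measure and almost every point of C is a density
    point of C; on the other hand C is closed and has empty interior.

    Let delta <= 0.  Then c >= 1 and admissible functions are slower on C.  At a
    density point x of C the distance d_A(x, y) is asymptotic to |y - x| / c:
    linear functions of slope 1 / c give the lower bound ([dist_ge_slow]), and
    mollifying an admissible function at a scale proportional to |y - x| gives the
    upper bound, since the faster set off C occupies a vanishing proportion of the
    cubes that matter ([dist_le_slow]).  At a point of the open complement of C the
    distance is locally the Euclidean one, because a cone truncated inside the
    complement is admissible ([dist_ge_fast]).  In both cases the intrinsic
    Lipschitz constant at a point of differentiability is the Euclidean one
    multiplied by the square root of the coefficient
    ([intrinsic_Lip_asymptotic]), and Lipschitz functions are differentiable almost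
    everywhere ([rademacher]).

    Let 0 < delta.  Then c < 1 and admissible functions may be faster on C, but this
    is of no use along a coordinate direction e_i: with n >= 2, every line parallel
    to e_i can be approximated by lines on which another coordinate lies in a gap
    of the Cantor set, and such lines stay away from C.  Hence
    d_A(x, x + t e_i) = |t| ([admissible_axis_increment]), and the coordinate
    function x_i has intrinsic Lipschitz constant at least 1 everywhere, whereas its
    energy on C is 1 - delta < 1 ([structures_differ]).

    Two tools carry the analysis.  Rademacher's theorem is deduced from its
    one-dimensional case by walking along the coordinate axes between points of a
    closed set on which all difference quotients are uniformly controlled; the
    one-dimensional density theorem and Tonelli show that such walks exist at almost
    every point ([closed_nonporous]).  For admissible functions, whose gradient is
    only a distribution, convolution with smooth bumps turns the bound on the weak
    gradient into a bound on increments ([weak_gradient_increment]). *)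

(** * Fubini on the slices of R^n *)

Section fubini_slices.
Context {R : realType}.
Local Notation mu := (@lebesgue_measure_rV R _).
Local Notation la := (@lebesgue_measure R).

Definition rV_tail n (x : 'rV[R]_n.+1) : 'rV[R]_n := \row_j x ord0 (lift ord0 j).

Lemma rV_cons0 n (p : R * 'rV[R]_n) : rV_cons p ord0 ord0 = p.1.
Proof.
rewrite /rV_cons (_ : ord0 = lshift n ord0 :> 'I_(1 + n)); last exact/val_inj.
by rewrite [LHS](row_mxEl (const_mx p.1 : 'rV_1) p.2 ord0 ord0) mxE.
Qed.

Lemma rV_consS n (p : R * 'rV[R]_n) j : rV_cons p ord0 (lift ord0 j) = p.2 ord0 j.
Proof.
rewrite /rV_cons (_ : lift ord0 j = rshift 1 j :> 'I_(1 + n)); last exact/val_inj.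
by rewrite [LHS](row_mxEr (const_mx p.1 : 'rV_1) p.2 ord0 j).
Qed.

Lemma rV_cons_eta n (x : 'rV[R]_n.+1) : rV_cons (x ord0 ord0, rV_tail x) = x.
Proof.
apply/rowP => i; have [j ->|->] := unliftP ord0 i; last by rewrite rV_cons0.
by rewrite rV_consS mxE.
Qed.

Lemma rV_consD n (p q : R * 'rV[R]_n) :
  rV_cons (p.1 + q.1, p.2 + q.2) = rV_cons p + rV_cons q.
Proof.
apply/rowP => i; have [j ->|->] := unliftP ord0 i.
  by rewrite [RHS]mxE !rV_consS mxE.
by rewrite [RHS]mxE !rV_cons0.
Qed.

Lemma rV_cons_shift0 n (v : 'rV[R]_n) t :
  rV_cons (t, v) = rV_cons (0, v) + t *: delta_mx ord0 ord0.
Proof.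
apply/rowP => i; rewrite [RHS]mxE; have [j ->|->] := unliftP ord0 i.
  by rewrite !rV_consS !mxE /= mulr0 addr0.
by rewrite !rV_cons0 !mxE /= mulr1 add0r.
Qed.

Lemma rV_cons_shiftS n s (v : 'rV[R]_n) t j :
  rV_cons (s, v + t *: delta_mx ord0 j) =
  rV_cons (s, v) + t *: delta_mx ord0 (lift ord0 j).
Proof.
apply/rowP => i; rewrite [RHS]mxE; have [k ->|->] := unliftP ord0 i.
  by rewrite !rV_consS /= !mxE (inj_eq lift_inj).
by rewrite !rV_cons0 !mxE /= mulr0 addr0.
Qed.

Lemma lebesgue_measure_rVSE n (A : set 'rV[R]_n.+1) :
  mu A = ((la \x mu) (@rV_cons R n @^-1` A))%E.
Proof. by []. Qed.

Lemma measurable_shift n (y : 'rV[R]_n) :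
  measurable_fun setT (fun x : 'rV[R]_n => x + y).
Proof.
apply/(measurable_fun_rVP (fun x : 'rV[R]_n => x + y)) => i.
under eq_fun do rewrite mxE.
by apply: measurable_funD => //; exact: measurable_coord.
Qed.

Lemma measurable_shiftR (y : R) : measurable_fun setT (fun t : R => t + y).
Proof. by apply: measurable_funD. Qed.

Lemma measurable_line n (x y : 'rV[R]_n) :
  measurable_fun setT (fun t : R => x + t *: y).
Proof.
apply/(measurable_fun_rVP (fun t : R => x + t *: y)) => i.
under eq_fun do rewrite !mxE.
by apply: measurable_funD => //; apply: measurable_funM.
Qed.

(** Tonelli on the coordinate i: peeling off the coordinates before i one at a
    time reduces to the case where i is the first factor of the product. *)
Lemma slice_null n (i : 'I_n) (A : set 'rV[R]_n) : measurable A ->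
  (forall x, la [set t | A (x + t *: delta_mx ord0 i)] = 0%E) -> mu A = 0%E.
Proof.
elim: n i A => [[]//|n IH] i A mA A0; rewrite lebesgue_measure_rVSE.
have mB : measurable (@rV_cons R n @^-1` A).
  by rewrite -[X in measurable X]setTI; exact: measurable_rV_cons.
have [j ij|i0] := unliftP ord0 i.
  rewrite /product_measure1 /= integral0_eq// => s _ /=.
  apply: (IH j); first exact: measurable_xsection.
  move=> v; rewrite -[RHS](A0 (rV_cons (s, v))); congr (la _).
  apply/seteqP; split => t /=; rewrite ij -rV_cons_shiftS /xsection /=.
    by move/set_mem.
  by move=> At; apply/mem_set.
rewrite -[LHS]/(product_measure1 la mu _).
have -> : product_measure1 la mu (@rV_cons R n @^-1` A) =
   product_measure2 la mu (@rV_cons R n @^-1` A).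
  apply: product_measure_unique => // A1 A2 mA1 mA2.
  exact: product_measure2E.
rewrite /product_measure2 /= integral0_eq// => v _ /=.
rewrite -[RHS](A0 (rV_cons (0, v))); congr (la _).
by apply/seteqP; split => t /=; rewrite /ysection /= i0 -rV_cons_shift0;
  [move/set_mem|move=> At; apply/mem_set].
Qed.

Lemma measure_box n (A : 'I_n -> set R) : (forall i, measurable (A i)) ->
  measurable [set x : 'rV[R]_n | forall i, A i (x ord0 i)] /\
  mu [set x : 'rV[R]_n | forall i, A i (x ord0 i)] = (\prod_(i < n) la (A i))%E.
Proof.
move=> mA; have mB m (B : 'I_m -> set R) : (forall i, measurable (B i)) ->
    measurable [set x : 'rV[R]_m | forall i, B i (x ord0 i)].
  move=> mB; rewrite [X in measurable X](_ : _ =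
      \bigcap_(i in [set: 'I_m]) (fun x : 'rV[R]_m => x ord0 i) @^-1` B i).
    apply: fin_bigcap_measurable => // i _.
    by rewrite -[X in measurable X]setTI; exact: measurable_coord.
  by apply/seteqP; split => x /=; [move=> Bx i _; exact: Bx|move=> Bx i; exact: Bx].
split; first exact: mB.
elim: n A mA => [|n IH] A mA.
  rewrite big_ord0 /= diracE mem_set//=; by case.
rewrite lebesgue_measure_rVSE big_ord_recl -IH//.
have mT := mB n (fun i => A (lift ord0 i)) (fun i => mA _).
rewrite -(@product_measure1E _ _ _ _ _ la mu _ _ (mA ord0) mT).
congr (product_measure1 la mu _); apply/seteqP; split => -[s v] /=.
  move=> Asv; split; first by have := Asv ord0; rewrite rV_cons0.
  by move=> i; have := Asv (lift ord0 i); rewrite rV_consS.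
move=> [As Av] i; have [j ->|->] := unliftP ord0 i.
  by rewrite rV_consS.
by rewrite rV_cons0.
Qed.

Lemma lebesgue_measure_translation (A : set R) (y : R) : measurable A ->
  la [set t | A (t + y)] = la A.
Proof.
move=> mA; pose sh := fun t : measurableTypeR R => (t + y : measurableTypeR R).
have msh : measurable_fun setT sh by apply: measurable_funD.
rewrite -[LHS]/(pushforward la sh A).
apply/esym; apply: (@lebesgue_measure_unique R (pushforward la sh)) => //.
move=> X [[a b] _ <-].
have E : sh @^-1` `]a, b]%classic = `]a - y, b - y]%classic.
  by apply/seteqP; split => t; rewrite /sh /= !in_itv/= ltrBlDr lerBrDr.
rewrite -[RHS]/(la (sh @^-1` `]a, b]%classic)) E -[LHS]/(la `]a, b]%classic).
rewrite !lebesgue_measure_itv /= !lte_fin ltrD2r.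
by case: ifP => // _; rewrite -!EFinB; congr (_%:E); ring.
Qed.

(** Both measures agree on the boxes A1 x A2 of the recursive product, which
    determine a product measure. *)
Lemma lebesgue_measure_rV_translation n (y : 'rV[R]_n) (A : set 'rV[R]_n) :
  measurable A -> mu [set x | A (x + y)] = mu A.
Proof.
elim: n y A => [|n IH] y A mA.
  congr (mu _); apply/seteqP.
  by split=> x /=; rewrite (_ : x + y = x) //; apply/rowP => -[].
rewrite !lebesgue_measure_rVSE.
have mB : measurable (@rV_cons R n @^-1` A).
  by rewrite -[X in measurable X]setTI; exact: measurable_rV_cons.
pose sh := fun p : measurableTypeR R * 'rV[R]_n =>
  ((p.1 + y ord0 ord0, p.2 + rV_tail y) : measurableTypeR R * 'rV[R]_n).
have msh : measurable_fun setT sh.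
  apply/measurable_fun_pair.
    by apply: measurable_funD => //; exact: measurable_fst.
  by apply: (measurableT_comp (measurable_shift _)); exact: measurable_snd.
rewrite (_ : _ @^-1` [set x | A (x + y)] = sh @^-1` (@rV_cons R n @^-1` A)).
  rewrite -[LHS]/(pushforward (la \x mu)%E sh _).
  apply/esym; apply: (@product_measure_unique _ _ _ _ _ _ _ (pushforward (la \x mu)%E
    sh)) => // A1 A2 mA1 mA2.
  have E : sh @^-1` (A1 `*` A2) = [set t | A1 (t + y ord0 ord0)] `*`
     [set v | A2 (v + rV_tail y)] by apply/seteqP; split => -[].
  rewrite -[LHS]/(product_measure1 la mu (sh @^-1` (A1 `*` A2))) E.
  rewrite product_measure1E.
  - by congr (_ * _)%E; [exact: lebesgue_measure_translation|exact: IH].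
  - rewrite -[X in measurable X]setTI.
    exact: (measurable_shiftR (y ord0 ord0) measurableT mA1).
  - by rewrite -[X in measurable X]setTI; exact: measurable_shift.
have E s v : rV_cons (s, v) + y = rV_cons (s + y ord0 ord0, v + rV_tail y).
  by rewrite -{1}(rV_cons_eta y) -rV_consD.
by apply/seteqP; split => -[s v] /=; rewrite /sh /= E.
Qed.

End fubini_slices.

(** * Topology and measurability in R^n *)

Section euclidean_topology.
Context {R : realType}.
Local Notation mu := (@lebesgue_measure_rV R _).
Local Notation la := (@lebesgue_measure R).

Lemma coord_le_norm n (x : 'rV[R]_n) i : `|x ord0 i| <= `|x|.
Proof.
rewrite [leRHS]/Num.norm /= mx_normrE; apply/bigmax_geP; right.
by exists (ord0, i).
Qed.

Lemma rV_norm_le n (x : 'rV[R]_n) r : 0 <= r ->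
  (forall i, `|x ord0 i| <= r) -> `|x| <= r.
Proof.
move=> r0 xr; rewrite [leLHS]/Num.norm /= mx_normrE; apply/bigmax_leP; split => //.
by move=> [i j] _ /=; rewrite ord1; exact: xr.
Qed.

Lemma rV_norm_lt n (x : 'rV[R]_n) r : 0 < r ->
  (forall i, `|x ord0 i| < r) -> `|x| < r.
Proof.
move=> r0 xr; rewrite [ltLHS]/Num.norm /= mx_normrE; apply/bigmax_ltP; split => //.
by move=> [i j] _ /=; rewrite ord1; exact: xr.
Qed.

Lemma norm_delta n (i : 'I_n) (t : R) : `|t *: (delta_mx ord0 i : 'rV[R]_n)| = `|t|.
Proof.
apply/eqP; rewrite eq_le; apply/andP; split.
  apply: rV_norm_le => // j; rewrite !mxE /=.
  by case: eqP => _; rewrite ?mulr1 ?mulr0 ?normr0.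
by have := coord_le_norm (t *: (delta_mx ord0 i : 'rV[R]_n)) i;
   rewrite !mxE !eqxx mulr1.
Qed.

Lemma nbhs_rVP n (x : 'rV[R]_n) (A : set 'rV[R]_n) :
  nbhs x A <-> exists2 e : R, 0 < e & forall y, `|y - x| < e -> A y.
Proof.
split.
  move=> /(@nbhs_normP _ 'rV[R]_n)[e e0 eA]; exists e => // y ye.
  by apply: eA; rewrite /= distrC.
move=> [e e0 eA]; apply/(@nbhs_normP _ 'rV[R]_n); exists e => // y /= ye.
by apply: eA; rewrite distrC.
Qed.

Lemma measurable_cube n (z : 'rV[R]_n) (r : R) : measurable [set x | `|x - z| < r].
Proof.
have [r0|r0] := ltP 0 r; last first.
  have -> : [set x : 'rV[R]_n | `|x - z| < r] = set0.
    apply/seteqP; split => // x /=.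
    by rewrite ltNge (le_trans r0).
  exact: measurable0.
have -> : [set x | `|x - z| < r] = [set x | forall i, ball (z ord0 i) r (x ord0 i)].
  apply/seteqP; split=> x /= xz.
    move=> i; rewrite /ball /= distrC.
    by apply: le_lt_trans xz; have := coord_le_norm (x - z) i; rewrite !mxE.
  by apply: rV_norm_lt => // i; rewrite !mxE distrC; exact: xz.
apply: (measure_box (A := fun i => ball (z ord0 i) r) _).1 => i.
exact: measurable_ball.
Qed.

(** The Borel sets of the product topology are those generated by the
    coordinates, because the cubes with rational data form a countable base. *)
Lemma open_measurable_rV n (U : set 'rV[R]_n) : open U -> measurable U.
Proof.
move=> oU.
pose c (q : 'rV[rat]_n * rat) : set 'rV[R]_n :=
  [set x | `|x - map_mx ratr q.1| < ratr q.2].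
rewrite (_ : U = \bigcup_q (if `[< c q `<=` U >] then c q else set0)).
  apply: countable_bigcupT_measurable => // q.
  by case: ifP => // _; exact: measurable_cube.
apply/seteqP; split => [x Ux|x [q _]]; last first.
  by case: asboolP => // cU; exact: cU.
have /nbhs_rVP[e e0 eU] : nbhs x U by exact: open_nbhs_nbhs.
have e2 : 0 < e / 2 by rewrite divr_gt0.
have [r] := rat_in_itvoo e2; rewrite in_itv/= => /andP[r0 re].
have /choice[q qP] : forall i : 'I_n, exists q : rat,
    x ord0 i < ratr q < x ord0 i + ratr r.
  move=> i; have xr : x ord0 i < x ord0 i + ratr r by rewrite ltrDl.
  by have [q] := rat_in_itvoo xr; rewrite in_itv/=; exists q.
have xq : c (\row_i q i, r) x.
  apply: rV_norm_lt => // i; rewrite !mxE distrC.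
  by have /andP[? ?] := qP i; rewrite ltr_norml; apply/andP; split; lra.
exists (\row_i q i, r) => //; case: asboolP => // -[]; move=> y /= yq.
apply: eU.
rewrite -(subrKA (map_mx ratr (\row_i q i))) (le_lt_trans (ler_normD _ _))//.
rewrite (_ : e = e / 2 + e / 2); last by rewrite -splitr.
by apply: ltrD; apply: lt_trans re; [exact: yq|rewrite distrC; exact: xq].
Qed.

Lemma closed_measurable_rV n (U : set 'rV[R]_n) : closed U -> measurable U.
Proof. by move/closed_openC/open_measurable_rV/measurableC; rewrite setCK. Qed.

Lemma continuous_measurable_rV n (f : 'rV[R]_n -> R) :
  continuous f -> measurable_fun setT f.
Proof.
move=> /continuousP cf; apply: (measurability _ (RGenOpens.measurableE R)) => //.
move=> _ [_ [a [b ->] <-]]; rewrite setTI; apply: open_measurable_rV.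
exact/cf/interval_open.
Qed.

Lemma measure_cube n (z : 'rV[R]_n) (r : R) : 0 <= r ->
  measurable [set x | `|x - z| <= r] /\
  mu [set x | `|x - z| <= r] = ((2 * r) ^+ n)%:E.
Proof.
move=> r0; have -> : [set x | `|x - z| <= r] = [set x | forall i,
    `[z ord0 i - r, z ord0 i + r]%classic (x ord0 i)].
  apply/seteqP; split => x /= xz.
    move=> i; rewrite in_itv/= -ler_distlC distrC.
    by apply: le_trans xz; have := coord_le_norm (x - z) i; rewrite !mxE.
  apply: rV_norm_le => // i; rewrite !mxE distrC ler_distlC.
  by have := xz i; rewrite in_itv.
have [mB ->] := @measure_box R n (fun i => `[z ord0 i - r, z ord0 i + r]%classic)
    (fun i => measurable_itv _).
split=> //; rewrite (eq_bigr (fun=> (2 * r)%:E)).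
  by rewrite prodEFin prodr_const card_ord.
move=> i _; rewrite lebesgue_measure_itv/= lte_fin.
case: ltP => h; first by rewrite -EFinB; congr EFin; lra.
have -> : r = 0 by lra.
by rewrite mulr0.
Qed.

Lemma compact_in_cube n (K : set 'rV[R]_n) : compact K ->
  exists2 r : R, 0 <= r & K `<=` [set x | `|x - 0| <= r].
Proof.
move/compact_bounded => [M [_ /(_ (`|M| + 1))]] h.
exists (`|M| + 1); first by rewrite addr_ge0.
by move=> x Kx /=; rewrite subr0; apply: h => //;
  rewrite (le_lt_trans (ler_norm M))// ltrDl.
Qed.

Lemma compact_closed_rV n (K : set 'rV[R]_n) : compact K -> closed K.
Proof. by apply: compact_closed; exact: norm_hausdorff. Qed.

Lemma integrable_bounded_support n (f : 'rV[R]_n -> R) (z : 'rV[R]_n) (M r : R) :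
  measurable_fun setT f -> (forall x, `|f x| <= M) ->
  (forall x, r < `|x - z| -> f x = 0) -> mu.-integrable setT (EFin \o f).
Proof.
move=> mf fM f0; have r0 : 0 <= Num.max r 0 by rewrite le_max lexx orbT.
have [mB BE] := measure_cube z r0.
have /measurable_bounded_integrable : (mu [set x | (`|x - z| <= Num.max r 0)%R] < +oo)%E.
  by rewrite BE ltry.
move=> /(_ f mB (measurable_funTS mf)); rewrite -/mu => H.
have {}H : mu.-integrable [set x | `|x - z| <= Num.max r 0] (EFin \o f).
  apply: H; exists M; split; first exact: num_real.
  by move=> A MA x _ /=; rewrite (le_trans (fM x))// ltW.
rewrite (_ : EFin \o f = (EFin \o f) \_ [set x | `|x - z| <= Num.max r 0]).
  by apply/(integrable_mkcond _ mB).
apply/funext => x; rewrite patchE; case: ifPn => // /negP xB /=.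
rewrite f0// ltNge; apply/negP => xr; apply: xB; apply/mem_set => /=.
by rewrite le_max xr.
Qed.

Lemma Rintegral_shift n (f : 'rV[R]_n -> R) (y : 'rV[R]_n) :
  measurable_fun setT f ->
  mu.-integrable setT (fun x => (f (x + y))%:E) ->
  \int[mu]_x f (x + y) = \int[mu]_x f x.
Proof.
move=> mf fi; rewrite /Rintegral; congr fine.
have mEf : measurable_fun setT (EFin \o f) by exact/measurable_EFinP.
have := @integral_pushforward _ _ _ _ R _ (measurable_shift y) mu setT
  (EFin \o f) mEf fi measurableT.
rewrite preimage_setT => <-.
apply: eq_measure_integral; first exact: measurable_shift.
move=> mshift A mA _.
exact: lebesgue_measure_rV_translation.
Qed.

#[global] Instance ae_rV_filter n :
  Filter (almost_everywhere (@lebesgue_measure_rV R n)).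
Proof. exact: (ae_filter_ringOfSetsType (@lebesgue_measure_rV R n)). Qed.

Lemma ae_coord n (i : 'I_n) (P : R -> Prop) :
  {ae la, forall t, P t} -> {ae mu, forall x : 'rV[R]_n, P (x ord0 i)}.
Proof.
move=> [N [mN N0 PN]]; exists [set x : 'rV[R]_n | N (x ord0 i)]; split.
- by rewrite -[X in measurable X]setTI; exact: measurable_coord.
- apply: (slice_null (i := i)); first by rewrite -[X in measurable X]setTI;
    exact: measurable_coord.
  move=> x; rewrite -[RHS]N0 -[RHS](lebesgue_measure_translation (x ord0 i) mN).
  by congr (la _); apply/seteqP; split => t /=; rewrite !mxE !eqxx mulr1 addrC.
- by move=> x /= xP; exact: PN.
Qed.

End euclidean_topology.

(** * Differentiability of Lipschitz functions on the line *)

Section contraction_ae_derivable.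
Context {R : realType}.
Local Notation la := (@lebesgue_measure R).
Variable F : R -> R.
Hypothesis F_nd : forall x y, x <= y -> 0 <= F y - F x <= y - x.

Let G x := x - F x.

Let F_dist x y : `|F x - F y| <= `|x - y|.
Proof.
wlog xy : x y / x <= y.
  by move=> h; have [/h//|/ltW/h] := leP x y; rewrite distrC (distrC y).
have /andP[F0 F1] := F_nd xy.
by rewrite distrC ger0_norm// distrC ger0_norm// subr_ge0.
Qed.

Let F_nondecreasing : nondecreasing F.
Proof. by move=> x y /F_nd/andP[]; rewrite subr_ge0. Qed.

Let F_continuous : continuous F.
Proof.
move=> x; apply/cvgrPdist_le => e e0; near=> y.
apply: le_trans (F_dist _ _) _.
by near: y; apply: cvgr_dist_le => //; exact: cvg_id.
Unshelve. all: by end_near. Qed.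

Let G_nondecreasing : nondecreasing G.
Proof. by move=> x y /F_nd/andP[_]; rewrite /G; lra. Qed.

Let G_continuous : continuous G.
Proof. by move=> x; apply: cvgB; [exact: cvg_id|exact: F_continuous]. Qed.

HB.instance Definition _ := isCumulative.Build R _ R F F_nondecreasing
  (right_continuousW F_continuous).
HB.instance Definition _ := isCumulative.Build R _ R G G_nondecreasing
  (right_continuousW G_continuous).

Let SF := lebesgue_stieltjes_measure F.
Let SG := lebesgue_stieltjes_measure G.

Let stieltjes_itv (H : cumulative R R) a b : a <= b ->
  lebesgue_stieltjes_measure H `]a, b]%classic = (H b - H a)%:E.
Proof.
move=> ab; rewrite /lebesgue_stieltjes_measure /measure_extension.
rewrite measurable_mu_extE/=; last by exists (a, b).
rewrite wlength_itv/= lte_fin; case: ltP => // ba.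
by rewrite (_ : b = a) ?subrr//; apply/eqP; rewrite eq_le ab ba.
Qed.

(** The Stieltjes measures of F and of x - F x agree with the Lebesgue measure,
    once added, on half-open intervals, hence everywhere. *)
Let SF_le (A : set R) : measurable A -> (SF A <= la A)%E.
Proof.
move=> mA; rewrite (@lebesgue_measure_unique _ (measure_add SF SG) _ A)//.
  by rewrite [X in (_ <= X)%E]measure_addE leeDl.
move=> X [[a b] _ <-] /=; rewrite [RHS]measure_addE.
have [ab|ba] := leP a b.
  transitivity ((F b - F a)%:E + (G b - G a)%:E)%E; last first.
    by congr (_ + _)%E; apply/esym/stieltjes_itv.
  rewrite lebesgue_measure_itv/= lte_fin /G -EFinD.
  case: ltP => [_|ba]; first by rewrite -?EFinB; congr EFin; ring.
  by rewrite (_ : b = a); [congr EFin; ring|lra].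
by rewrite set_itv_ge ?measure0 ?adde0// bnd_simp -leNgt ltW.
Qed.

(** The measure dF, cut off to a bounded interval to make it finite, has a density
    with respect to the Lebesgue measure, and F is a primitive of this density. *)
Let derivable_in (N : R) : 0 < N ->
  {ae la, forall x, - N < x < N -> derivable F x 1}.
Proof.
move=> N0; pose D : set R := `]- N, N]%classic.
have mD : measurable (D : set (measurableTypeR R)) by exact: measurable_itv.
have Doo : (SF D < +oo)%E.
  apply: le_lt_trans (SF_le mD) _.
  by rewrite /D lebesgue_measure_itv/=; case: ifP => _; rewrite -?EFinB ltry.
pose nu := mfrestr mD Doo.
have nula : (nu `<< la)%E.
  apply/null_content_dominatesP => A mA A0; apply/eqP.
  rewrite eq_le measure_ge0 andbT -A0.
  apply: le_trans (SF_le mA).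
  by rewrite /nu /mfrestr /mrestr le_measure ?inE//; apply: measurableI.
pose h := Radon_Nikodym_SigmaFinite.f nu la.
have hfin := Radon_Nikodym_SigmaFinite.f_fin_num nula.
have hint := Radon_Nikodym_SigmaFinite.f_integrable nula.
have hE : EFin \o (fine \o h) = h by apply/funext => x /=; rewrite fineK// hfin.
have hint' : la.-integrable setT (EFin \o (fine \o h)) by rewrite hE.
have := @FTC1 R (fine \o h) (BRight (- N)).
move=> /(_ _ _)/wrap[].
  by move=> y; apply: (integrableS measurableT) hint'.
  by apply: open_integrable_locally => //; exact: openT.
move=> /= FTC; apply: filterS FTC; first exact: (ae_filter_ringOfSetsType la).
move=> x FTC /andP[Nx xN].
have /FTC[dx _] : (BRight (- N) < BRight x)%O by rewrite bnd_simp.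
suff : derivable (fun y => F (- N) +
    \int[la]_(t in `]- N, y]) (fine \o h) t) x 1.
  apply: near_eq_derivable => //; near=> y.
  have yN : - N <= y by near: y; exact: lt_le_nbhsr.
  have yN' : y <= N by near: y; exact: lt_le_nbhsl.
  rewrite /Rintegral [X in fine X](_ : _ = nu `]- N, y]%classic); last first.
    transitivity (\int[la]_(t in `](- N)%R, y]%classic) h t)%E.
      by apply: eq_integral => t _ /=; rewrite fineK// hfin.
    exact/esym/(Radon_Nikodym_SigmaFinite.f_integral nula).
  rewrite /nu /mfrestr /mrestr (_ : _ `&` D = `]- N, y]%classic).
    by rewrite [X in fine X](stieltjes_itv F yN)/= addrC subrK.
  apply/seteqP; split => [t []//|t]; rewrite /D /= !in_itv/= => /andP[-> ty].
  by rewrite ty (le_trans ty yN').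
by apply: derivableD.
Unshelve. all: by end_near. Qed.

Lemma contraction_ae_derivable : {ae la, forall x, derivable F x 1}.
Proof.
have : {ae la, forall x, forall n : nat, - n.+1%:R < x < n.+1%:R -> derivable F x 1}.
  by apply: ae_foralln => n; exact: derivable_in.
apply: filterS; first exact: (ae_filter_ringOfSetsType la).
move=> x /(_ (Num.bound x)); apply; rewrite -ltr_norml.
by rewrite (lt_le_trans (unstable.ltr_norm_bound x))// ler_nat.
Qed.

End contraction_ae_derivable.

(** (f x + K x) / (2 K) is nondecreasing and a contraction when K bounds the
    Lipschitz constant of f. *)
Lemma lipschitz_ae_derivable {R : realType} (f : R -> R) (L : R) :
  (forall x y, `|f x - f y| <= L * `|x - y|) ->
  {ae @lebesgue_measure R, forall x, derivable f x 1}.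
Proof.
move=> fL; pose K := `|L| + 1.
have K0 : 0 < K by rewrite ltr_wpDl.
have fK x y : `|f x - f y| <= K * `|x - y|.
  by apply: le_trans (fL x y) _; rewrite ler_wpM2r// /K ler_wpDr// ler_norm.
pose F x := (2 * K)^-1 * (f x + K * x).
have : {ae @lebesgue_measure R, forall x, derivable F x 1}.
  apply: contraction_ae_derivable => x y xy.
  have yx : 0 <= y - x by rewrite subr_ge0.
  have := fK y x; rewrite [`|y - x|]ger0_norm// ler_norml => /andP[h1 h2].
  have K2 : 0 < 2 * K by rewrite mulr_gt0.
  have -> : F y - F x = (f y - f x + K * (y - x)) / (2 * K) by rewrite /F; field; lra.
  apply/andP; split; first by apply: divr_ge0; [lra|exact: ltW].
  by rewrite ler_pdivrMr//; lra.
apply: filterS; first exact: (ae_filter_ringOfSetsType (@lebesgue_measure R)).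
move=> x dF.
rewrite (_ : f = (fun y => (2 * K) *: F y - K *: y)); last first.
  by apply/funext => y; rewrite /F /GRing.scale/=; field; lra.
by apply: derivableB; apply: derivableZ => //; exact: derivable_id.
Qed.

(** * Nonporosity of closed sets *)

Section nonporosity.
Context {R : realType}.
Local Notation mu := (@lebesgue_measure_rV R _).
Local Notation la := (@lebesgue_measure R).

(** If A missed the points at distance at most c |s| from t + s, it would miss a
    fixed proportion c / 2 of the ball of radius 2 |s| around the density point t. *)
Lemma density_nonporous (A : set R) : measurable A ->
  {ae la, forall t, A t -> forall c : R, 0 < c -> exists2 d : R, 0 < d &
    forall s, `|s| < d -> exists2 s', `|s' - s| <= c * `|s| & A (t + s')}.
Proof.
move=> mA; apply: filterS (lebesgue_density mA).
  exact: (ae_filter_ringOfSetsType la).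
move=> t; rewrite indicE => + At c c_gt0; rewrite mem_set// => /= dens.
wlog c1 : c c_gt0 / c < 1.
  move=> wh; have [|c1] := ltP c 1; first exact: wh.
  have [||d d0 H] := wh (1 / 2); [lra|lra|].
  exists d => // s /H[s' s's As']; exists s' => //.
  by apply: le_trans s's _; rewrite ler_wpM2r//; lra.
have /fine_cvgP[finr /cvgrPdist_lt/(_ (c / 2))] := dens.
have c20 : 0 < c / 2 by rewrite divr_gt0.
move=> /(_ c20) near_dens.
have [d /= d0 Hd] : exists2 d : R, 0 < d & forall r, 0 < r -> r < d ->
    (1 - c / 2 < fine (la (A `&` ball t r) * (la (ball t r))^-1)%E)%R.
  have [d /= d0 H] := near_dens; exists d => // r r0 rd.
  have := H r; rewrite /ball_ /= sub0r normrN gtr0_norm// => /(_ rd r0).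
  by rewrite ltr_norml => /andP[_]; lra.
exists (d / 2); first by rewrite divr_gt0.
move=> s sd; have [->|s0] := eqVneq s 0.
  by exists 0; rewrite ?subrr ?normr0 ?mulr0// addr0.
apply: contrapT => noA.
have s_gt0 : 0 < `|s| by rewrite normr_gt0.
have cs0 : 0 < c * `|s| by rewrite mulr_gt0.
have sub : A `&` ball t (2 * `|s|) `<=`
    ball t (2 * `|s|) `\` ball (t + s) (c * `|s|).
  move=> u [Au tu]; split => // us; apply: noA; exists (u - t).
    by move: us; rewrite /ball /= => /ltW;
      rewrite distrC [u - t - s]addrAC -addrA -opprD [_ - (s + t)]addrC [s + t]addrC addrC.
  by rewrite addrC subrK.
have subb : ball (t + s) (c * `|s|) `<=` ball t (2 * `|s|).
  move=> u; rewrite /ball /= => us.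
  rewrite (_ : t - u = (t + s - u) - s); last by ring.
  rewrite (le_lt_trans (ler_normB _ _))//.
  have cs : c * `|s| < `|s| by rewrite gtr_pMl.
  by lra.
have r2 : 0 < 2 * `|s| by rewrite mulr_gt0.
have mball x r : measurable (ball x r : set (measurableTypeR R)) by exact: measurable_ball.
have X_le : (la (A `&` ball t (2 * `|s|)) <= ((2 * `|s|) *+ 2 - (c * `|s|) *+ 2)%:E)%E.
  apply: (@le_trans _ _ (la (ball t (2 * `|s|) `\` ball (t + s) (c * `|s|)))).
    apply: le_measure => //; rewrite inE; first exact: measurableI.
    exact: measurableD.
  rewrite measureD//.
    rewrite (setIidr subb); move: (lebesgue_measure_ball t (ltW r2)) => /= ->.
    by move: (lebesgue_measure_ball (t + s) (ltW cs0)) => /= ->.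
  by move: (lebesgue_measure_ball t (ltW r2)) => /= ->; rewrite ltry.
have Xfin : la (A `&` ball t (2 * `|s|)) \is a fin_num.
  by rewrite ge0_fin_numE// (le_lt_trans X_le)// ltry.
have := Hd (2 * `|s|) r2; rewrite -ltr_pdivlMl// mulrC => /(_ sd).
move: X_le; rewrite -(fineK Xfin) lee_fin; set X := fine _ => X_le.
move: (lebesgue_measure_ball t (ltW r2)) => /= ->.
rewrite inver mulrn_eq0 /= gt_eqF//= ltr_pdivlMr ?mulrn_wgt0//.
by move=> h; rewrite (mulr2n (2 * `|s|)) in h X_le; rewrite (mulr2n (c * `|s|)) in X_le;
  lra.
Qed.

(** Compactness of [a, b]: if no point x + s v lies in A, the same holds with a
    uniform margin in s, hence for all points near x. *)
Lemma closed_thickening n (A : set 'rV[R]_n) (v : 'rV[R]_n) (a b : R) :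
  closed A -> closed [set x | exists2 s, a <= s <= b & A (x + s *: v)].
Proof.
move=> cA; rewrite -openC openE => x /= nx.
have cov : near_covering `[a, b]%classic.
  by apply/compact_near_coveringP; exact: segment_compact.
have : \forall y \near x, `[a, b]%classic `<=` (fun s => ~ A (y + s *: v)).
  apply: (cov _ (nbhs x) (fun y s => ~ A (y + s *: v))) => s sab.
  have nA : ~ A (x + s *: v).
    by move=> Axs; apply: nx; exists s => //; move: sab; rewrite /= in_itv.
  have /nbhs_rVP[e e0 eA] : nbhs (x + s *: v) (~` A).
    by apply: open_nbhs_nbhs; split => //; exact: closed_openC.
  have v0 : 0 < `|v| + 1 by rewrite ltr_wpDl.
  exists ([set s' | `|s - s'| < e / 2 / (`|v| + 1)], [set y | `|y - x| < e / 2]) => /=.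
    split.
      apply: (@nbhsx_ballx _ _ s (e / 2 / (`|v| + 1))).
      by rewrite !divr_gt0.
    by apply/nbhs_rVP; exists (e / 2) => //; rewrite divr_gt0.
  move=> [s' y] /= [s's yx]; apply: eA.
  rewrite (_ : _ - _ = (y - x) - (s - s') *: v); last first.
    by apply/rowP => i; rewrite !mxE; ring.
  rewrite (le_lt_trans (ler_normB _ _))// normrZ [ltRHS]splitr ltr_leD//.
  rewrite (@le_trans _ _ (`|s - s'| * (`|v| + 1)))//.
    by rewrite ler_wpM2l// lerDl.
  by rewrite -ler_pdivlMr// ltW.
apply: filterS => y Hy [s sab Ays].
by apply: (Hy s) => //=; rewrite in_itv.
Qed.

(** Almost every point of a closed set is not a porosity point.  The coordinates
    are added one at a time: one-dimensional density on the lines parallel to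
    e_k shows that almost every point of A lies in one of the closed sets
    thick m of points from which A is nearly reached along e_k at every scale
    below 1/(m+1), and these sets are again nonporous in the first k
    coordinates. *)
Lemma closed_nonporous_prefix n k (A : set 'rV[R]_n) (c : R) : closed A -> 0 < c ->
  {ae mu, forall x, A x -> exists2 d : R, 0 < d & forall h : 'rV[R]_n, `|h| < d ->
    (forall i : 'I_n, (k <= i)%N -> h ord0 i = 0) ->
    exists2 y, A y & `|y - (x + h)| <= c * `|h|}.
Proof.
elim: k A c => [|k IH] A c cA c0.
  apply: aeW => x Ax; exists 1 => // h _ h0; exists x => //.
  have -> : h = 0 by apply/rowP => i; rewrite h0// mxE.
  by rewrite addr0 subrr normr0 mulr0.
have [kn|nk] := ltnP k n; last first.
  apply: (filterS _ (IH A c cA c0)) => x H Ax.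
  have [d d0 Hd] := H Ax; exists d => // h hd h0.
  by apply: Hd => // i ki; apply: h0; have := leq_trans nk ki; rewrite leqNgt ltn_ord.
pose e : 'rV[R]_n := delta_mx ord0 (Ordinal kn).
pose thick m := A `&` \bigcap_(t in [set t : R | `|t| < m.+1%:R^-1])
  [set x | exists2 s, t - c / 2 * `|t| <= s <= t + c / 2 * `|t| & A (x + s *: e)].
have cthick m : closed (thick m).
  apply: closedI => //; apply: closed_bigI => t _; exact: closed_thickening.
have c2 : 0 < c / 2 by rewrite divr_gt0.
have : {ae mu, forall x, A x -> exists m, thick m x}.
  exists (A `\` \bigcup_m thick m).
  have mN : measurable (A `\` \bigcup_m thick m).
    apply: measurableD; first exact: closed_measurable_rV.
    by apply: bigcupT_measurable => m; exact: closed_measurable_rV.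
  split=> //.
    apply: (slice_null (i := Ordinal kn)) => // x.
    have ml : measurable [set t | A (x + t *: e)].
      rewrite -[X in measurable X]setTI; apply: (measurable_line x e) => //.
      exact: closed_measurable_rV.
    apply/negligibleP.
      by rewrite -[X in measurable X]setTI; exact: (measurable_line x e).
    apply: negligibleS (density_nonporous ml).
    move=> t /= [Axt nthick] H; apply: nthick.
    have [d d0 Hd] := H Axt _ c2.
    have [m _ md] := near_infty_natSinv_lt (PosNum d0).
    exists m => //; split => // u /= um.
    have [|s' s'u As'] := Hd u; first by apply: lt_trans um _; exact: (md m (leqnn m)).
    exists s'; first by rewrite -ler_distlC distrC.
    by rewrite -addrA -scalerDl.
  by move=> x /= /not_implyP[Ax nthick]; split => // -[m _ Tm]; apply: nthick; exists m.
move=> ae1.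
have ae2 : {ae mu, forall x, forall m, thick m x ->
    exists2 d : R, 0 < d & forall h : 'rV[R]_n, `|h| < d ->
    (forall i : 'I_n, (k <= i)%N -> h ord0 i = 0) ->
    exists2 y, thick m y & `|y - (x + h)| <= c / 2 * `|h|}.
  by apply: ae_foralln => m; exact: IH.
apply: (filterS2 _ _ ae1 ae2)  => {ae1 ae2}.
move=> x H1 H2 Ax; have [m Tm] := H1 Ax; have [d d0 Hd] := H2 m Tm.
exists (Num.min d m.+1%:R^-1); first by rewrite lt_min d0 invr_gt0 ltr0n.
move=> h; rewrite lt_min => /andP[hd hm] h0.
pose hk := h ord0 (Ordinal kn).
have hkh : `|hk| <= `|h| by exact: coord_le_norm.
have h'h : `|h - hk *: e| <= `|h|.
  apply: rV_norm_le => // i; rewrite !mxE /=; have [->|ik] := eqVneq.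
    by rewrite mulr1 /hk subrr normr0.
  by rewrite mulr0 subr0; exact: coord_le_norm.
have [||y [Ay Ty] yx] := Hd (h - hk *: e).
- exact: le_lt_trans hd.
- move=> i ki; rewrite !mxE /=; have [->|ik] := eqVneq.
    by rewrite mulr1 /hk subrr.
  rewrite mulr0 subr0; apply: h0; rewrite ltn_neqAle ki andbT.
  by apply: contra ik => /eqP E; apply/eqP/val_inj.
have [|s + As] := Ty hk; first exact: le_lt_trans hm.
rewrite -ler_distlC distrC => sk.
exists (y + s *: e) => //.
have -> : y + s *: e - (x + h) = (y - (x + (h - hk *: e))) + (s - hk) *: e.
  by apply/rowP => i; rewrite !mxE; ring.
rewrite (le_trans (ler_normD _ _))// norm_delta (_ : c * _ =
  c / 2 * `|h| + c / 2 * `|h|); last first.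
  by rewrite -mulrDl -splitr.
by apply: lerD; [apply: le_trans yx _|apply: le_trans sk _]; rewrite ler_wpM2l// ltW.
Qed.

Lemma closed_nonporous n (A : set 'rV[R]_n) (c : R) : closed A -> 0 < c ->
  {ae mu, forall x, A x -> exists2 d : R, 0 < d & forall h : 'rV[R]_n, `|h| < d ->
    exists2 y, A y & `|y - (x + h)| <= c * `|h|}.
Proof.
move=> cA c0; apply: (filterS _ (closed_nonporous_prefix n cA c0)) => x H Ax.
 have [d d0 Hd] := H Ax; exists d => // h hd.
by apply: Hd => // i; rewrite leqNgt ltn_ord.
Qed.

End nonporosity.

(** * Rademacher's theorem *)

Lemma natSinv_mul_lt (R : realType) (a b : R) : 0 < b ->
  exists k : nat, a * k.+1%:R^-1 < b.
Proof.
move=> b0; exists (Num.bound (a / b)).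
rewrite ltr_pdivrMr ?ltr0n// mulrC -ltr_pdivrMr//.
by rewrite (lt_trans (unstable.ltr_bound _))// ltr_nat.
Qed.

Lemma lipschitz_rV_continuous (R : realType) n (f : 'rV[R]_n -> R) (L : R) :
  (forall x y, `|f x - f y| <= L * `|x - y|) -> continuous f.
Proof.
move=> fL x; apply/(@cvgrPdist_lt _ _ _ (nbhs x)) => eps eps0.
apply/nbhs_rVP; exists (eps / (`|L| + 1)); first by rewrite divr_gt0// ltr_wpDl.
move=> y; rewrite ltr_pdivlMr ?ltr_wpDl// => yx /=.
apply: le_lt_trans (fL x y) _; rewrite distrC; apply: le_lt_trans yx.
by rewrite mulrC ler_wpM2l// ler_wpDr// ler_norm.
Qed.

Section rademacher.
Context {R : realType} {n : nat}.
Local Notation mu := (@lebesgue_measure_rV R n).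
Local Notation la := (@lebesgue_measure R).
Variables (f : 'rV[R]_n -> R) (L : R).
Hypothesis fL : forall x y, `|f x - f y| <= L * `|x - y|.
Local Notation e i := (delta_mx ord0 i : 'rV[R]_n).

(** Rational slopes q and integer scales k, m make the points of derivability a
    Borel combination of countably many closed sets: derivability itself, stated
    with limits, gives no measurability, which Tonelli requires. *)
Let flat (i : 'I_n) (k m : nat) (q : R) := [set x | forall s, `|s| < m.+1%:R^-1 ->
  `|f (x + s *: e i) - f x - q * s| <= k.+1%:R^-1 * `|s|].

Let flat_closed i k m q : closed (flat i k m q).
Proof.
rewrite (_ : flat i k m q = \bigcap_(s in [set s : R | `|s| < m.+1%:R^-1])
    (fun x => `|f (x + s *: e i) - f x - q * s|) @^-1`
    [set y | y <= k.+1%:R^-1 * `|s|]).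
  apply: closed_bigI => s _; apply: closed_comp; last exact: closed_le.
  move=> x _; apply: (@lipschitz_rV_continuous _ _ _ (L + L)) => {}x y.
  apply: le_trans (ler_dist_dist _ _) _.
  have := fL (x + s *: e i) (y + s *: e i).
  rewrite opprD addrACA subrr addr0 mulrDl => h1; have h2 := fL x y.
  rewrite (_ : _ - _ = (f (x + s *: e i) - f (y + s *: e i)) - (f x - f y)).
    by apply: le_trans (ler_normB _ _) _; exact: lerD.
  by ring.
by apply/seteqP; split => x H s; [move=> /H|move=> /H].
Qed.

Let derivable_along i := \bigcap_k \bigcup_(mq : nat * rat) flat i k mq.1 (ratr mq.2).

Let measurable_derivable_along i : measurable (derivable_along i).
Proof.
apply: bigcapT_measurable => k; apply: countable_bigcupT_measurable => // mq.
by apply: closed_measurable_rV; exact: flat_closed.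
Qed.

Let derivable_alongP i x : derivable_along i x <-> derivable f x (e i).
Proof.
split => [H|/cvg_ex[/= l fl] k _]; last first.
  have k0 : 0 < k.+1%:R^-1 / 2 :> R by rewrite divr_gt0// invr_gt0 ltr0n.
  have [q] : exists q : rat, l < ratr q < l + k.+1%:R^-1 / 2.
    have lk : l < l + k.+1%:R^-1 / 2 by rewrite ltrDl.
    by have [q] := rat_in_itvoo lk; rewrite in_itv/=; exists q.
  move=> /andP[lq ql].
  have /cvgrPdist_lt/(_ _ k0)[d /= d0 Hd] := fl.
  have [m _ md] := near_infty_natSinv_lt (PosNum d0).
  exists (m, q) => // s /= sm; have [->|s0] := eqVneq s 0.
    by rewrite scale0r addr0 subrr mulr0 subr0 normr0 mulr0.
  have := Hd s; rewrite /ball_ /= sub0r normrN => /(_ _ s0)/wrap[].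
    by apply: lt_trans sm _; exact: (md m (leqnn m)).
  rewrite /shift/= (addrC _ x) => Hs.
  rewrite -ler_pdivrMr ?normr_gt0// -normf_div.
  have -> : (f (x + s *: e i) - f x - ratr q * s) / s =
     (s^-1 *: (f (x + s *: e i) - f x) - l) - (ratr q - l).
    by rewrite /GRing.scale/=; field.
  apply: (le_trans (ler_normB _ _)); rewrite distrC [leRHS]splitr.
  by apply: lerD; [exact: ltW|]; rewrite ger0_norm;
    [rewrite lerBlDl ltW|rewrite subr_ge0 ltW].
apply/cauchy_cvgP/cauchy_exP => eps eps0.
have [k _ kd] := near_infty_natSinv_lt (PosNum eps0).
have [[m q] _ /= Hf] := H k Logic.I.
exists (ratr q); exists (m.+1%:R^-1) => /=; first by rewrite invr_gt0 ltr0n.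
move=> s /=; rewrite /ball_ /= sub0r normrN => /Hf Hs s0.
rewrite /ball /= /shift/= (addrC _ x).
have -> : ratr q - s^-1 *: (f (x + s *: e i) - f x) =
   - ((f (x + s *: e i) - f x - ratr q * s) / s).
  by rewrite /GRing.scale/=; field.
rewrite normrN normf_div ltr_pdivrMr ?normr_gt0//.
by apply: le_lt_trans Hs _; rewrite ltr_pM2r ?normr_gt0//; exact: (kd k (leqnn k)).
Qed.

Lemma measurable_derivable i : measurable [set x | derivable f x (e i)].
Proof.
rewrite (_ : mkset _ = derivable_along i); first exact: measurable_derivable_along.
by apply/seteqP; split => x /derivable_alongP.
Qed.

Lemma lipschitz_ae_partial i : {ae mu, forall x, derivable f x (e i)}.
Proof.
exists (~` derivable_along i); split; first exact: measurableC.
  apply: (slice_null (i := i)); first exact: measurableC.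
  move=> x; apply/negligibleP.
    rewrite -[X in measurable X]setTI; apply: (measurable_line x (e i)) => //.
    exact: measurableC.
  have : {ae la, forall t, derivable (fun t : R => f (x + t *: e i) : R) t 1}.
    apply: (@lipschitz_ae_derivable _ _ L) => s t.
    apply: le_trans (fL _ _) _.
    by rewrite opprD addrACA subrr add0r -scalerBl norm_delta.
  apply: negligibleS => t /= nd dt; apply: nd; apply/derivable_alongP.
  move: dt; rewrite /derivable/= => dt.
  rewrite (_ : (fun h => _) = (fun h : R => h^-1 *:
     (((fun t : R => f (x + t *: e i)) \o shift t) (h *: (1 : R)) - f (x + t *: e i))))//.
  apply/funext => h /=; rewrite /shift /=.
  by rewrite [h *: 1]mulr1 scalerDl addrCA.
by move=> x /= nd /derivable_alongP.
Qed.

(** From a point x of the closed set where all the difference quotients are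
    uniformly close to q, one walks to x + h along the coordinate axes; each
    corner of the path is replaced by a nearby point of the same closed set,
    which exists because x is not a porosity point. *)
Lemma rademacher : {ae mu, forall x, (forall i, derivable f x (e i)) /\
  forall eps, 0 < eps -> exists2 d : R, 0 < d & forall h : 'rV[R]_n, `|h| < d ->
    `|f (x + h) - f x - \sum_i partial i f x * h ord0 i| <= eps * `|h|}.
Proof.
pose A (kmq : nat * nat * {ffun 'I_n -> rat}) :=
  \bigcap_(i in [set: 'I_n]) flat i kmq.1.1 kmq.1.2 (ratr (kmq.2 i)).
have cA p : closed (A p) by apply: closed_bigI => i _; exact: flat_closed.
have ae1 : {ae mu, forall x, forall j : nat, forall i : 'I_n, i = j :> nat ->
    derivable f x (e i)}.
  apply: ae_foralln => j; have [jn|nj] := ltnP j n; last first.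
    by apply: aeW => x i ij; move: nj; rewrite -ij leqNgt ltn_ord.
  apply: (filterS _ (lipschitz_ae_partial (Ordinal jn))) => x dx i ij.
  by rewrite (_ : i = Ordinal jn)//; exact/val_inj.
have ae2 : {ae mu, forall x, forall c p : nat,
   if unpickle p is Some p' then A p' x -> exists2 d : R, 0 < d &
     forall h : 'rV[R]_n, `|h| < d ->
     exists2 y, A p' y & `|y - (x + h)| <= c.+1%:R^-1 * `|h| else True}.
  apply: ae_foralln => c; apply: ae_foralln => p.
  case: unpickle => [p'|]; last exact: aeW.
  by apply: closed_nonporous => //; rewrite invr_gt0 ltr0n.
apply: (filterS2 _ _ ae1 ae2) => x dx por; split; first by move=> i; exact: (dx i).
move=> eps eps0.
(* the total error of the walk below is n * (2 * |L| / (c + 1) + 2 / (k + 1)) *)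
have [k0 kP] : exists k : nat, 2 * n%:R * k.+1%:R^-1 < eps / 2.
  by apply: natSinv_mul_lt; rewrite divr_gt0.
have [c0 cP] : exists c : nat, 2 * n%:R * `|L| * c.+1%:R^-1 < eps / 2.
  by apply: natSinv_mul_lt; rewrite divr_gt0.
have [m_q mqP] : exists mq : nat * {ffun 'I_n -> rat}, A (k0, mq.1, mq.2) x.
  have /choice[mq mqP] : forall i, exists mq : nat * rat, flat i k0 mq.1 (ratr mq.2) x.
    move=> i; have /derivable_alongP/(_ k0 Logic.I)[mq _] := dx i i erefl.
    by exists mq.
  exists (\max_i (mq i).1, [ffun i => (mq i).2]) => i _ s /= sm.
  rewrite ffunE; apply: mqP; apply: lt_le_trans sm _.
  by rewrite lef_pV2 ?posrE ?ltr0n// ler_nat ltnS;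
    exact: (leq_bigmax (F := fun i => (mq i).1)).
have := por c0 (pickle (k0, m_q.1, m_q.2)); rewrite pickleK => /(_ mqP)[d d0 Hd].
pose q i : R := ratr (m_q.2 i).
have qd i : `|q i - partial i f x| <= k0.+1%:R^-1.
  apply/ler_addgt0Pr => eta eta0.
  have /cvgrPdist_lt/(_ _ eta0)[r /= r0 Hr] := dx i i erefl.
  pose t := Num.min r m_q.1.+1%:R^-1.
  have t0 : 0 < t by rewrite lt_min r0 invr_gt0 ltr0n.
  have t2 : t / 2 < t by rewrite ltr_pdivrMr// ltr_pMr// ltr1n.
  have t20 : 0 < t / 2 by rewrite divr_gt0.
  move: (t2); rewrite lt_min => /andP[tr tm].
  have := Hr (t / 2); rewrite /ball_ /= sub0r normrN gtr0_norm// => /(_ tr).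
  rewrite gt_eqF// => /(_ isT); rewrite /shift/= (addrC _ x) => Ht.
  have := mqP i Logic.I (t / 2); rewrite gtr0_norm// => /(_ tm) /=.
  rewrite -/(q i) -ler_pdivrMr// -[X in _ / X](gtr0_norm t20) -normf_div => Hq.
  rewrite (_ : q i - _ = ((t / 2)^-1 *: (f (x + t / 2 *: e i) - f x) - partial i f x)
     - ((f (x + t / 2 *: e i) - f x - q i * (t / 2)) / (t / 2))); last first.
    by rewrite /GRing.scale/=; field; rewrite gt_eqF.
  apply: (le_trans (ler_normB _ _)); rewrite addrC; apply: lerD => //.
  by rewrite distrC ltW.
exists (Num.min d m_q.1.+1%:R^-1); first by rewrite lt_min d0 invr_gt0 ltr0n.
move=> h; rewrite lt_min => /andP[hd hm].
pose hj (j : nat) : 'rV[R]_n := \row_i (if (i < j)%N then h ord0 i else 0).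
have hj_le j : `|hj j| <= `|h|.
  apply: rV_norm_le => // i; rewrite mxE; case: ifP => _; first exact: coord_le_norm.
  by rewrite normr0.
have walk j : (j <= n)%N ->
    `|f (x + hj j) - f x - \sum_(i < n | (i < j)%N) q i * h ord0 i| <=
    j%:R * (2 * `|L| * c0.+1%:R^-1 + k0.+1%:R^-1) * `|h|.
  elim: j => [_|j IH jn].
    rewrite big1 ?subr0 => [|i]; last by rewrite ltn0.
    by rewrite (_ : hj 0%N = 0) ?addr0 ?subrr ?normr0 ?mul0r//; apply/rowP => i;
      rewrite !mxE.
  have [y Ay yx] := Hd (hj j) (le_lt_trans (hj_le j) hd).
  pose i0 := Ordinal jn.
  have hjS : hj j.+1 = hj j + h ord0 i0 *: e i0.
    apply/rowP => i; rewrite !mxE ltnS leq_eqVlt /=.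
    have [ij|ij] := eqVneq (nat_of_ord i) j.
      have -> : i = i0 by exact/val_inj.
      by rewrite /= ltnn eqxx add0r mulr1.
    by rewrite (_ : (i == i0) = false) ?mulr0 ?addr0//; apply/negbTE.
  rewrite (bigD1 i0)/= ?ltnS//.
  rewrite (eq_bigl (fun i : 'I_n => (i < j)%N)); last first.
    by move=> i; rewrite ltnS ltn_neqAle andbC -(inj_eq val_inj).
  set S := \sum_(i | _) _ in IH *.
  have hi : `|h ord0 i0| <= `|h| by exact: coord_le_norm.
  have s1 := fL (x + hj j.+1) (y + h ord0 i0 *: e i0).
  have s2 := fL y (x + hj j).
  have s3 : `|f (y + h ord0 i0 *: e i0) - f y - q i0 * h ord0 i0| <=
      k0.+1%:R^-1 * `|h ord0 i0| by exact: (Ay i0 Logic.I _ (le_lt_trans hi hm)).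
  have yx' : L * `|y - (x + hj j)| <= `|L| * (c0.+1%:R^-1 * `|h|).
    apply: (@le_trans _ _ (`|L| * `|y - (x + hj j)|));
      first by rewrite ler_wpM2r// ler_norm.
    rewrite ler_wpM2l//; apply: le_trans yx _; rewrite ler_wpM2l// ?invr_ge0//.
  have {s1}s1 : `|f (x + hj j.+1) - f (y + h ord0 i0 *: e i0)| <= L * `|y - (x + hj j)|.
    apply: le_trans s1 _; rewrite (_ : `|_ - _| = `|y - (x + hj j)|)// distrC.
    by congr (`|_|); rewrite hjS; apply/rowP => i; rewrite !mxE; ring.
  have s4 : k0.+1%:R^-1 * `|h ord0 i0| <=
    k0.+1%:R^-1 * `|h| by rewrite ler_wpM2l// invr_ge0.
  have IH' := IH (ltnW jn).
  rewrite (_ : _ - _ - _ = (f (x + hj j.+1) - f (y + h ord0 i0 *: e i0)) +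
    (f (y + h ord0 i0 *: e i0) - f y - q i0 * h ord0 i0) + (f y - f (x + hj j)) +
    (f (x + hj j) - f x - S)); last by ring.
  apply: (le_trans (ler_normD _ _)); apply: (le_trans (lerD (ler_normD _ _) (lexx _))).
  apply: (le_trans (lerD (lerD (ler_normD _ _) (lexx _)) (lexx _))).
  rewrite -[j.+1%:R]natr1; clear - s1 s2 s3 s4 IH' yx'.
  set u := k0.+1%:R^-1 in s3 s4 IH' *; set v := c0.+1%:R^-1 in IH' yx' *.
  move: u v s3 s4 IH' yx' => u v s3 s4 IH' yx'; lra.
have := walk n (leqnn n); rewrite (_ : hj n = h); last first.
  by apply/rowP => i; rewrite mxE ltn_ord.
rewrite (eq_bigl xpredT) => [walkn|i]; last by rewrite ltn_ord.
have qh : `|\sum_i q i * h ord0 i - \sum_i partial i f x * h ord0 i| <=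
    n%:R * k0.+1%:R^-1 * `|h|.
  rewrite -sumrB; apply: le_trans (ler_norm_sum _ _ _) _.
  rewrite -mulrA mulr_natl -[X in _ *+ X](card_ord n) -sumr_const.
  apply: ler_sum => i _; rewrite -mulrBl normrM.
  by apply: ler_pM => //; exact: coord_le_norm.
rewrite (_ : _ - _ - _ = (f (x + h) - f x - \sum_i q i * h ord0 i) +
  (\sum_i q i * h ord0 i - \sum_i partial i f x * h ord0 i)); last by ring.
apply: (le_trans (ler_normD _ _)); apply: (le_trans (lerD walkn qh)).
rewrite -mulrDl ler_wpM2r//; move: kP cP.
set u := k0.+1%:R^-1; set v := c0.+1%:R^-1; lra.
Qed.

End rademacher.

(** * The Euclidean norm and integration by parts *)

Section euclidean_norm.
Context {R : realType} {n : nat}.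
Implicit Types v w : 'rV[R]_n.

Definition dot v w : R := \sum_i v ord0 i * w ord0 i.
Definition enorm v : R := Num.sqrt (dot v v).

Lemma dotC v w : dot v w = dot w v.
Proof. by apply: eq_bigr => i _; rewrite mulrC. Qed.

Lemma dotDl u v w : dot (u + v) w = dot u w + dot v w.
Proof. by rewrite -big_split; apply: eq_bigr => i _; rewrite mxE mulrDl. Qed.

Lemma dotZl (t : R) v w : dot (t *: v) w = t * dot v w.
Proof. by rewrite mulr_sumr; apply: eq_bigr => i _; rewrite mxE mulrA. Qed.

Lemma dotNl v w : dot (- v) w = - dot v w.
Proof. by rewrite -scaleN1r dotZl mulN1r. Qed.

Lemma dotBl u v w : dot (u - v) w = dot u w - dot v w.
Proof. by rewrite dotDl dotNl. Qed.

Lemma dotDr u v w : dot w (u + v) = dot w u + dot w v.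
Proof. by rewrite !(dotC w) dotDl. Qed.

Lemma dotZr (t : R) v w : dot w (t *: v) = t * dot w v.
Proof. by rewrite !(dotC w) dotZl. Qed.

Lemma dot_ge0 v : 0 <= dot v v.
Proof. by apply: sumr_ge0 => i _; rewrite -expr2 sqr_ge0. Qed.

Lemma enorm_ge0 v : 0 <= enorm v. Proof. exact: sqrtr_ge0. Qed.
#[local] Hint Resolve enorm_ge0 dot_ge0 : core.

Lemma sqr_enorm v : enorm v ^+ 2 = dot v v.
Proof. by rewrite sqr_sqrtr. Qed.

Lemma dot_eq0 v : dot v v = 0 -> v = 0.
Proof.
move/psumr_eq0P => h; apply/rowP => i; rewrite mxE.
have /eqP := h (fun i _ => sqr_ge0 (v ord0 i)) i isT.
by rewrite -expr2 sqrf_eq0 => /eqP.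
Qed.

Lemma cauchy_schwarz v w : `|dot v w| <= enorm v * enorm w.
Proof.
rewrite -[leRHS]ger0_norm ?mulr_ge0// -ler_sqr ?nnegrE ?normr_ge0 ?mulr_ge0//.
rewrite !real_normK ?num_real// exprMn !sqr_enorm.
have [w0|w0] := eqVneq (dot w w) 0.
  by rewrite w0 mulr0 (dot_eq0 w0) (_ : dot v 0 = 0) ?expr0n// /dot big1// => i _;
    rewrite mxE mulr0.
have wp : 0 < dot w w by rewrite lt_neqAle eq_sym w0 dot_ge0.
have := dot_ge0 (dot w w *: v - dot v w *: w).
rewrite dotBl !dotZl !(dotC _ (_ - _)) !dotBl !dotZl (dotC w v).
set S := dot v w; set A := dot v v; set B := dot w w in wp *.
rewrite (_ : _ - _ = B * (A * B - S ^+ 2)); last by ring.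
by rewrite pmulr_rge0// subr_ge0.
Qed.

Lemma enormZ (t : R) v : enorm (t *: v) = `|t| * enorm v.
Proof. by rewrite /enorm dotZl dotZr mulrA -expr2 sqrtrM ?sqr_ge0// sqrtr_sqr. Qed.

Lemma enormN v : enorm (- v) = enorm v.
Proof. by rewrite -scaleN1r enormZ normrN1 mul1r. Qed.

Lemma enormB v w : enorm (v - w) = enorm (w - v).
Proof. by rewrite -enormN opprB. Qed.

Lemma enormD v w : enorm (v + w) <= enorm v + enorm w.
Proof.
rewrite -ler_sqr ?nnegrE ?addr_ge0// sqrrD !sqr_enorm dotDl !dotDr (dotC w v).
have := le_trans (ler_norm _) (cauchy_schwarz v w); rewrite mulr2n; lra.
Qed.

Lemma norm_le_enorm v : `|v| <= enorm v.
Proof.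
apply: rV_norm_le => // i; rewrite -[leLHS]ger0_norm ?normr_ge0//.
rewrite -[leRHS]ger0_norm// -ler_sqr ?nnegrE ?normr_ge0// !real_normK ?num_real// sqr_enorm.
by rewrite /dot (bigD1 i)//= -expr2 lerDl sumr_ge0// => j _; rewrite -expr2 sqr_ge0.
Qed.

Lemma enorm_le_norm v : enorm v <= n.+1%:R * `|v|.
Proof.
rewrite -ler_sqr ?nnegrE ?mulr_ge0// sqr_enorm exprMn.
apply: (@le_trans _ _ (n%:R * `|v| ^+ 2)).
  rewrite mulr_natl -[X in _ *+ X](card_ord n) -sumr_const; apply: ler_sum => i _.
  by rewrite -expr2 -real_normK ?num_real// lerXn2r ?nnegrE//; exact: coord_le_norm.
rewrite ler_wpM2r ?sqr_ge0// -natrX ler_nat expnS expn1.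
by rewrite (leq_trans (leqnSn n))// leq_pmulr.
Qed.

Lemma enorm_eq0 v : enorm v = 0 -> v = 0.
Proof. by move=> v0; apply: dot_eq0; rewrite -sqr_enorm v0 expr0n. Qed.

Lemma enorm_gt0 v : v != 0 -> 0 < enorm v.
Proof.
move=> v0; rewrite lt_neqAle enorm_ge0 andbT eq_sym.
by apply: contra v0 => /eqP/enorm_eq0 ->.
Qed.

Lemma enorm0 : enorm 0 = 0.
Proof. by rewrite /enorm /dot big1 ?sqrtr0// => i _; rewrite mxE mul0r. Qed.

Lemma dot_delta (i : 'I_n) v : dot (delta_mx ord0 i) v = v ord0 i.
Proof.
rewrite /dot (bigD1 i)//= !mxE !eqxx mul1r big1 ?addr0// => k ki.
by rewrite !mxE (negbTE ki) andbF mul0r.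
Qed.

Lemma enorm_delta (i : 'I_n) : enorm (delta_mx ord0 i) = 1.
Proof. by rewrite /enorm dot_delta mxE !eqxx sqrtr1. Qed.

Lemma energy_scalar (a : 'rV[R]_n -> R) z v :
  energy (fun z => (a z)%:M) z v = a z * enorm v ^+ 2.
Proof.
rewrite /energy mul_mx_scalar -scalemxAl mxE sqr_enorm mxE; congr (_ * _).
by apply: eq_bigr => i _; rewrite !mxE.
Qed.

End euclidean_norm.
#[global] Hint Resolve enorm_ge0 dot_ge0 : core.

Section weak_gradient_lipschitz.
Context {R : realType} {n : nat}.
Local Notation mu := (@lebesgue_measure_rV R n).
Local Notation e i := (delta_mx ord0 i : 'rV[R]_n).

(** Dominated convergence, the dominating function being M on a cube. *)
Lemma cvg_Rintegral_bounded_support (f_ : nat -> 'rV[R]_n -> R) (f : 'rV[R]_n -> R)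
    (M r : R) :
  (forall m, measurable_fun setT (f_ m)) -> measurable_fun setT f ->
  {ae mu, forall x, f_ m x @[m --> \oo] --> f x} ->
  (forall m x, `|f_ m x| <= M) -> (forall m x, r < `|x| -> f_ m x = 0) ->
  \int[mu]_x f_ m x @[m --> \oo] --> \int[mu]_x f x.
Proof.
move=> mf_ mf cf fM f0.
have M0 : 0 <= M by exact: le_trans (fM 0%N 0).
pose B := [set x : 'rV[R]_n | `|x - 0| <= `|r|].
have [mB _] := measure_cube (0 : 'rV[R]_n) (normr_ge0 r).
pose G (x : 'rV[R]_n) : R := M * \1_B x.
have mG : measurable_fun setT G.
  by apply: measurable_funM => //; exact: measurable_indic.
have iG : mu.-integrable setT (EFin \o G).
  apply: (@integrable_bounded_support _ _ _ 0 M `|r|) => // x.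
    rewrite /G indicE; case: (_ \in _); rewrite ?mulr1 ?mulr0 ?normr0//.
    by rewrite ger0_norm.
  move=> rx; rewrite /G indicE (_ : _ \in _ = false) ?mulr0//.
  by apply/negbTE/negP => /set_mem; rewrite /B /= leNgt rx.
have fG m x : `|f_ m x| <= G x.
  rewrite /G indicE; have [_|/negP xB] := boolP (x \in B); first by rewrite mulr1.
  rewrite mulr0 f0 ?normr0//; apply: le_lt_trans (ler_norm r) _.
  by rewrite ltNge; apply/negP => xr; apply: xB; apply/mem_set; rewrite /B /= subr0.
have mEf_ m : measurable_fun setT (fun x => (f_ m x)%:E) by exact/measurable_EFinP.
have mEf : measurable_fun setT (fun x => (f x)%:E) by exact/measurable_EFinP.
have cEf : {ae mu, forall x, setT x -> (f_ m x)%:E @[m --> \oo] --> (f x)%:E}.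
  by apply: filterS cf => x cf _; apply: cvg_EFin; [exact: nearW|exact: cf].
have dEf : {ae mu, forall x m, setT x -> (`|(f_ m x)%:E| <= (G x)%:E)%E}.
  by apply: aeW => x m _; rewrite lee_fin.
have [fi _] := dominated_convergence measurableT mEf_ mEf cEf iG dEf.
rewrite -(fineK (integrable_fin_num measurableT fi)) => /fine_cvgP[_ cI].
exact: cI.
Qed.

Lemma derivable_cvg_seq (f : 'rV[R]_n -> R) x i (s : R ^nat) :
  derivable f x (e i) -> s m @[m --> \oo] --> 0 -> (forall m, s m != 0) ->
  (f (x + s m *: e i) - f x) / s m @[m --> \oo] --> partial i f x.
Proof.
move=> df s0 sn0.
have := df => /cvgr_dnbhsP/(_ s (conj sn0 s0)).
by apply: cvg_trans; apply: near_eq_cvg; apply: nearW => m;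
  rewrite /= /shift/= mulrC (addrC _ x).
Qed.
(** The factor \1 makes the partial derivative a pointwise limit of difference
    quotients everywhere, hence measurable. *)
Lemma measurable_partial (f : 'rV[R]_n -> R) (L : R) i :
  (forall x y, `|f x - f y| <= L * `|x - y|) ->
  measurable_fun setT (fun x => partial i f x * \1_[set x | derivable f x (e i)] x).
Proof.
move=> fL; set D := [set x | derivable f x (e i)].
have mD : measurable D := measurable_derivable fL i.
have cf := lipschitz_rV_continuous fL.
pose q m x := (f (x + m.+1%:R^-1 *: e i) - f x) / m.+1%:R^-1.
have mq m : measurable_fun setT (fun x => q m x * \1_D x).
  apply: measurable_funM; last exact: measurable_indic.
  apply: measurable_funM => //; apply: measurable_funB.
    exact: (measurableT_comp (continuous_measurable_rV cf) (measurable_shift _)).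
  exact: continuous_measurable_rV.
apply/measurable_EFinP; apply: (emeasurable_fun_cvg (fun m x => (q m x * \1_D x)%:E)).
  by move=> m; exact/measurable_EFinP.
move=> x _; have H : (fun m => q m x * \1_D x) @ \oo --> partial i f x * \1_D x.
  rewrite indicE; have [/set_mem Dx|xD] := boolP (x \in D).
    apply: cvgM; last exact: cvg_cst.
    apply: (derivable_cvg_seq Dx (@cvg_harmonic R)) => m.
    by rewrite invr_eq0 pnatr_eq0.
  rewrite (_ : (fun m => _) = cst 0); first by rewrite mulr0; exact: cvg_cst.
  by apply/funext => m; rewrite mulr0.
by apply: cvg_EFin; [exact: nearW|exact: H].
Qed.

(** Difference quotients may be moved from the Lipschitz function to the test
    function by translation invariance; both sides then converge boundedly. *)
Lemma lipschitz_integration_by_parts (f phi : 'rV[R]_n -> R) (L M r : R) i :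
  (forall x y, `|f x - f y| <= L * `|x - y|) ->
  (forall x y, `|phi x - phi y| <= M * `|x - y|) ->
  (forall x, derivable phi x (e i)) ->
  (forall x, r < `|x| -> phi x = 0) ->
  \int[mu]_x (f x * partial i phi x) =
  - \int[mu]_x ((partial i f x * \1_[set x | derivable f x (e i)] x) * phi x).
Proof.
move=> fL phiM dphi phi0.
have cf := lipschitz_rV_continuous fL; have cphi := lipschitz_rV_continuous phiM.
have mf := continuous_measurable_rV cf; have mphi := continuous_measurable_rV cphi.
pose s m : R := m.+1%:R^-1.
have s_gt0 m : 0 < s m by rewrite invr_gt0 ltr0n.
have s_le1 m : s m <= 1 by rewrite invf_le1 ?ltr0n// ler1n.
have s0 : s m @[m --> \oo] --> 0 by exact: cvg_harmonic.
have msh (g : 'rV[R]_n -> R) y : measurable_fun setT g ->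
    measurable_fun setT (fun x : 'rV[R]_n => g (x + y)).
  by move=> mg; exact: (measurableT_comp mg (measurable_shift _)).
pose r' := `|r| + 2.
have far (x y : 'rV[R]_n) : r' < `|x| -> `|y| <= 1 -> r < `|x + y|.
  move=> rx y1; have := ler_normB (x + y) y; rewrite addrK.
  by have := ler_norm r; rewrite /r' in rx; lra.
have fb x : `|x| <= r' + 1 -> `|f x| <= `|f 0| + `|L| * (r' + 1).
  move=> xr; rewrite -[f x](subrK (f 0)) addrC (le_trans (ler_normD _ _))// lerD2l.
  have := fL x 0; rewrite subr0 => /le_trans; apply.
  apply: (@le_trans _ _ (`|L| * `|x|)); first by rewrite ler_wpM2r// ler_norm.
  by rewrite ler_wpM2l.
set C := `|f 0| + _ in fb.
have C0 : 0 <= C by rewrite addr_ge0// mulr_ge0// /r'; have := normr_ge0 r; lra.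
have phib x : `|phi x| <= `|M| * (2 * `|r| + 1).
  have [xr|rx] := leP `|x| `|r|; last first.
    by rewrite phi0 ?normr0 ?mulr_ge0 ?addr_ge0// (le_lt_trans (ler_norm r)).
  have t0 : 0 <= 2 * `|r| + 1 by rewrite addr_ge0.
  have y0 : phi (x + (2 * `|r| + 1) *: e i) = 0.
    apply: phi0; have := ler_normB ((2 * `|r| + 1) *: e i + x) x.
    rewrite addrK norm_delta ger0_norm// addrC [_ + x]addrC.
    by have := ler_norm r; lra.
  rewrite -[phi x]subr0 -y0; apply: le_trans (phiM _ _) _.
  rewrite opprD addrA subrr add0r normrN norm_delta ger0_norm//.
  by rewrite ler_wpM2r// ler_norm.
set P := `|M| * _ in phib.
have q1 m x : `|(f (x + s m *: e i) - f x) / s m| <= `|L|.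
  rewrite normf_div [`|s m|]gtr0_norm// ler_pdivrMr//; apply: le_trans (fL _ _) _.
  by rewrite addrAC subrr add0r norm_delta [`|s m|]gtr0_norm// ler_wpM2r ?ler_norm// ltW.
have q2 m x : `|(phi (x - s m *: e i) - phi x) / - s m| <= `|M|.
  rewrite normf_div normrN [`|s m|]gtr0_norm// ler_pdivrMr//; apply: le_trans (phiM _ _) _.
  by rewrite addrAC subrr add0r normrN norm_delta [`|s m|]gtr0_norm// ler_wpM2r
    ?ler_norm// ltW.
pose D := [set x | derivable f x (e i)].
have c1 : \int[mu]_x ((f (x + s m *: e i) - f x) / s m * phi x) @[m --> \oo] -->
    \int[mu]_x ((partial i f x * \1_D x) * phi x).
  apply: (@cvg_Rintegral_bounded_support _ _ (`|L| * P) r).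
  - by move=> m; apply: measurable_funM => //; apply: measurable_funM => //;
      apply: measurable_funB => //; exact: msh.
  - by apply: measurable_funM => //; exact: measurable_partial fL.
  - apply: (filterS _ (lipschitz_ae_partial fL i)) => x dx.
    rewrite indicE mem_set// mulr1; apply: cvgM; last exact: cvg_cst.
    by apply: derivable_cvg_seq => // m; rewrite gt_eqF.
  - by move=> m x; rewrite normrM ler_pM.
  - by move=> m x rx; rewrite phi0// mulr0.
have c2 : \int[mu]_x (f x * ((phi (x - s m *: e i) - phi x) / - s m)) @[m --> \oo] -->
    \int[mu]_x (f x * partial i phi x).
  apply: (@cvg_Rintegral_bounded_support _ _ (C * `|M|) r').
  - by move=> m; apply: measurable_funM => //; apply: measurable_funM => //;
      apply: measurable_funB => //; exact: msh.
  - apply: measurable_funM => //.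
    rewrite (_ : partial i phi = fun x =>
      partial i phi x * \1_[set x | derivable phi x (e i)] x).
      exact: measurable_partial phiM.
    by apply/funext => x; rewrite indicE mem_set ?mulr1//; exact: dphi.
  - apply: aeW => x; apply: cvgM; first exact: cvg_cst.
    rewrite (_ : (fun m => _) = (fun m => (phi (x + (- s m) *: e i) - phi x) / (- s m)));
      last first.
      by apply/funext => m; rewrite scaleNr.
    apply: derivable_cvg_seq => //; last by move=> m; rewrite oppr_eq0 gt_eqF.
    by rewrite -oppr0; exact: cvgN.
  - move=> m x; have [xr|xr] := leP `|x| r'.
      by rewrite normrM ler_pM// fb// (le_trans xr)// lerDl.
    rewrite !phi0 ?subrr ?mul0r ?mulr0 ?normr0 ?mulr_ge0//.
      by rewrite -[x]addr0; apply: far; rewrite ?normr0.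
    by apply: far => //; rewrite normrN norm_delta gtr0_norm.
  - move=> m x xr; rewrite !phi0 ?subrr ?mul0r ?mulr0//.
      by rewrite -[x]addr0; apply: far; rewrite ?normr0.
    by apply: far => //; rewrite normrN norm_delta gtr0_norm.
have E m : \int[mu]_x (f x * ((phi (x - s m *: e i) - phi x) / - s m)) =
    - \int[mu]_x ((f (x + s m *: e i) - f x) / s m * phi x).
  have y1 : `|s m *: e i| <= 1 by rewrite norm_delta gtr0_norm.
  set y := s m *: e i in y1 *.
  have I1 : mu.-integrable setT (fun x : 'rV[R]_n => (f x * phi (x - y))%:E).
    apply: (@integrable_bounded_support _ _ _ 0 (C * P) r').
    - by apply: measurable_funM => //; exact: msh.
    - move=> x; have [xr|xr] := leP `|x| r'.
        by rewrite normrM ler_pM// fb// (le_trans xr)// lerDl.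
      by rewrite phi0 ?mulr0 ?normr0 ?mulr_ge0//; apply: far; rewrite ?normrN.
    - by move=> x; rewrite subr0 => xr; rewrite phi0 ?mulr0//; apply: far; rewrite ?normrN.
  have I2 : mu.-integrable setT (fun x : 'rV[R]_n => (f x * phi x)%:E).
    apply: (@integrable_bounded_support _ _ _ 0 (C * P) r).
    - exact: measurable_funM.
    - move=> x; have [xr|xr] := leP `|x| r'.
        by rewrite normrM ler_pM// fb// (le_trans xr)// lerDl.
      by rewrite -[x]addr0 phi0 ?mulr0 ?normr0 ?mulr_ge0//; apply: far; rewrite ?normr0.
    - by move=> x; rewrite subr0 => xr; rewrite phi0 ?mulr0.
  have I3 : mu.-integrable setT (fun x : 'rV[R]_n => (f (x + y) * phi x)%:E).
    apply: (@integrable_bounded_support _ _ _ 0 (C * P) r).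
    - by apply: measurable_funM => //; exact: msh.
    - move=> x; have [xr|xr] := leP `|x| r'.
        rewrite normrM ler_pM// fb//; apply: le_trans (ler_normD _ _) _.
        exact: lerD.
      by rewrite -[x in phi x]addr0 phi0 ?mulr0 ?normr0 ?mulr_ge0//; apply: far;
        rewrite ?normr0.
    - by move=> x; rewrite subr0 => xr; rewrite phi0 ?mulr0.
  have T : \int[mu]_x (f (x + y) * phi x) = \int[mu]_x (f x * phi (x - y)).
    pose h (x : 'rV[R]_n) := f x * phi (x - y).
    have hE x : h (x + y) = f (x + y) * phi x by rewrite /h addrK.
    transitivity (\int[mu]_x h (x + y)); first by apply: eq_Rintegral => x _; rewrite hE.
    apply: (@Rintegral_shift R n h y).
      by apply: measurable_funM => //; exact: msh.
    by under eq_fun do rewrite hE.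
  rewrite (@eq_Rintegral _ _ _ mu setT (fun x : 'rV[R]_n =>
    (- (s m)^-1) * (f x * phi (x - y) - f x * phi x))); last first.
    by move=> x _; rewrite invrN; ring.
  rewrite [X in _ = - X](@eq_Rintegral _ _ _ mu setT (fun x : 'rV[R]_n =>
    (s m)^-1 * (f (x + y) * phi x - f x * phi x))); last first.
    by move=> x _; ring.
  rewrite !RintegralZl//; last 2 first.
  - exact: (integrableB measurableT I3 I2).
  - exact: (integrableB measurableT I1 I2).
  by rewrite !RintegralB// T mulNr.
have : \int[mu]_x (f x * ((phi (x - s m *: e i) - phi x) / - s m)) @[m --> \oo] -->
    - \int[mu]_x ((partial i f x * \1_D x) * phi x).
  by under eq_fun do rewrite E; exact: cvgN.
by move=> c3; apply: (cvg_unique _ c2 c3).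
Qed.

End weak_gradient_lipschitz.

(** * Lipschitz functions are admissible *)

Section test_functions.
Context {R : realType} {n : nat}.
Local Notation mu := (@lebesgue_measure_rV R n).
Local Notation e i := (delta_mx ord0 i : 'rV[R]_n).
Implicit Types (f phi : 'rV[R]_n -> R) (x v : 'rV[R]_n).

(** Restriction to a line reduces directional derivatives to one variable, where the
    mean value theorem and differentiation under the integral are available. *)
Lemma is_derive_line f x v (t : R) : derivable f (x + t *: v) v ->
  is_derive t (1 : R) (fun s : R => f (x + s *: v) : R) ('D_v f (x + t *: v)).
Proof.
move=> df; have E : (fun h : R => h^-1 *: (((fun s : R =>
  f (x + s *: v)) \o shift t) (h *: (1 : R))
    - f (x + t *: v))) =
   (fun h : R => h^-1 *: ((f \o shift (x + t *: v)) (h *: v) - f (x + t *: v))).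
  by apply/funext => h /=; rewrite /shift /= [h *: 1]mulr1 scalerDl addrCA.
by split; rewrite /derivable /derive E.
Qed.

Lemma derive_partial f x v : differentiable f x ->
  'D_v f x = \sum_i v ord0 i * partial i f x.
Proof.
move=> df; rewrite deriveE// [v in LHS]row_sum_delta linear_sum; apply: eq_bigr => i _.
by rewrite linearZ /partial deriveE.
Qed.

Lemma continuous_bounded_cube f (r : R) : continuous f ->
  exists M, forall x, `|x| <= r -> `|f x| <= M.
Proof.
move=> cf.
have : compact [set v : 'rV[R]_n | forall i, `[- r, r]%classic (v ord0 i)].
  by apply: (@rV_compact _ _ (fun=> `[- r, r]%classic)) => i; exact: segment_compact.
move=> /(continuous_compact (continuous_subspaceT cf))/compact_bounded.
move=> [M [_ /(_ (`|M| + 1))]] h; exists (`|M| + 1) => x xr.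
apply: h; first by rewrite (le_lt_trans (ler_norm M))// ltrDl.
exists x => //= i; rewrite in_itv/= -ler_norml.
exact: le_trans (coord_le_norm x i) xr.
Qed.

Lemma continuous_bounded_support f (r : R) : continuous f ->
  (forall x, r < `|x| -> f x = 0) -> exists M, forall x, `|f x| <= M.
Proof.
move=> /(continuous_bounded_cube r)[M fM] f0; exists (Num.max M 0) => x.
rewrite le_max; have [xr|rx] := leP `|x| r; first by rewrite fM.
by rewrite f0// normr0 lexx orbT.
Qed.

Lemma smooth_continuous f : smooth f -> continuous f.
Proof. by move=> sf x; exact/differentiable_continuous/(sf [::]). Qed.

Lemma smooth_partial f i : smooth f -> smooth (partial i f).
Proof. by move=> sf s x; have := sf (rcons s i) x; rewrite foldr_rcons. Qed.

Lemma partial_support f (r : R) i : (forall x, r < `|x| -> f x = 0) ->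
  forall x, r < `|x| -> partial i f x = 0.
Proof.
move=> f0 x rx; rewrite /partial.
have -> : 'D_(e i) f x = 'D_(e i) (cst 0) x.
  apply: near_eq_derive => //; apply/nbhs_rVP; exists (`|x| - r); first by rewrite subr_gt0.
  move=> y yx; apply: f0; have := ler_distD y x 0; rewrite !subr0 distrC; lra.
exact: derive_cst.
Qed.

Lemma smooth_support_lipschitz f (r : R) : smooth f ->
  (forall x, r < `|x| -> f x = 0) ->
  exists M, forall x y, `|f x - f y| <= M * `|x - y|.
Proof.
move=> sf f0.
have /choice[M MP] : forall i : 'I_n, exists M, forall x, `|partial i f x| <= M.
  move=> i; apply: (@continuous_bounded_support _ r).
    exact/smooth_continuous/smooth_partial.
  exact: partial_support.
exists (\sum_i M i) => x y; pose g (t : R) := f (y + t *: (x - y)).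
have dg t : is_derive t (1 : R) g ('D_(x - y) f (y + t *: (x - y))).
  by apply: is_derive_line; apply: diff_derivable; exact: (sf [::]).
have [|c _] := @MVT R g _ 0 1 ltr01 (fun t _ => dg t).
  apply: derivable_within_continuous => t _; exact: (@ex_derive _ _ _ _ _ _ _ (dg t)).
rewrite /g scale1r scale0r addr0 [y + (x - y)]addrC subrK subr0 mulr1 => ->.
rewrite derive_partial; last exact: (sf [::]).
rewrite mulr_suml; apply: le_trans (ler_norm_sum _ _ _) _; apply: ler_sum => i _.
rewrite normrM mulrC; apply: ler_pM => //.
exact: coord_le_norm.
Qed.

Lemma test_function_support phi : test_function phi ->
  exists r : R, forall x, r < `|x| -> phi x = 0.
Proof.
move=> [_ /compact_in_cube[r _ sub]]; exists r => x rx; apply: contrapT => /eqP phix.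
have /sub : closure [set x | phi x != 0] x by exact: subset_closure.
by rewrite /= subr0 leNgt rx.
Qed.

Lemma bounded_on_cubes_L2loc f : measurable_fun setT f ->
  (forall r : R, exists M, forall x, `|x| <= r -> `|f x| <= M) -> L2loc f.
Proof.
move=> mf fM; split=> // K cK.
have mK : measurable K by apply: closed_measurable_rV; exact: compact_closed_rV.
have [r r0 Kr] := compact_in_cube cK; have [M MP] := fM r.
have [mB BE] := measure_cube (0 : 'rV[R]_n) r0.
have Koo : (mu K < +oo)%E.
  apply: (@le_lt_trans _ _ (mu [set x | (`|x - 0| <= r)%R])); last by rewrite BE ltry.
  by apply: le_measure; rewrite ?inE; [exact: mK|exact: mB|exact: Kr].
apply: (@le_lt_trans _ _ (\int[mu]_(x in K) (M ^+ 2)%:E)%E).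
  apply: ge0_le_integral => //.
  - by move=> x _; rewrite lee_fin sqr_ge0.
  - apply/measurable_EFinP/measurable_funTS. exact: measurable_funX.
  - move=> x Kx; rewrite lee_fin -real_normK ?num_real// lerXn2r ?nnegrE//.
      by apply: le_trans (MP 0 _); rewrite ?normr0.
    by apply: MP; have := Kr _ Kx; rewrite /= subr0.
by rewrite integral_cst//; apply: lte_mul_pinfty => //; rewrite lee_fin sqr_ge0.
Qed.

(** Integration by parts holds for the partial derivatives that exist almost
    everywhere by Rademacher's theorem; setting them to 0 elsewhere makes them
    measurable. *)
Lemma lipschitz_W12loc f (L : R) : (forall x y, `|f x - f y| <= L * `|x - y|) ->
  exists g, W12loc f g /\ {ae mu, forall x, g x = grad f x}.
Proof.
move=> fL; have cf := lipschitz_rV_continuous fL.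
pose g (x : 'rV[R]_n) : 'rV[R]_n :=
  \row_i (partial i f x * \1_[set x | derivable f x (e i)] x).
exists g; split; last first.
  apply: (filterS _ (rademacher fL)) => x [dx _].
  by apply/rowP => i; rewrite !mxE indicE mem_set ?mulr1//; exact: dx.
split.
- apply: bounded_on_cubes_L2loc; first exact: continuous_measurable_rV.
  by move=> r; exact: continuous_bounded_cube.
- move=> i; under eq_fun do rewrite mxE; apply: bounded_on_cubes_L2loc.
    exact: measurable_partial fL.
  move=> r; exists `|L| => x _; rewrite indicE.
  have [/set_mem dx|_] := boolP (x \in _); last by rewrite mulr0 normr0.
  rewrite mulr1; apply/ler_addgt0Pr => eps eps0.
  have /cvgrPdist_lt/(_ _ eps0)[d /= d0 Hd] := dx.
  have d2 : 0 < d / 2 by rewrite divr_gt0.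
  have := Hd (d / 2); rewrite /ball_ /= sub0r normrN gtr0_norm// => /(_ _)/wrap[].
    by rewrite ltr_pdivrMr// ltr_pMr// ltr1n.
  rewrite gt_eqF// => /(_ isT); set q := _ *: _ => Hq.
  have qL : `|q| <= `|L|.
    rewrite /q normrZ gtr0_norm ?invr_gt0// ler_pdivrMl// [leRHS]mulrC.
    apply: le_trans (fL _ _) _; rewrite /shift/= addrK norm_delta gtr0_norm//.
    by rewrite ler_wpM2r ?ler_norm// ltW.
  have := ler_normD (partial i f x - q) q; rewrite subrK.
  by move=> /le_trans; apply; rewrite addrC lerD// ltW.
- move=> phi [sphi cphi] i.
  have [r phi0] := test_function_support (conj sphi cphi).
  have [M phiM] := smooth_support_lipschitz sphi phi0.
  have dphi x : derivable phi x (e i) by apply: diff_derivable; exact: (sphi [::]).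
  rewrite (lipschitz_integration_by_parts fL phiM dphi phi0).
  by congr (- _); apply: eq_Rintegral => x _; rewrite mxE.
Qed.

(** Tested on the increment t p along the gradient p itself, the expansion gives
    t |p|^2 <= K t |p| + o(t). *)
Lemma grad_enorm_le f x (K : R) : 0 <= K ->
  (forall eps, 0 < eps -> exists2 d : R, 0 < d & forall h : 'rV[R]_n, `|h| < d ->
    `|f (x + h) - f x - \sum_i partial i f x * h ord0 i| <= eps * `|h|) ->
  (exists2 rho : R, 0 < rho & forall y, `|y - x| < rho ->
    `|f y - f x| <= K * enorm (y - x)) ->
  enorm (grad f x) <= K.
Proof.
move=> K0 fx [rho rho0 fK]; set p := grad f x.
have [->|p0] := eqVneq p 0; first by rewrite enorm0.
have P0 := enorm_gt0 p0.
apply/ler_addgt0Pr => eps eps0; have [d d0 Hd] := fx _ eps0.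
have np : 0 < `|p| + 1 by rewrite ltr_wpDl.
pose t := Num.min d rho / (`|p| + 1).
have t0 : 0 < t by rewrite divr_gt0// lt_min d0.
have tp : `|t *: p| < Num.min d rho.
  rewrite normrZ gtr0_norm// /t -mulrA gtr_pMr ?lt_min ?d0//.
  by rewrite mulrC ltr_pdivrMr// mul1r ltrDl.
move: tp; rewrite lt_min => /andP[td trho]; clearbody t.
have := Hd _ td; have := fK (x + t *: p).
rewrite addrAC subrr add0r => /(_ trho).
have -> : \sum_i partial i f x * (t *: p) ord0 i = t * enorm p ^+ 2.
  by rewrite sqr_enorm mulr_sumr; apply: eq_bigr => i _; rewrite !mxE; ring.
rewrite enormZ normrZ (gtr0_norm t0) => h1 h2.
have h3 : `|p| <= enorm p by exact: norm_le_enorm.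
have h4 : t * enorm p ^+ 2 <= K * (t * enorm p) + eps * (t * `|p|).
  have := ler_normB (f (x + t *: p) - f x) (f (x + t *: p) - f x - t * enorm p ^+ 2).
  rewrite (_ : _ - (_ - _) = t * enorm p ^+ 2); last by ring.
  have tP2 : 0 <= t * enorm p ^+ 2 by rewrite mulr_ge0 ?sqr_ge0// ltW.
  by rewrite ger0_norm//; lra.
have h5 : t * enorm p ^+ 2 <= (K + eps) * (t * enorm p).
  apply: le_trans h4 _; rewrite mulrDl lerD2l; apply: ler_wpM2l; first exact: ltW.
  by apply: ler_wpM2l => //; exact: ltW.
have tP : 0 < t * enorm p by rewrite mulr_gt0.
by rewrite -(ler_pM2r tP); move: h5; rewrite expr2; lra.
Qed.

(** By Rademacher's theorem, admissibility becomes a pointwise condition on local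
    Euclidean Lipschitz constants, which may vary with the coefficient a. *)
Lemma lipschitz_admissible (a : 'rV[R]_n -> R) f (L : R) :
  (forall x y, `|f x - f y| <= L * `|x - y|) -> (forall z, 0 <= a z) ->
  (forall z, exists2 K, 0 <= K /\ a z * K ^+ 2 <= 1 &
    exists2 rho : R, 0 < rho & forall y, `|y - z| < rho ->
      `|f y - f z| <= K * enorm (y - z)) ->
  admissible (fun z => (a z)%:M) f.
Proof.
move=> fL a0 fK; split; first exact: lipschitz_rV_continuous fL.
have [g [Wg gE]] := lipschitz_W12loc fL; exists g; split=> //.
apply: (filterS2 _ _ gE (rademacher fL)) => z -> [_ dz].
rewrite energy_scalar; have [K [K0 aK] HK] := fK z.
apply: le_trans aK; apply: ler_wpM2l => //.
by apply: lerXn2r; rewrite ?nnegrE ?enorm_ge0//; exact: (grad_enorm_le K0 dz HK).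
Qed.

End test_functions.

(** * Smooth functions with compact support *)

Section flat_exponential.
Context {R : realType}.

(** The factor t^-k is there to have a family whose span is stable under
    derivation, as [is_derive_flatexp] shows. *)
Definition flatexp (k : nat) (t : R) : R :=
  if 0 < t then (t^-1) ^+ k * expR (- t^-1) else 0.

Lemma flatexp_le0 k t : t <= 0 -> flatexp k t = 0.
Proof. by move=> t0; rewrite /flatexp ltNge t0. Qed.

Lemma flatexp_ge0 k t : 0 <= flatexp k t.
Proof.
rewrite /flatexp; case: ltP => // t0.
by rewrite mulr_ge0 ?expR_ge0// exprn_ge0// invr_ge0 ltW.
Qed.

Lemma flatexp0_le1 t : flatexp 0 t <= 1.
Proof.
rewrite /flatexp; case: ltP => // t0; rewrite expr0 mul1r -expR0 ler_expR.
by rewrite oppr_le0 invr_ge0 ltW.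
Qed.

Lemma flatexp0_ge (t : R) : 1 / 2 <= t -> expR (- 2) <= flatexp 0 t.
Proof.
move=> t2; have t0 : 0 < t by lra.
rewrite /flatexp t0 expr0 mul1r ler_expR lerN2 -[leRHS]invrK.
by rewrite lef_pV2 ?posrE ?invr_gt0//; lra.
Qed.

(** One term of the exponential series dominates every power of 1 / t; the square
    makes the derivative at 0 vanish. *)
Lemma flatexp_le_sqr k (t : R) : flatexp k t <= (k.+2)`!%:R * t ^+ 2.
Proof.
rewrite /flatexp; case: ltP => [t0|_]; last by rewrite mulr_ge0 ?sqr_ge0.
have y0 : 0 < t^-1 by rewrite invr_gt0.
have := expR_ge1Dxn k.+1 (ltW y0); set y := t^-1 in y0 *; set F := _`!%:R => H.
have F0 : 0 < F :> R by rewrite ltr0n fact_gt0.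
have : y ^+ k.+2 <= F * expR y.
  by rewrite mulrC -ler_pdivrMr//; apply: le_trans H; rewrite lerDr.
rewrite expRN ler_pdivrMr ?expR_gt0//.
have -> : t = y^-1 by rewrite invrK.
have -> : y ^+ k = y ^+ k.+2 * y^-1 ^+ 2.
  by rewrite -addn2 exprD -mulrA -exprMn mulfV ?gt_eqF// expr1n mulr1.
by move=> h; rewrite [leRHS]mulrAC ler_wpM2r// sqr_ge0.
Qed.

Lemma is_derive_flatexp k (t : R) :
  is_derive t 1 (flatexp k) (flatexp k.+2 t - k%:R * flatexp k.+1 t).
Proof.
have [t0|t0|<-] := ltgtP 0 t.
- have E : \forall s \near t, (fun s => (s^-1) ^+ k * expR (- s^-1)) s = flatexp k s.
    near=> s; rewrite /flatexp (_ : 0 < s)//; near: s; exact: lt_nbhsr.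
  apply: (near_eq_is_derive E).
  have dV : is_derive t 1 (fun s : R => s^-1) (- t ^- 2 *: (1 : R)).
    by apply: (@is_deriveV R id) => //; rewrite gt_eqF.
  have dE : is_derive t 1 (fun s : R => expR (- s^-1)) (expR (- t^-1) * (t ^- 2)).
    apply: (@is_derive1_comp R expR (fun s => - s^-1)).
    by apply: is_derive_eq; rewrite scaleNr opprK [LHS]mulr1.
  have D := is_deriveM (is_deriveX k dV) dE.
  rewrite (_ : (fun s : R => s^-1 ^+ k * expR (- s^-1)) =
    (fun s : R => s^-1) ^+ k * (fun s => expR (- s^-1))); last first.
    by apply/funext => s; rewrite mulrfctE exprfctE.
  apply: (is_derive_eq D); rewrite exprfctE; clear D E.
  rewrite /flatexp t0 /GRing.scale/= /GRing.scale/= !mulr1.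
  case: k => [|k]; first by rewrite /= !mul0r mulr0 addr0 subr0 expr0 -exprVn; ring.
  rewrite /= -exprVn; set y := t^-1; rewrite !exprS; ring.
- have E : \forall s \near t, cst 0 s = flatexp k s.
    near=> s; rewrite flatexp_le0//; apply: ltW; near: s; exact: lt_nbhsl.
  apply: (near_eq_is_derive E).
  by rewrite !flatexp_le0 ?(ltW t0)// mulr0 subr0; exact: is_derive_cst.
rewrite !(@flatexp_le0 _ 0)// mulr0 subr0.
have H : (fun h : R => h^-1 *: ((flatexp k \o shift 0) (h *: (1 : R)) -
  flatexp k 0)) @ 0^' --> (0 : R).
  apply/cvgrPdist_le => eps eps0.
  have F0 : 0 < (k.+2)`!%:R :> R by rewrite ltr0n fact_gt0.
  exists (eps / (k.+2)`!%:R) => /=; first by rewrite divr_gt0.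
  move=> h /=; rewrite !sub0r !normrN => heps h0.
  rewrite /shift /= addr0 [h *: 1]mulr1 (flatexp_le0 k (lexx 0)) subr0 normrZ normfV.
  rewrite ler_pdivrMl ?normr_gt0// ger0_norm ?flatexp_ge0//.
  apply: le_trans (flatexp_le_sqr k h) _.
  rewrite -real_normK ?num_real// expr2 mulrA [leRHS]mulrC ler_wpM2r//.
  by rewrite mulrC -ler_pdivlMr// ltW.
split; first by apply/cvg_ex; exists 0; exact: H.
by apply/cvg_lim; [exact: Rhausdorff|exact: H].
Unshelve. all: by end_near. Qed.

End flat_exponential.

Section mollifier.
Context {R : realType} {n : nat}.
Local Notation mu := (@lebesgue_measure_rV R n).
Local Notation e i := (delta_mx ord0 i : 'rV[R]_n).
Implicit Types (f g : 'rV[R]_n -> R) (x v : 'rV[R]_n).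

(** The algebra generated by the functions x |-> flatexp k (a x_i + c) is stable
    under partial derivatives, so that its elements are smooth. *)
Inductive flat_algebra : ('rV[R]_n -> R) -> Prop :=
| flat_gen k (a c : R) (i : 'I_n) : flat_algebra (fun x => flatexp k (a * x ord0 i + c))
| flat_cst (c : R) : flat_algebra (cst c)
| flat_add f g : flat_algebra f -> flat_algebra g -> flat_algebra (f + g)
| flat_mul f g : flat_algebra f -> flat_algebra g -> flat_algebra (f * g).

Lemma flat_algebra_partial f : flat_algebra f ->
  (forall x, differentiable f x) /\ forall j, flat_algebra (partial j f).
Proof.
elim => [k a c i|c|{}f g _ [df pf] _ [dg pg]|{}f g ff [df pf] fg [dg pg]].
- have dH x : differentiable (fun x : 'rV[R]_n => flatexp k (a * x ord0 i + c)) x.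
    apply: (@differentiable_comp _ _ _ _ (fun x : 'rV[R]_n =>
      a * x ord0 i + c) (flatexp k)).
      apply: differentiableD => //; apply: differentiableM => //.
      exact: differentiable_coord.
    by apply/derivable1_diffP; exact: (@ex_derive _ _ _ _ _ _ _ (is_derive_flatexp k _)).
  split => // j.
  rewrite (_ : partial j _ = cst (a * (i == j)%:R) *
    ((fun x => flatexp k.+2 (a * x ord0 i + c)) + cst (- k%:R) * (fun x =>
      flatexp k.+1 (a * x ord0 i + c)))).
    by do !constructor.
  apply/funext => x; rewrite !(mulrfctE, addrfctE) /=.
  have dj : derivable (fun x : 'rV[R]_n =>
    flatexp k (a * x ord0 i + c)) (x + 0 *: e j) (e j).
    by apply: diff_derivable; exact: dH.
  have D1 := is_derive_line dj.
  have D2 : is_derive (0 : R) (1 : R) (fun s : R =>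
    flatexp k (a * (x + s *: e j) ord0 i + c))
      ((flatexp k.+2 (a * x ord0 i + c) - k%:R * flatexp k.+1 (a * x ord0 i +
        c)) * (a * (i == j)%:R)).
    apply: (@is_derive1_comp R (flatexp k) (fun s => a * (x + s *: e j) ord0 i + c)).
      apply: is_derive_eq; first exact: is_derive_flatexp.
      by rewrite scale0r addr0.
    rewrite (_ : (fun s => _) = (fun s : R =>
      (a * (i == j)%:R) *: s + (a * x ord0 i + c))); last first.
      by apply/funext => s; rewrite !mxE /= eq_sym /GRing.scale/=; case: eqP => _ /=;
        rewrite ?mulr1 ?mulr0; ring.
    apply: is_derive_eq; rewrite addr0; exact: mulr1.
  rewrite /partial -[x in LHS]addr0 -(scale0r (e j)).
  rewrite -(@derive_val _ _ _ _ _ _ _ D1) (@derive_val _ _ _ _ _ _ _ D2); ring.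
- split => [x|j]; first exact: differentiable_cst.
  rewrite (_ : partial j _ = cst 0); first by constructor.
  by apply/funext => x; exact: derive_cst.
- split => [x|j]; first exact: differentiableD.
  rewrite (_ : partial j _ = partial j f + partial j g); first by constructor.
  by apply/funext => x; rewrite /partial deriveD//; exact: diff_derivable.
- split => [x|j]; first exact: differentiableM.
  rewrite (_ : partial j _ = f * partial j g + g * partial j f).
    by apply: flat_add; apply: flat_mul.
  by apply/funext => x; rewrite /partial deriveM//; exact: diff_derivable.
Qed.

Lemma flat_algebra_smooth f : flat_algebra f -> smooth f.
Proof.
move=> ff s x; apply: (flat_algebra_partial _).1.
by elim: s => //= i s IH; exact: (flat_algebra_partial IH).2.
Qed.

(** A product of one-variable bumps; its mass is not normalized, but only its ratio
    to eps^n enters the estimates, by [Rintegral_mollifier_ge]. *)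
Definition mollifier (eps : R) x : R :=
  \prod_i (flatexp 0 (eps^-1 * x ord0 i + 1) * flatexp 0 (- eps^-1 * x ord0 i + 1)).

Lemma mollifier_smooth eps : smooth (mollifier eps).
Proof.
apply: flat_algebra_smooth; rewrite /mollifier.
elim: (index_enum _) => [|i s IH].
  by under eq_fun do rewrite big_nil; exact: flat_cst.
under eq_fun do rewrite big_cons.
by apply: flat_mul => //; apply: flat_mul; exact: flat_gen.
Qed.

Lemma measurable_mollifier eps : measurable_fun setT (mollifier eps).
Proof.
by apply: continuous_measurable_rV; apply: smooth_continuous; exact: mollifier_smooth.
Qed.

Lemma mollifier_ge0 eps x : 0 <= mollifier eps x.
Proof. by apply: prodr_ge0 => i _; rewrite mulr_ge0// flatexp_ge0. Qed.

Lemma mollifier_le1 eps x : mollifier eps x <= 1.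
Proof.
apply: prodr_ile1 => i _; rewrite mulr_ge0 ?flatexp_ge0//=.
by rewrite mulr_ile1 ?flatexp_ge0 ?flatexp0_le1.
Qed.

Lemma mollifier_support eps x : 0 < eps -> eps <= `|x| -> mollifier eps x = 0.
Proof.
move=> eps0 ex; apply: contrapT => /eqP bx.
have : `|x| < eps.
  apply: rV_norm_lt => // i.
  move: bx; rewrite /mollifier (bigD1 i)//= !mulf_eq0 !negb_or => /andP[/andP[b1 b2] _].
  have c1 : 0 < eps^-1 * x ord0 i + 1.
    by rewrite ltNge; apply: contra b1 => /(flatexp_le0 0) ->.
  have c2 : 0 < - eps^-1 * x ord0 i + 1.
    by rewrite ltNge; apply: contra b2 => /(flatexp_le0 0) ->.
  rewrite -[eps]mulr1 -ltr_pdivrMl// -[eps^-1]gtr0_norm ?invr_gt0// -normrM ltr_norml.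
  by apply/andP; split; lra.
by rewrite ltNge ex.
Qed.

Lemma mollifier_ge eps x : 0 < eps -> `|x| <= eps / 2 ->
  (expR (- 2) ^+ 2) ^+ n <= mollifier eps x.
Proof.
move=> eps0 xe; rewrite -[X in _ ^+ X](card_ord n) -prodr_const /mollifier.
apply: ler_prod => i _; rewrite exprn_ge0 ?expR_ge0//= expr2.
have : `|eps^-1 * x ord0 i| <= 1 / 2.
  rewrite normrM gtr0_norm ?invr_gt0// ler_pdivrMl// mulrC mul1r mulrC.
  exact: le_trans (coord_le_norm x i) xe.
rewrite ler_norml => /andP[h1 h2].
by apply: ler_pM; rewrite ?expR_ge0//; apply: flatexp0_ge; lra.
Qed.

End mollifier.

(** * Mollification of a function with a weak gradient *)

Section mollification.
Context {R : realType} {n : nat}.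
Local Notation mu := (@lebesgue_measure_rV R n).
Local Notation e i := (delta_mx ord0 i : 'rV[R]_n).
Implicit Types (f phi : 'rV[R]_n -> R) (x v z : 'rV[R]_n).

Lemma derive_shift f v z : 'D_v (fun w : 'rV[R]_n => f (w - z)) = (fun w : 'rV[R]_n =>
  'D_v f (w - z)).
Proof.
apply/funext => w; rewrite /derive.
rewrite (_ : (fun h : R => h^-1 *: (((fun w : 'rV[R]_n =>
  f (w - z)) \o shift w) (h *: v) - f (w - z))) =
  (fun h : R => h^-1 *: ((f \o shift (w - z)) (h *: v) - f (w - z))))//.
by apply/funext => h; rewrite /= /shift /= addrA.
Qed.

Lemma smooth_shift f z : smooth f -> smooth (fun w : 'rV[R]_n => f (w - z)).
Proof.
move=> sf s x; have -> : foldr partial (fun w : 'rV[R]_n => f (w - z)) s =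
    (fun w : 'rV[R]_n => foldr partial f s (w - z)).
  by elim: s => //= i s ->; exact: derive_shift.
apply: (@differentiable_comp _ _ _ _ (fun w : 'rV[R]_n => w - z) (foldr partial f s)) => //.
Qed.

Lemma test_function_mollifier (eps : R) z : 0 < eps ->
  test_function (fun w : 'rV[R]_n => mollifier eps (w - z)).
Proof.
move=> eps0; split; first by apply: smooth_shift; exact: mollifier_smooth.
apply: bounded_closed_compact; last exact: closed_closure.
exists (`|z| + eps); split; first exact: num_real.
move=> M zM w Hw; apply: le_trans (ltW zM).
have cl : closed [set y : 'rV[R]_n | `|y| <= `|z| + eps].
  rewrite -[X in closed X]/((fun y : 'rV[R]_n => `|y|) @^-1` [set t : R | t <= `|z| + eps]).
  apply: closed_comp; last exact: closed_le.
  move=> y _; move: y; apply: (@lipschitz_rV_continuous R n (fun y => `|y|) 1) => y w'.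
  by rewrite mul1r ler_dist_dist.
suff /closureS/(_ _ Hw) : [set y | mollifier eps (y - z) != 0] `<=`
    [set y : 'rV[R]_n | `|y| <= `|z| + eps] by rewrite -(closure_id _).1.
move=> y /= by0; have : `|y - z| < eps.
  by rewrite ltNge; apply: contra by0 => /(mollifier_support eps0) ->.
by move=> yz; have := ler_normD (y - z) z; rewrite subrK; lra.
Qed.

Lemma ae_dominated_integrable (f G : 'rV[R]_n -> R) : measurable_fun setT f ->
  mu.-integrable setT (EFin \o G) -> {ae mu, forall x, `|f x| <= G x} ->
  mu.-integrable setT (EFin \o f).
Proof.
move=> mf iG fG; have mEf : measurable_fun setT (EFin \o f) by exact/measurable_EFinP.
have cE : {ae mu, forall x, setT x -> (fun=> (EFin \o f) x) @ \oo --> (EFin \o f) x}.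
  by apply: aeW => x _; exact: cvg_cst.
have dE : {ae mu, forall x (m : nat), setT x -> (`|(EFin \o f) x| <= (EFin \o G) x)%E}.
  by apply: (filterS _ fG) => x {}fG m _; rewrite lee_fin.
by have [] := dominated_convergence measurableT (fun=> mEf) mEf cE iG dE.
Qed.

Lemma Rintegral_sum (I : Type) (s : seq I) (F : I -> 'rV[R]_n -> R) :
  (forall i, mu.-integrable setT (EFin \o F i)) ->
  mu.-integrable setT (fun x => (\sum_(i <- s) F i x)%:E) /\
  \int[mu]_x (\sum_(i <- s) F i x) = \sum_(i <- s) \int[mu]_x F i x.
Proof.
move=> iF; elim: s => [|i s [IH1 IH2]].
  under eq_fun do rewrite big_nil; rewrite big_nil; split; first exact: integrable0.
  by under eq_Rintegral do rewrite big_nil; rewrite Rintegral_cst// mul0r.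
under eq_fun do rewrite big_cons; rewrite big_cons; split.
  exact: (integrableD measurableT (iF i) IH1).
under eq_Rintegral do rewrite big_cons.
by rewrite RintegralD// IH2.
Qed.


Lemma Rintegral_mollifier_shift (eps : R) z : 0 < eps ->
  \int[mu]_w mollifier eps (w - z) = \int[mu]_w mollifier eps w.
Proof.
move=> eps0; have mb := @measurable_mollifier R n eps.
rewrite -(@Rintegral_shift R n (mollifier eps) (- z))//.
apply: (@integrable_bounded_support _ _ _ z 1 eps).
- exact: (measurableT_comp mb (measurable_shift _)).
- by move=> x; rewrite ger0_norm ?mollifier_ge0 ?mollifier_le1.
- by move=> x xz; apply: mollifier_support => //; exact: ltW.
Qed.

Lemma integrable_mul_mollifier (f : 'rV[R]_n -> R) (eps : R) z : 0 < eps ->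
  measurable_fun setT f -> (exists M, forall w, `|w - z| < eps -> `|f w| <= M) ->
  mu.-integrable setT (fun w : 'rV[R]_n => (f w * mollifier eps (w - z))%:E).
Proof.
move=> eps0 mf [M fM]; have mb := @measurable_mollifier R n eps.
have M0 : 0 <= M by apply: le_trans (fM z _); rewrite ?subrr ?normr0.
apply: (@integrable_bounded_support _ _ _ z M eps).
- apply: measurable_funM => //; exact: (measurableT_comp mb (measurable_shift _)).
- move=> w; have [wz|zw] := ltP `|w - z| eps;
    last by rewrite mollifier_support// mulr0 normr0.
  rewrite normrM -[leRHS]mulr1 ler_pM// ?fM// ger0_norm ?mollifier_ge0 ?mollifier_le1//.
- by move=> w xz; rewrite mollifier_support ?mulr0// ltW.
Qed.

(** The bound is proportional to the volume eps^n with a constant that is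
    independent of eps, so that sets of small density have small mollified mass. *)
Lemma Rintegral_mollifier_ge (eps : R) : 0 < eps ->
  (expR (- 2) ^+ 2) ^+ n * eps ^+ n <= \int[mu]_w (mollifier eps w : R).
Proof.
move=> eps0; set kap := (expR (- 2) ^+ 2) ^+ n.
have [mB BE] := measure_cube (0 : 'rV[R]_n) (ltW (divr_gt0 eps0 (ltr0n R 2))).
move: mB BE; set B := [set x | _] => mB BE.
rewrite (_ : eps ^+ n = \int[mu]_w \1_B w); last first.
  rewrite /Rintegral integral_indic// setIT [X in fine X](_ : _ = (eps ^+ n)%:E)//.
  by transitivity ((2 * (eps / 2)) ^+ n)%:E; [exact: BE|rewrite mulrC divfK].
have iB : mu.-integrable setT (EFin \o \1_B).
  apply: (@integrable_bounded_support _ _ _ 0 1 (eps / 2)); first exact: measurable_indic.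
    by move=> w; rewrite indicE; case: (_ \in _); rewrite ?normr0 ?normr1.
  move=> w ew; rewrite indicE (_ : _ \in _ = false)//.
  by apply/negbTE/negP => /set_mem; rewrite /B /= leNgt ew.
rewrite -RintegralZl//; apply: le_Rintegral => //.
- exact: (integrableZl measurableT kap iB).
- apply: (@integrable_bounded_support _ _ _ 0 1 eps).
  + exact: measurable_mollifier.
  + by move=> x; rewrite ger0_norm ?mollifier_ge0 ?mollifier_le1.
  + by move=> x; rewrite subr0 => xz; apply: mollifier_support => //; exact: ltW.
- move=> w _; rewrite indicE; have [/set_mem|_] := boolP (w \in B).
    by rewrite /B /= subr0 mulr1 => wB; exact: mollifier_ge.
  by rewrite mulr0 mollifier_ge0.
Qed.

Lemma ae_le_Rintegral (f1 f2 : 'rV[R]_n -> R) :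
  mu.-integrable setT (EFin \o f1) -> mu.-integrable setT (EFin \o f2) ->
  (forall x, 0 <= f1 x) -> (forall x, 0 <= f2 x) ->
  {ae mu, forall x, f1 x <= f2 x} -> \int[mu]_x f1 x <= \int[mu]_x f2 x.
Proof.
move=> i1 i2 p1 p2 f12; apply: fine_le.
- exact: (integrable_fin_num measurableT i1).
- exact: (integrable_fin_num measurableT i2).
- apply: ae_ge0_le_integral => //.
  + by move=> x _; rewrite lee_fin.
  + by have /integrableP[] := i1.
  + by move=> x _; rewrite lee_fin.
  + by have /integrableP[] := i2.
  + by apply: (filterS _ f12) => x {}f12 _; rewrite lee_fin.
Qed.

(** Along a segment of direction v the convolution of u with a bump has as its
    derivative the convolution of v . g with the bump: the derivative falls on
    the bump, and the definition of the weak gradient g moves it back. *)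
Lemma mollified_increment (u : 'rV[R]_n -> R) (g : 'rV[R]_n -> 'rV[R]_n)
    (G : 'rV[R]_n -> R) (K S eps : R) x v :
  0 < eps -> continuous u -> W12loc u g -> measurable_fun setT G ->
  (forall w, 0 <= G w <= K) -> {ae mu, forall w, enorm (g w) <= G w} ->
  (forall t, 0 <= t <= 1 -> \int[mu]_w (G w * mollifier eps (w - (x + t *: v))) <= S) ->
  `|\int[mu]_w (u w * mollifier eps (w - (x + v))) - \int[mu]_w (u w * mollifier eps (w -
    x))| <=
  enorm v * S.
Proof.
move=> eps0 cu [_ g2 wg] mG G0K gG GS.
have smb := @mollifier_smooth R n eps.
have mu_ := continuous_measurable_rV cu.
pose z (t : R) := x + t *: v.
pose F (t : R) := \int[mu]_w (u w * mollifier eps (w - z t)).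
pose r := `|x| + 2 * `|v| + eps.
have [C uC] := continuous_bounded_cube r cu.
have /choice[M MP] : forall i : 'I_n, exists M, forall y,
  `|partial i (mollifier eps) y| <= M.
  move=> i; apply: (@continuous_bounded_support _ _ _ eps).
    by apply: smooth_continuous; exact: smooth_partial.
  by apply: partial_support => y ey; apply: mollifier_support => //; exact: ltW.
pose D := C * \sum_i `|v ord0 i| * M i.
have zr t w : -1 < t < 2 -> `|w - z t| <= eps -> `|w| <= r.
  move=> /andP[t1 t2] wz; rewrite -(subrK (z t) w).
  apply: le_trans (ler_normD _ _) _; rewrite /r addrC; apply: lerD => //.
  apply: le_trans (ler_normD _ _) _; rewrite lerD2l normrZ; apply: ler_wpM2r => //.
  by rewrite ler_norml; apply/andP; split; lra.
have C0 : 0 <= C.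
  by apply: le_trans (uC 0 _) => //; rewrite normr0 /r !addr_ge0 ?mulr_ge0// ltW.
have D0 : 0 <= D.
  by apply: mulr_ge0 => //; apply: sumr_ge0 => i _;
    rewrite mulr_ge0// (le_trans _ (MP i 0)).
pose B := [set w : 'rV[R]_n | `|w - 0| <= r].
have r0 : 0 <= r by rewrite /r !addr_ge0 ?mulr_ge0// ltW.
have [mB _] := measure_cube (0 : 'rV[R]_n) r0.
have du w t : is_derive t (1 : R) (fun t : R => u w * mollifier eps (w - z t))
    (u w * - \sum_i v ord0 i * partial i (mollifier eps) (w - z t)).
  have df : derivable (mollifier eps) ((w - x) + t *: - v) (- v).
    by apply: diff_derivable; exact: (smb [::]).
  have E s : w - x + s *: - v = w - z s by rewrite /z scalerN opprD addrA.
  have := is_derive_line df; rewrite E derive_partial; last exact: (smb [::]).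
  under eq_fun do rewrite E.
  move=> /(is_deriveZ (u w)) dd; apply: is_derive_eq; rewrite -sumrN; congr (_ * _).
  by apply: eq_bigr => i _; rewrite mxE mulNr.
have bd w t : -1 < t < 2 -> `|u w * - \sum_i v ord0 i * partial i (mollifier eps) (w -
  z t)| <=
    D * \1_B w.
  move=> t12; rewrite indicE; have [|/negP wB] := boolP (w \in B).
    rewrite inE /B /= subr0 => wr; rewrite mulr1 normrM normrN; apply: ler_pM => //;
      first exact: uC.
    apply: le_trans (ler_norm_sum _ _ _) _; apply: ler_sum => i _.
    by rewrite normrM ler_wpM2l.
  rewrite big1 ?oppr0 ?mulr0 ?normr0// => i _.
  rewrite (@partial_support _ _ (mollifier eps) eps) ?mulr0//.
    by move=> y ey; apply: mollifier_support => //; exact: ltW.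
  rewrite ltNge; apply/negP => /(zr t w t12) wr; apply: wB; apply/mem_set.
  by rewrite /B /= subr0.
have iu (t : R) : mu.-integrable setT (fun w : 'rV[R]_n =>
  (u w * mollifier eps (w - z t))%:E).
  apply: integrable_mul_mollifier => //.
  have [C' uC'] := continuous_bounded_cube (`|z t| + eps) cu; exists C' => w wz; apply: uC'.
  by have := ler_normD (w - z t) (z t); rewrite subrK; lra.
have iD : mu.-integrable setT (EFin \o (fun w : 'rV[R]_n => D * \1_B w)).
  apply: (@integrable_bounded_support _ _ _ 0 D r).
  - by apply: measurable_funM => //; exact: measurable_indic.
  - by move=> w; rewrite indicE; case: (_ \in _); rewrite ?mulr1 ?mulr0 ?normr0// ger0_norm.
  - move=> w rw; rewrite indicE (_ : _ \in _ = false) ?mulr0//.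
    by apply/negbTE/negP => /set_mem; rewrite /B /= leNgt rw.
have p1E (t : R) w : partial1of2 (fun (t : R) (w : 'rV[R]_n) =>
  u w * mollifier eps (w - z t)) t w =
    u w * - \sum_i v ord0 i * partial i (mollifier eps) (w - z t).
  by rewrite /partial1of2 derive1E; exact: (@derive_val _ _ _ _ _ _ _ (du w t)).
have dF (t : R) : 0 <= t <= 1 -> is_derive t (1 : R) F
    (\int[mu]_w (u w * - \sum_i v ord0 i * partial i (mollifier eps) (w - z t))).
  move=> /andP[t0 t1].
  (* an open interval around [0, 1], on which the domination by D holds *)
  have tI : `]-1, 2[%classic t by rewrite /= in_itv/=; apply/andP; split; lra.
  have h1 s : `]-1, 2[%classic s -> mu.-integrable setT (EFin \o (fun w : 'rV[R]_n =>
    u w * mollifier eps (w - z s))).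
    by move=> _; exact: iu.
  have h2 s w : `]-1, 2[%classic s -> setT w -> derivable (fun s : R =>
    u w * mollifier eps (w - z s)) s 1.
    by move=> _ _; exact: (@ex_derive _ _ _ _ _ _ _ (du w s)).
  have h3 w : 0 <= D * \1_B w by rewrite mulr_ge0.
  have h4 s w : `]-1, 2[%classic s -> setT w ->
      `|partial1of2 (fun (t : R) (w : 'rV[R]_n) =>
        u w * mollifier eps (w - z t)) s w| <= D * \1_B w.
    by rewrite /= in_itv/= => s12 _; rewrite p1E; exact: bd.
  split; first by have := derivable_under_integral measurableT tI h1 h2 h3 iD h4.
  rewrite -derive1E (differentiation_under_integral measurableT tI h1 h2 h3 iD h4).
  by apply: eq_Rintegral => w _; exact: p1E.
have igt (t : R) i : mu.-integrable setT (fun w : 'rV[R]_n =>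
  (g w ord0 i * mollifier eps (w - z t))%:E).
  apply: (@ae_dominated_integrable _ (fun w : 'rV[R]_n => K * mollifier eps (w - z t))).
  - apply: measurable_funM; first by have [] := g2 i.
    exact: (measurableT_comp (@measurable_mollifier R n eps) (measurable_shift _)).
  - apply: integrable_mul_mollifier => //; exists `|K| => //.
  - apply: (filterS _ gG) => w gw; rewrite normrM [X in _ * X]ger0_norm ?mollifier_ge0//.
    apply: ler_wpM2r; first exact: mollifier_ge0.
    have /andP[_ GK] := G0K w; apply: le_trans GK; apply: le_trans gw.
    exact: le_trans (coord_le_norm _ _) (norm_le_enorm _).
have dFE (t : R) : \int[mu]_w (u w * - \sum_i v ord0 i * partial i (mollifier eps) (w -
  z t)) =
    \int[mu]_w (dot v (g w) * mollifier eps (w - z t)).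
  have iup i : mu.-integrable setT (EFin \o (fun w : 'rV[R]_n =>
      u w * partial i (mollifier eps) (w - z t))).
    have [C' uC'] := continuous_bounded_cube (`|z t| + eps) cu.
    have C'0 : 0 <= C' by apply: le_trans (uC' 0 _); rewrite ?normr0// addr_ge0// ltW.
    have cp : continuous (partial i (@mollifier R n eps)).
      by apply: smooth_continuous; exact: smooth_partial.
    have p0 w : eps < `|w| -> partial i (@mollifier R n eps) w = 0.
      by apply: partial_support => y ey; apply: mollifier_support => //; exact: ltW.
    apply: (@integrable_bounded_support _ _ _ (z t) (C' * M i) eps).
    - apply: measurable_funM => //.
      exact: (measurableT_comp (continuous_measurable_rV cp) (measurable_shift _)).
    - move=> w; have [wz|zw] := leP `|w - z t| eps.
        rewrite normrM ler_pM// uC'//.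
        by have := ler_normD (w - z t) (z t); rewrite subrK; lra.
      by rewrite p0// mulr0 normr0 mulr_ge0// (le_trans _ (MP i 0)).
    - by move=> w zw; rewrite p0// mulr0.
  transitivity (\int[mu]_w (\sum_i (- v ord0 i) * (u w * partial i (mollifier eps) (w -
    z t)))).
    apply: eq_Rintegral => w _; rewrite -sumrN mulr_sumr; apply: eq_bigr => i _; ring.
  rewrite (Rintegral_sum _ (fun i => integrableZl measurableT (- v ord0 i) (iup i))).2.
  transitivity (\int[mu]_w (\sum_i v ord0 i * (g w ord0 i * mollifier eps (w - z t)))).
    rewrite (Rintegral_sum _ (fun i => integrableZl measurableT (v ord0 i) (igt t i))).2.
    apply: eq_bigr => i _; rewrite !RintegralZl//; last exact: igt.
    have := wg _ (test_function_mollifier (z t) eps0) i.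
    have -> : partial i (fun w : 'rV[R]_n => mollifier eps (w - z t)) =
      (fun w : 'rV[R]_n => partial i (mollifier eps) (w - z t)) by exact: derive_shift.
    by move=> ->; rewrite mulrNN.
  by apply: eq_Rintegral => w _; rewrite /dot mulr_suml; apply: eq_bigr => i _; ring.
have dF_le (t : R) : 0 <= t <= 1 ->
   `|\int[mu]_w (dot v (g w) * mollifier eps (w - z t))| <= enorm v * S.
  move=> t01; have i1 : mu.-integrable setT
      (EFin \o (fun w : 'rV[R]_n => dot v (g w) * mollifier eps (w - z t))).
    rewrite (_ : EFin \o _ = fun w : 'rV[R]_n =>
       (\sum_i v ord0 i * (g w ord0 i * mollifier eps (w - z t)))%:E).
      exact: (Rintegral_sum _ (fun i => integrableZl measurableT (v ord0 i) (igt t i))).1.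
    by apply/funext => w /=; rewrite /dot mulr_suml; congr EFin; apply: eq_bigr => i _;
      ring.
  have i2 : mu.-integrable setT (EFin \o (fun w : 'rV[R]_n =>
    G w * mollifier eps (w - z t))).
    apply: integrable_mul_mollifier => //; exists K => w _.
    by have /andP[G0 GK] := G0K w; rewrite ger0_norm.
  apply: le_trans (le_normr_Rintegral measurableT i1) _.
  apply: (@le_trans _ _ (\int[mu]_w (enorm v * (G w * mollifier eps (w - z t)))));
    last first.
    by rewrite RintegralZl// ler_wpM2l ?enorm_ge0//; exact: GS.
  apply: ae_le_Rintegral.
  - exact: (integrable_norm i1).
  - exact: (integrableZl measurableT (enorm v) i2).
  - by move=> w; exact: normr_ge0.
  - move=> w; rewrite !mulr_ge0 ?enorm_ge0 ?mollifier_ge0//.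
    by have /andP[] := G0K w.
  - apply: (filterS _ gG) => w gw; rewrite normrM [X in _ * X]ger0_norm ?mollifier_ge0//.
    rewrite mulrA ler_wpM2r ?mollifier_ge0//; apply: le_trans (cauchy_schwarz _ _) _.
    by rewrite ler_wpM2l ?enorm_ge0.
have [||c c01] := @MVT R F (fun t => \int[mu]_w (u w * -
  \sum_i v ord0 i * partial i (mollifier eps) (w - z t))) 0 1 ltr01.
- by move=> t; rewrite in_itv/= => /andP[t0 t1]; apply: dF; apply/andP; split; exact: ltW.
- apply: derivable_within_continuous => t; rewrite in_itv/= => t01.
  exact: (@ex_derive _ _ _ _ _ _ _ (dF t t01)).
rewrite subr0 mulr1 dFE {1}/F /z scale1r /F /z scale0r addr0 => ->.
apply: dF_le; move: c01; rewrite in_itv/= => /andP[t0 t1].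
by apply/andP; split; exact: ltW.
Qed.

End mollification.

(** * Increments of a function with a bounded weak gradient *)

Section increments.
Context {R : realType} {n : nat}.
Local Notation mu := (@lebesgue_measure_rV R n).
Local Notation N eps := (\int[mu]_w (@mollifier R n eps w)).
Variables (u : 'rV[R]_n -> R) (g : 'rV[R]_n -> 'rV[R]_n) (G : 'rV[R]_n -> R) (K : R).
Hypotheses (cu : continuous u) (Wu : W12loc u g) (mG : measurable_fun setT G).
Hypotheses (G0K : forall w, 0 <= G w <= K) (gG : {ae mu, forall w, enorm (g w) <= G w}).

Lemma mollifier_mass_gt0 (eps : R) : 0 < eps -> 0 < N eps.
Proof.
move=> eps0; apply: lt_le_trans (Rintegral_mollifier_ge eps0).
by rewrite mulr_gt0 ?exprn_gt0 ?expR_gt0.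
Qed.

Lemma integrable_cst_mollifier (c eps : R) z : 0 < eps ->
  mu.-integrable setT (fun w : 'rV[R]_n => (c * mollifier eps (w - z))%:E).
Proof.
by move=> eps0; apply: (@integrable_mul_mollifier _ _ (cst c)) => //; exists `|c|.
Qed.

Lemma Rintegral_cst_mollifier (c eps : R) z : 0 < eps ->
  \int[mu]_w (c * mollifier eps (w - z)) = c * N eps.
Proof.
move=> eps0; rewrite -(Rintegral_mollifier_shift z eps0).
apply: (@RintegralZl _ _ _ mu setT (fun w : 'rV[R]_n =>
  mollifier eps (w - z)) c measurableT).
by have := integrable_cst_mollifier 1 z eps0; under eq_fun do rewrite mul1r.
Qed.

Lemma mollified_close (eps eta : R) z : 0 < eps ->
  (forall w, `|w - z| < eps -> `|u w - u z| <= eta) ->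
  `|\int[mu]_w (u w * mollifier eps (w - z)) - u z * N eps| <= eta * N eps.
Proof.
move=> eps0 ueta; have mu_ := continuous_measurable_rV cu.
have eta0 : 0 <= eta by apply: le_trans (ueta z _); rewrite ?subrr ?normr0.
have i1 : mu.-integrable setT (fun w : 'rV[R]_n => (u w * mollifier eps (w - z))%:E).
  apply: integrable_mul_mollifier => //; exists (`|u z| + eta) => w /ueta uw.
  by rewrite -[u w](subrK (u z)) addrC (le_trans (ler_normD _ _))// lerD2l.
have i2 : mu.-integrable setT (EFin \o (fun w : 'rV[R]_n =>
    u w * mollifier eps (w - z) - u z * mollifier eps (w - z))).
  exact: (integrableB measurableT i1 (integrable_cst_mollifier (u z) z eps0)).
rewrite -!(Rintegral_cst_mollifier _ z eps0) -RintegralB//;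
  last exact: integrable_cst_mollifier.
apply: le_trans (le_normr_Rintegral measurableT i2) _.
apply: le_Rintegral => //; [exact: (integrable_norm i2)|exact: integrable_cst_mollifier|].
move=> w _; rewrite -mulrBl normrM [X in _ * X]ger0_norm ?mollifier_ge0//.
have [wz|zw] := ltP `|w - z| eps; last by rewrite mollifier_support// !mulr0.
by rewrite ler_wpM2r ?mollifier_ge0// ueta.
Qed.

(** u is compared with its local averages at both ends of the segment, and the
    averages with each other by [mollified_increment]. *)
Lemma weak_gradient_increment (S eps eta : R) x v : 0 < eps ->
  (forall t, 0 <= t <= 1 -> \int[mu]_w (G w * mollifier eps (w - (x + t *: v))) <=
    S * N eps) ->
  (forall w, `|w - x| < eps -> `|u w - u x| <= eta) ->
  (forall w, `|w - (x + v)| < eps -> `|u w - u (x + v)| <= eta) ->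
  `|u (x + v) - u x| <= enorm v * S + 2 * eta.
Proof.
move=> eps0 HS e1 e2; have N0 := mollifier_mass_gt0 eps0.
have H := mollified_increment eps0 cu Wu mG G0K gG HS.
have H1 := mollified_close eps0 e1; have H2 := mollified_close eps0 e2.
rewrite -(ler_pM2r N0) -[X in `|_| * X](gtr0_norm N0) -normrM mulrBl.
move: H H1 H2; set A := \int[mu]_w (u w * mollifier eps (w - (x + v))).
set B := \int[mu]_w (u w * mollifier eps (w - x)); set M := N eps => H H1 H2;
  clearbody A B M.
rewrite (_ : u (x + v) * M - u x * M = (u (x + v) * M - A) + (A - B) + (B - u x * M));
  last by ring.
apply: le_trans (ler_normD _ _) _; apply: le_trans (lerD (ler_normD _ _) (lexx _)) _.
by rewrite distrC in H2; lra.
Qed.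

Lemma integrable_G_mollifier (eps : R) z : 0 < eps ->
  mu.-integrable setT (fun w : 'rV[R]_n => (G w * mollifier eps (w - z))%:E).
Proof.
move=> eps0; apply: integrable_mul_mollifier => //; exists K => w _.
by have /andP[G0 GK] := G0K w; rewrite ger0_norm.
Qed.

Lemma continuous_near (z : 'rV[R]_n) (eta : R) : 0 < eta ->
  exists2 d, 0 < d & forall w, `|w - z| < d -> `|u w - u z| <= eta.
Proof.
move=> eta0; have cz : u w @[w --> nbhs z] --> u z by exact: cu.
move/cvgrPdist_le : cz => /(_ _ eta0)/nbhs_rVP[d d0 H].
by exists d => // w wz; rewrite distrC; exact: H.
Qed.

(** The scale of mollification tends to 0, so that only the values of g near the
    segment matter; G may be larger elsewhere. *)
Lemma increment_along_segment (k rho : R) x v : 0 < rho ->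
  (forall t w, 0 <= t <= 1 -> `|w - (x + t *: v)| < rho -> G w <= k) ->
  `|u (x + v) - u x| <= k * enorm v.
Proof.
move=> rho0 Gk; apply/ler_addgt0Pr => eta eta0.
have eta2 : 0 < eta / 2 by rewrite divr_gt0.
have [d1 d10 H1] := continuous_near x eta2.
have [d2 d20 H2] := continuous_near (x + v) eta2.
pose eps := Num.min rho (Num.min d1 d2).
have eps0 : 0 < eps by rewrite !lt_min rho0 d10.
rewrite (_ : k * enorm v + eta = enorm v * k + 2 * (eta / 2)); last by field.
apply: (@weak_gradient_increment _ eps) => //.
- move=> t t01; rewrite -(Rintegral_cst_mollifier k (x + t *: v) eps0).
  apply: le_Rintegral => //.
  + exact: integrable_G_mollifier.
  + exact: integrable_cst_mollifier.
  + move=> w _; have [wz|zw] := ltP `|w - (x + t *: v)| eps;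
      last by rewrite mollifier_support// !mulr0.
    rewrite ler_wpM2r ?mollifier_ge0//; apply: (Gk t) => //.
    by apply: lt_le_trans wz _; rewrite ge_min lexx.
- by move=> w wx; apply: H1; apply: lt_le_trans wx _; rewrite !ge_min lexx orbT.
- by move=> w wx; apply: H2; apply: lt_le_trans wx _; rewrite !ge_min lexx !orbT.
Qed.

Lemma weak_lipschitz x y : `|u y - u x| <= K * enorm (y - x).
Proof.
have := @increment_along_segment K 1 x (y - x) ltr01; rewrite [x + _]addrC subrK; apply.
by move=> t w _ _; have /andP[] := G0K w.
Qed.

(** If |g| is at most c off a set E that fills only a small proportion of the
    cubes of side eps along the segment, mollifying at the scale eps shows that u
    grows at most at the rate c, up to small errors. *)
Lemma increment_density (c beta eps : R) (E : set 'rV[R]_n) x v : 0 < eps -> 0 <= c ->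
  measurable E -> (forall w, G w <= c + K * \1_E w) ->
  (forall t, 0 <= t <= 1 ->
    (mu (E `&` [set w | (`|w - (x + t *: v)| < eps)%R]) <= (beta * eps ^+ n)%:E)%E) ->
  `|u (x + v) - u x| <= enorm v * (c + K * (beta / (expR (- 2) ^+ 2) ^+ n)) +
     2 * (K * (n.+1%:R * eps)).
Proof.
move=> eps0 c0 mE GE Hb; set kap := (expR (- 2) ^+ 2) ^+ n.
have kap0 : 0 < kap by rewrite !exprn_gt0// expR_gt0.
have K0 : 0 <= K by have /andP[] := G0K 0; exact: le_trans.
have near z w : `|w - z| < eps -> `|u w - u z| <= K * (n.+1%:R * eps).
  move=> wz; apply: le_trans (weak_lipschitz _ _) _; apply: ler_wpM2l => //.
  by apply: le_trans (enorm_le_norm _) _; rewrite ler_wpM2l// ltW.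
apply: (@weak_gradient_increment _ eps); [by []| |exact: near|exact: near].
move=> t t01; set z := x + t *: v.
have mQ : measurable (E `&` [set w | `|w - z| < eps]).
  by apply: measurableI => //; exact: measurable_cube.
have Qoo : (mu (E `&` [set w | (`|w - z| < eps)%R]) < +oo)%E.
  by apply: le_lt_trans (Hb t t01) _; rewrite ltry.
pose Q := E `&` [set w | `|w - z| < eps].
have iQ : mu.-integrable setT (EFin \o \1_Q).
  apply: (@integrable_bounded_support _ _ _ z 1 eps); first exact: measurable_indic.
    by move=> w; rewrite indicE; case: (_ \in _); rewrite ?normr0 ?normr1.
  move=> w ew; rewrite indicE (_ : _ \in _ = false)//.
  by apply/negbTE/negP => /set_mem[_]; rewrite /= ltNge ltW.
have QE : \int[mu]_w \1_Q w <= beta * eps ^+ n.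
  rewrite /Rintegral integral_indic// setIT.
  by rewrite -lee_fin fineK ?Hb// ge0_fin_numE.
apply: (@le_trans _ _ (\int[mu]_w (c * mollifier eps (w - z) + K * \1_Q w))).
  apply: le_Rintegral => //.
  - exact: integrable_G_mollifier.
  - exact: (integrableD measurableT (integrable_cst_mollifier c z eps0)
      (integrableZl measurableT K iQ)).
  - move=> w _; have [wz|zw] := ltP `|w - z| eps; last first.
      by rewrite mollifier_support// !mulr0 add0r mulr_ge0.
    apply: (@le_trans _ _ ((c + K * \1_E w) * mollifier eps (w - z))).
      by rewrite ler_wpM2r ?mollifier_ge0.
    rewrite mulrDl lerD2l (_ : \1_Q w = \1_E w); last first.
      by rewrite !indicE /Q in_setI; congr (_%:R); rewrite [X in _ && X]mem_set ?andbT.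
    by rewrite -[leRHS]mulr1 ler_wpM2l ?mollifier_le1// mulr_ge0.
rewrite RintegralD//; last 2 first.
- exact: integrable_cst_mollifier.
- exact: (integrableZl measurableT K iQ).
rewrite Rintegral_cst_mollifier// RintegralZl// mulrDl lerD2l -mulrA ler_wpM2l//.
have Nk := Rintegral_mollifier_ge (n := n) eps0.
apply: le_trans QE _; rewrite -mulrA.
have b0 : 0 <= beta.
  have := le_trans (measure_ge0 mu _) (Hb t t01); rewrite lee_fin.
  by rewrite pmulr_lge0// exprn_gt0.
by apply: ler_wpM2l => //; rewrite ler_pdivlMl.
Qed.

End increments.

Section product_density.
Context {R : realType}.
Local Notation mu := (@lebesgue_measure_rV R _).
Local Notation la := (@lebesgue_measure R).

Lemma density_compl (A : set R) : measurable A ->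
  {ae la, forall t, A t -> forall beta : R, 0 < beta -> exists2 d : R, 0 < d &
    forall r, 0 < r -> r < d -> (la (~` A `&` ball t r) <= (beta * r)%:E)%E}.
Proof.
move=> mA; apply: filterS (lebesgue_density mA).
  exact: (ae_filter_ringOfSetsType la).
move=> t; rewrite indicE => + At beta beta0; rewrite mem_set// => /= dens.
have /fine_cvgP[finr /cvgrPdist_lt/(_ (beta / 2))] := dens.
rewrite divr_gt0// => /(_ isT) [d /= d0 Hd].
exists d => // r r0 rd.
have mb : measurable (ball t r : set (measurableTypeR R)) by exact: measurable_ball.
have bE : la (ball t r) = (r *+ 2)%:E by exact: (lebesgue_measure_ball t (ltW r0)).
have boo : (la (ball t r) < +oo)%E by rewrite bE ltry.
have Xfin : la (A `&` ball t r) \is a fin_num.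
  by rewrite ge0_fin_numE// (le_lt_trans _ boo)// le_measure ?inE//; exact: measurableI.
have := Hd r; rewrite /ball_ /= sub0r normrN gtr0_norm// => /(_ rd r0).
rewrite bE -(fineK Xfin) inver mulrn_eq0 /= gt_eqF//= => H.
rewrite (_ : ~` A `&` ball t r = ball t r `\` (A `&` ball t r)); last first.
  by rewrite setDE setCI setIUr setICr setU0 setIC.
rewrite measureD//; last exact: measurableI.
rewrite (setIidr (@subIsetr _ _ _)).
apply: (@le_trans _ _ ((r *+ 2)%:E - la (A `&` ball t r))%E); first by rewrite -bE.
rewrite -(fineK Xfin) -EFinB lee_fin; move: H.
set X := fine _ => /ltr_normlW; rewrite ltrBlDr -ltrBlDl ltr_pdivlMr ?mulrn_wgt0//.
by rewrite (mulr2n r) => h; lra.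
Qed.

(** A point of the cube outside the product has a coordinate outside A, which
    confines it to one of n slabs of small relative thickness. *)
Lemma product_density n (A : set R) : measurable A ->
  {ae @lebesgue_measure_rV R n, forall x : 'rV[R]_n, (forall i, A (x ord0 i)) ->
    forall beta : R, 0 < beta -> exists2 d : R, 0 < d & forall r, 0 < r -> r < d ->
    (mu (~` [set w : 'rV[R]_n | forall i, A (w ord0 i)] `&`
       [set w : 'rV[R]_n | (`|w - x| < r)%R]) <= (beta * r ^+ n)%:E)%E}.
Proof.
move=> mA.
have : {ae @lebesgue_measure_rV R n, forall x : 'rV[R]_n, forall j : nat,
  forall i : 'I_n, i = j :> nat ->
    A (x ord0 i) -> forall beta : R, 0 < beta -> exists2 d : R, 0 < d &
    forall r, 0 < r -> r < d -> (la (~` A `&` ball (x ord0 i) r) <= (beta * r)%:E)%E}.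
  apply: ae_foralln => j; have [jn|nj] := ltnP j n; last first.
    by apply: aeW => x i ij; move: nj; rewrite -ij leqNgt ltn_ord.
  apply: (filterS _ (ae_coord (Ordinal jn) (density_compl mA))) => x dx i ij.
  by rewrite (_ : i = Ordinal jn)//; exact/val_inj.
apply: (filterS (F := almost_everywhere (@lebesgue_measure_rV R n))) => x dx Ax beta beta0.
(* n slabs of measure at most b1 2^n r^n each *)
pose b1 := beta / (n.+1%:R * 2 ^+ n).
have b10 : 0 < b1 by rewrite divr_gt0// mulr_gt0 ?ltr0n ?exprn_gt0.
have /choice[d dP] : forall i : 'I_n, exists d : R, 0 < d /\
    forall r, 0 < r -> r < d -> (la (~` A `&` ball (x ord0 i) r) <= (b1 * r)%:E)%E.
  by move=> i; have [d d0 Hd] := dx i i erefl (Ax i) _ b10; exists d.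
have s0 : 0 < 1 + \sum_i (d i)^-1.
  by rewrite ltr_pwDl// sumr_ge0// => i _; rewrite invr_ge0 ltW// (dP i).1.
exists (1 + \sum_i (d i)^-1)^-1; first by rewrite invr_gt0.
move=> r r0 rd.
have rdi i : r < d i.
  apply: lt_le_trans rd _; rewrite -[leRHS]invrK lef_pV2 ?posrE ?invr_gt0 ?(dP i).1//.
  rewrite (bigD1 i)//= addrCA lerDl addr_ge0// sumr_ge0// => j _.
  by rewrite invr_ge0 ltW// (dP j).1.
pose S (k : nat) (j : 'I_n) : set R :=
  if (j == k :> nat) then ~` A `&` ball (x ord0 j) r else ball (x ord0 j) r.
have mb t : measurable (ball t r : set (measurableTypeR R)) by exact: measurable_ball.
have mS k j : measurable (S k j).
  by rewrite /S; case: ifP => _; [apply: measurableI;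
    [exact: measurableC|exact: mb]|exact: mb].
pose box k := [set w : 'rV[R]_n | forall j, S k j (w ord0 j)].
have mbox k : measurable (box k) by exact: (measure_box (mS k)).1.
have box_le (k : nat) : (k < n)%N ->
    (mu (box k) <= (b1 * 2 ^+ n * r ^+ n)%:E)%E.
  move=> kn; pose k' := Ordinal kn; rewrite (measure_box (mS k)).2.
  have bE t : la (ball t r) = (2 * r)%:E.
    by rewrite mulr_natl; exact: (lebesgue_measure_ball t (ltW r0)).
  rewrite (bigD1 k')//=.
  rewrite (eq_bigr (fun=> (2 * r)%:E)); last first.
    by move=> j jk; rewrite /S ifN ?bE//; apply: contra jk => /eqP jk; apply/eqP/val_inj.
  rewrite prodEFin {1}/S eqxx.
  apply: (@le_trans _ _ ((b1 * r)%:E * (\prod_(j < n | j != k') (2 * r))%:E)%E).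
    apply: lee_wpmul2r; last exact: (dP k').2.
    by rewrite lee_fin prodr_ge0// => _ _; rewrite mulr_ge0// ltW.
  rewrite -EFinM lee_fin -mulrA -mulrA; apply: ler_wpM2l; first exact: ltW.
  rewrite -exprMn -[X in _ ^+ X](card_ord n) -prodr_const [leRHS](bigD1 k')//=.
  by apply: ler_wpM2r; [rewrite prodr_ge0// => _ _; rewrite mulr_ge0// ltW|lra].
apply: (@le_trans _ _ (mu (\big[setU/set0]_(k < n) box k))).
  apply: le_measure; rewrite ?inE.
  - apply: measurableI; last exact: measurable_cube.
    by apply: measurableC; exact: (measure_box (fun=> mA)).1.
  - by apply: bigsetU_measurable => k _.
  - move=> w [/existsNP[k nAk] wx]; rewrite -bigcup_mkord; exists (k : nat) => //= j.
    have wj : ball (x ord0 j) r (w ord0 j).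
      rewrite /ball /= distrC; apply: le_lt_trans wx.
      by have := coord_le_norm (w - x) j; rewrite !mxE.
    rewrite /S; case: eqP => // jk; split => //.
    by rewrite (_ : j = k)//; exact/val_inj.
apply: le_trans (@Boole_inequality _ _ _ (@lebesgue_measure_rV R n) box n (fun k _ =>
  mbox k)) _.
apply: (@le_trans _ _ (\sum_(k < n) (b1 * 2 ^+ n * r ^+ n)%:E)%E).
  by apply: lee_sum => k _; exact: box_le.
rewrite sumEFin lee_fin sumr_const card_ord -[leLHS]mulr_natl mulrA; apply: ler_wpM2r.
  by rewrite exprn_ge0// ltW.
have -> : b1 * 2 ^+ n = beta / n.+1%:R.
  by rewrite /b1 invfM mulrA divfK// expf_neq0// pnatr_eq0.
by rewrite mulrA ler_pdivrMr ?ltr0n// mulrC ler_wpM2l ?ler_nat// ltW.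
Qed.

End product_density.

(** * Cantor sets *)

Section cantor.
Context {R : realType}.
Local Notation la := (@lebesgue_measure R).
Variable a : nat -> R.
Hypothesis a01 : forall j, 0 < a j < 1.

(** Starting at an arbitrary generation k and interval I makes it possible to peel
    off the first letter of the words, as in [cantor_levelS]. *)
Definition cantor_level k (I : R * R) m : set R :=
  \bigcup_(w in [set w : seq bool | size w = m])
    (let J := cantor_descend a k I w in `[J.1, J.2]%classic).

Lemma cantor_level0 k I : cantor_level k I 0 = `[I.1, I.2]%classic.
Proof.
apply/seteqP; split => [t [w /= /size0nil ->]//|t It].
by exists [::].
Qed.

Lemma cantor_levelS k I m : cantor_level k I m.+1 =
  cantor_level k.+1 (cantor_child (a k) I false) m `|`
  cantor_level k.+1 (cantor_child (a k) I true) m.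
Proof.
apply/seteqP; split => [t [[|b w] //= [wm] wt]|t].
  by case: b wt => wt; [right|left]; exists w.
by case=> -[w /= wm wt]; [exists (false :: w)|exists (true :: w)] => //=; rewrite wm.
Qed.

Lemma cantor_child_bounds k (I : R * R) b : I.1 < I.2 ->
  let J := cantor_child (a k) I b in
  [/\ I.1 <= J.1, J.1 < J.2, J.2 <= I.2 & J.2 - J.1 = (1 - a k) / 2 * (I.2 - I.1)].
Proof.
move=> I12; have /andP[a0 a1] := a01 k; rewrite /cantor_child.
have h1 : a k * (I.2 - I.1) < I.2 - I.1 by rewrite gtr_pMl// subr_gt0.
have h0 : 0 < a k * (I.2 - I.1) by rewrite mulr_gt0// subr_gt0.
by case: b => /=; split; lra.
Qed.

Lemma cantor_level_sub k I m : I.1 < I.2 -> cantor_level k I m `<=` `[I.1, I.2]%classic.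
Proof.
elim: m k I => [|m IH] k I I12; first by rewrite cantor_level0.
have H b : cantor_level k.+1 (cantor_child (a k) I b) m `<=` `[I.1, I.2]%classic.
  have [h1 h2 h3 _] := cantor_child_bounds k b I12.
  move=> t /(IH _ _ h2); rewrite /= !in_itv/= => /andP[t1 t2].
  by rewrite (le_trans h1 t1) (le_trans t2 h3).
by rewrite cantor_levelS => t [] /H.
Qed.

Lemma cantor_level_closed k I m : closed (cantor_level k I m).
Proof.
elim: m k I => [|m IH] k I; first by rewrite cantor_level0; exact: interval_closed.
by rewrite cantor_levelS; exact: closedU.
Qed.

Lemma cantor_level_decr k I m : I.1 < I.2 ->
  cantor_level k I m.+1 `<=` cantor_level k I m.
Proof.
elim: m k I => [|m IH] k I I12.
  by rewrite cantor_level0; exact: cantor_level_sub.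
rewrite cantor_levelS [X in _ `<=` X]cantor_levelS; apply: setUSS; apply: IH.
  by have [] := cantor_child_bounds k false I12.
by have [] := cantor_child_bounds k true I12.
Qed.

(** The centre of each interval of generation m is removed in the next step. *)
Lemma cantor_level_gap k I m t : I.1 < I.2 -> cantor_level k I m t ->
  exists c, [/\ I.1 <= c <= I.2, `|c - t| <= (I.2 - I.1) / 2 ^+ m &
    ~ cantor_level k I m.+1 c].
Proof.
elim: m k I t => [|m IH] k I t I12.
  rewrite cantor_level0 /= in_itv/= => /andP[t1 t2]; exists ((I.1 + I.2) / 2); split.
  - by apply/andP; split; lra.
  - by rewrite expr0 divr1 ler_norml; apply/andP; split; lra.
  - rewrite cantor_levelS !cantor_level0 /cantor_child /= !in_itv/=.
    have /andP[a0 _] := a01 k.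
    have h0 : 0 < a k * (I.2 - I.1) by rewrite mulr_gt0// subr_gt0.
    by case=> /andP[? ?]; lra.
rewrite cantor_levelS => ht.
have [b {ht}ht] : exists b, cantor_level k.+1 (cantor_child (a k) I b) m t.
  by case: ht => ht; [exists false|exists true].
have [h1 h2 h3 h4] := cantor_child_bounds k b I12.
have [c [/andP[c1 c2] ct nc]] := IH k.+1 _ t h2 ht.
exists c; split.
- by rewrite (le_trans h1 c1) (le_trans c2 h3).
- apply: le_trans ct _; rewrite h4 exprS invfM mulrA; apply: ler_wpM2r.
    by rewrite invr_ge0 exprn_ge0.
  have /andP[a0 a1] := a01 k; have I0 : 0 < I.2 - I.1 by rewrite subr_gt0.
  have : 0 < a k * (I.2 - I.1) by rewrite mulr_gt0.
  lra.
- have /andP[a0 a1] := a01 k.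
  have h0 : 0 < a k * (I.2 - I.1) by rewrite mulr_gt0// subr_gt0.
  have [g1 g2 g3 _] := cantor_child_bounds k (~~ b) I12.
  rewrite cantor_levelS => H.
  have [//|] : cantor_level k.+1 (cantor_child (a k) I b) m.+1 c \/
      cantor_level k.+1 (cantor_child (a k) I (~~ b)) m.+1 c.
    by case: b {IH ht h1 h2 h3 h4 c1 c2 ct nc g1 g2 g3} H => /=; tauto.
  move=> /(cantor_level_sub g2); rewrite /= in_itv/= => /andP[d1 d2].
  move: c1 c2 d1 d2; rewrite /cantor_child; case: (b) => /=; lra.
Qed.

(** The part removed from I is the central gap, of length a_k |I|, and what is
    removed from its two children; the bound that subadditivity gives satisfies the
    recursion of 1 - prod (1 - a_j). *)
Lemma cantor_level_measure k I m : I.1 < I.2 ->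
  (la (`[I.1, I.2] `\` cantor_level k I m) <=
   ((I.2 - I.1) * (1 - \prod_(j < m) (1 - a (k + j))))%:E)%E.
Proof.
have mL k' I' m' : measurable (cantor_level k' I' m' : set (measurableTypeR R)).
  by apply: closed_measurable; exact: cantor_level_closed.
have mI (I' : R * R) : measurable (`[I'.1, I'.2]%classic : set (measurableTypeR R)).
  exact: measurable_itv.
elim: m k I => [|m IH] k I I12.
  by rewrite cantor_level0 setDv measure0 big_ord0 subrr mulr0.
have /andP[a0 a1] := a01 k; have I0 : 0 < I.2 - I.1 by rewrite subr_gt0.
have h0 : 0 < a k * (I.2 - I.1) by rewrite mulr_gt0.
pose J b := cantor_child (a k) I b.
have [f1 f2 f3 f4] := cantor_child_bounds k false I12.
have [t1 t2 t3 t4] := cantor_child_bounds k true I12.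
pose gap : set R := `](J false).2, (J true).1[%classic.
pose D b := `[(J b).1, (J b).2] `\` cantor_level k.+1 (J b) m.
have mD b : measurable (D b : set (measurableTypeR R)) by exact: measurableD.
have mgap : measurable (gap : set (measurableTypeR R)) by exact: measurable_itv.
have sub : `[I.1, I.2] `\` cantor_level k I m.+1 `<=` gap `|` (D false `|` D true).
  move=> x [/=]; rewrite in_itv/= => /andP[x1 x2].
  rewrite cantor_levelS => /not_orP[nf nt].
  have [xf|xf] := leP x (J false).2.
    right; left; split => //=; rewrite in_itv/= xf andbT.
    by rewrite /J /cantor_child /=.
  have [xt|xt] := leP (J true).1 x.
    right; right; split => //=; rewrite in_itv/= xt /=.
    by rewrite /J /cantor_child /=.
  by left; rewrite /gap /= in_itv/= xf xt.
have gapE : la gap = (a k * (I.2 - I.1))%:E.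
  rewrite /gap lebesgue_measure_itv/= lte_fin ifT; last by rewrite /J /cantor_child /=; lra.
  by rewrite -EFinB /J /cantor_child /=; congr EFin; field.
apply: (@le_trans _ _ (la (gap `|` (D false `|` D true)))).
  apply: le_measure => //; rewrite inE; first exact: measurableD.
  by apply: measurableU => //; exact: measurableU.
have mDD : measurable (D false `|` D true : set (measurableTypeR R)) by exact: measurableU.
apply: (le_trans (measureU2 _ mgap mDD)).
apply: (@le_trans _ _ (la gap + (la (D false) + la (D true)))%E).
  by apply: leeD2l; exact: measureU2.
set P := \prod_(j < m) (1 - a (k.+1 + j)).
apply: (@le_trans _ _ ((a k * (I.2 - I.1))%:E +
  (((1 - a k) / 2 * (I.2 - I.1) * (1 - P))%:E + ((1 - a k) / 2 * (I.2 - I.1) * (1 -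
    P))%:E))%E).
  apply: leeD; first by rewrite gapE.
  apply: leeD; [have := IH k.+1 (J false) f2|have := IH k.+1 (J true) t2].
    by rewrite -/(D false) f4.
  by rewrite -/(D true) t4.
rewrite -!EFinD lee_fin big_ord_recl addn0.
rewrite (eq_bigr (fun j : 'I_m => 1 - a (k.+1 + j))); last by move=> j _;
  rewrite /= /bump /= addnA addn1.
rewrite -/P le_eqVlt; apply/orP; left; apply/eqP; by field.
Qed.

Lemma prod_compl_ge (m : nat) (b : nat -> R) : (forall j, 0 <= b j <= 1) ->
  1 - \sum_(j < m) b j <= \prod_(j < m) (1 - b j).
Proof.
move=> b01; elim: m => [|m IH]; first by rewrite !big_ord0 subr0.
rewrite !big_ord_recr /=; have /andP[b0 b1] := b01 m.
have p1 : \prod_(j < m) (1 - b j) <= 1.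
  by apply: prodr_ile1 => j _; have /andP[] := b01 j; lra.
set P := \prod_(_ < _) _ in IH p1 *; set S := \sum_(_ < _) _ in IH *.
have : P * b m <= b m by rewrite ler_piMl.
lra.
Qed.

(** A tail of the series has sum at most 1 / 2, and [prod_compl_ge] bounds the
    corresponding tail product from below. *)
Lemma prod_compl_bounded_below : cvgn [normed series a] ->
  exists2 p : R, 0 < p & forall m, p <= \prod_(j < m) (1 - a j).
Proof.
move=> ca; pose S := series (fun j => `|a j|).
have S_nd : nondecreasing_seq S.
  by apply: nondecreasing_series => j _ _; exact: normr_ge0.
have Sl m : S m <= limn S by exact: nondecreasing_cvgn_le.
have [N HN] : exists N : nat, limn S - S N < 1 / 2.
  have /cvgrPdist_lt/(_ (1 / 2)) : S @ \oo --> limn S by exact: ca.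
  rewrite divr_gt0// => /(_ isT)[N _ /(_ N (leqnn N))] /= H.
  by exists N; apply: le_lt_trans H; exact: ler_norm.
exists (\prod_(j < N) (1 - a j) * (1 / 2)).
  apply: mulr_gt0; last by lra.
  by apply: prodr_gt0 => j _; have /andP[_] := a01 j; rewrite subr_gt0.
have fac01 j : 0 < 1 - a j <= 1 by have /andP[? ?] := a01 j; apply/andP; split; lra.
have tail m : 1 / 2 <= \prod_(j < m) (1 - a (N + j)).
  apply: le_trans (@prod_compl_ge m (fun j => a (N + j)%N) _); last first.
    by move=> j; have /andP[? ?] := a01 (N + j); apply/andP; split; apply: ltW.
  have E : \sum_(j < m) a (N + j) = S (N + m)%N - S N.
    rewrite /S /series /= !big_mkord big_split_ord /= addrAC subrr add0r.
    by apply: eq_bigr => j _; rewrite gtr0_norm//; have /andP[] := a01 (N + j)%N.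
  by rewrite E; have := Sl (N + m)%N; lra.
move=> m; have [mN|Nm] := leqP m N.
  rewrite -(subnKC mN) big_split_ord /= -mulrA -[leRHS]mulr1.
  apply: ler_wpM2l; first by apply: prodr_ge0 => j _; have /andP[/ltW] := fac01 j.
  apply: mulr_ile1 => //; last by lra.
    by apply: prodr_ge0 => j _; have /andP[/ltW] := fac01 (m + j)%N.
  by apply: prodr_ile1 => j _; have /andP[/ltW -> ->] := fac01 (m + j)%N.
rewrite -(subnKC (ltnW Nm)) big_split_ord /=; apply: ler_wpM2l; last exact: tail.
by apply: prodr_ge0 => j _; have /andP[/ltW] := fac01 j.
Qed.

Lemma cantor_setE : cantor_set_of a =
  \bigcap_(m in [set m | (0 < m)%N]) cantor_level 0 (0, 1) m.
Proof. by []. Qed.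

Lemma cantor_set_closed : closed (cantor_set_of a).
Proof. by rewrite cantor_setE; apply: closed_bigI => m _; exact: cantor_level_closed. Qed.

Lemma cantor_set_measurable : measurable (cantor_set_of a : set (measurableTypeR R)).
Proof. exact: closed_measurable cantor_set_closed. Qed.

Lemma cantor_set_gap t (eta : R) : 0 < eta ->
  exists2 c, `|c - t| < eta & ~ cantor_set_of a c.
Proof.
move=> eta0; have [Ct|] := pselect (cantor_set_of a t); last first.
  by exists t => //; rewrite subrr normr0.
have [m meta] : exists m : nat, 1 / 2 ^+ m.+1 < eta.
  have [m] := natSinv_mul_lt 1 eta0; rewrite !mul1r => meta; exists m.
  apply: le_lt_trans meta; rewrite mul1r lef_pV2 ?posrE ?exprn_gt0 ?ltr0n//.
  by rewrite -natrX ler_nat ltnW// ltn_expl.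
have [|c [_ ct nc]] := @cantor_level_gap 0 (0, 1) m.+1 t ltr01; first exact: (Ct m.+1).
exists c; first by apply: le_lt_trans ct _; rewrite /= subr0.
by move=> /(_ m.+2 isT).
Qed.

Lemma cantor_set_measure_gt0 : cvgn [normed series a] -> (0 < la (cantor_set_of a))%E.
Proof.
move=> ca; have [p p0 pP] := prod_compl_bounded_below ca.
pose C := cantor_set_of a; pose I : set R := `[0, 1]%classic.
pose F m := I `\` cantor_level 0 (0, 1) m.+1.
have mL m : measurable (cantor_level 0 (0, 1) m : set (measurableTypeR R)).
  by apply: closed_measurable; exact: cantor_level_closed.
have mI : measurable (I : set (measurableTypeR R)) by exact: measurable_itv.
have mF m : measurable (F m : set (measurableTypeR R)) by exact: measurableD.
have mC := cantor_set_measurable.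
have UF : \bigcup_m F m = I `\` C.
  apply/seteqP; split => [t [m _ [It nt]]|t [It nC]].
    by split => // /(_ m.+1 isT).
  have /existsNP[[|m] /not_implyP[//= _ nm]] := nC.
  by exists m.
have Fle : (la (I `\` C) <= (1 - p)%:E)%E.
  rewrite -UF.
  have cF : la \o F @ \oo --> la (\bigcup_m F m).
    apply: nondecreasing_cvg_mu => //; first exact: bigcupT_measurable.
    apply/nondecreasing_seqP => m; apply/subsetPset; apply: setDS.
    exact: cantor_level_decr.
  have <- := cvg_lim (@ereal_hausdorff R) cF.
  apply: lime_le; first by apply/cvg_ex; eexists; exact: cF.
  apply: nearW => m; have H := @cantor_level_measure 0 (0, 1) m.+1 ltr01.
  apply: (le_trans H).
  by rewrite /= subr0 mul1r lee_fin lerD2l lerN2; exact: pP.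
rewrite lt_neqAle measure_ge0 andbT eq_sym; apply/eqP => C0.
have : (la I <= la (I `\` C) + la C)%E.
  rewrite -[leLHS]/(la I); apply: le_trans (measureU2 _ _ _) => //; last exact: measurableD.
  apply: le_measure; rewrite ?inE//; first by apply: measurableU => //; exact: measurableD.
  by move=> t It; have [?|?] := pselect (C t); [right|left].
rewrite C0 adde0 => /le_trans/(_ Fle).
by rewrite /I lebesgue_measure_itv/= lte_fin ltr01 -EFinB lee_fin; lra.
Qed.

End cantor.

(** * Intrinsic Lipschitz constants from an asymptotic distance *)

Section intrinsic_lipschitz.
Context {R : realType} {n : nat}.
Implicit Types (x y z v w : 'rV[R]_n).

Lemma dnbhs_rVP x (V : set 'rV[R]_n) :
  x^' V <-> exists2 e : R, 0 < e & forall y, `|y - x| < e -> y != x -> V y.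
Proof. exact: nbhs_rVP. Qed.

Lemma limf_esup_le (f : 'rV[R]_n -> \bar R) x (l : \bar R) (d : R) : 0 < d ->
  (forall y, `|y - x| < d -> y != x -> (f y <= l)%E) -> (limf_esup f x^' <= l)%E.
Proof.
move=> d0 H; apply: (@le_trans _ _ (ereal_sup (f @` [set y | `|y - x| < d /\ y != x]))).
  apply: ereal_inf_lbound; exists [set y | `|y - x| < d /\ y != x] => //.
  by apply/dnbhs_rVP; exists d.
by apply: ub_ereal_sup => _ [y [yd yx] <-]; exact: H.
Qed.

Lemma limf_esup_ge (f : 'rV[R]_n -> \bar R) x (l : \bar R) :
  (forall d, 0 < d -> exists y, [/\ `|y - x| < d, y != x & (l <= f y)%E]) ->
  (l <= limf_esup f x^')%E.
Proof.
move=> H; apply: le_ereal_inf_tmp => _ [V /dnbhs_rVP[d d0 VP] <-].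
have [y [yd yx ly]] := H d d0; apply: le_trans ly _.
by apply: ereal_sup_ubound; exists y => //; exact: VP.
Qed.

Lemma limf_esup_eq (f : 'rV[R]_n -> \bar R) x (l : R) :
  (forall eps, 0 < eps -> exists2 d, 0 < d &
    forall y, `|y - x| < d -> y != x -> (f y <= (l + eps)%:E)%E) ->
  (forall eps, 0 < eps -> forall d, 0 < d ->
     exists y, [/\ `|y - x| < d, y != x & ((l - eps)%:E <= f y)%E]) ->
  limf_esup f x^' = l%:E.
Proof.
move=> H1 H2; apply/eqP; rewrite eq_le; apply/andP; split.
  apply/lee_addgt0Pr => eps eps0; have [d d0 Hd] := H1 _ eps0.
  by rewrite -EFinD; exact: (limf_esup_le d0).
apply/lee_subgt0Pr => eps eps0; rewrite -EFinB; apply: limf_esup_ge; exact: H2.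
Qed.

Variable A : 'rV[R]_n -> 'M[R]_n.

Lemma intrinsic_dist_le x y (M : R) :
  (forall f, admissible A f -> f x - f y <= M) -> (intrinsic_dist A x y <= M%:E)%E.
Proof. by move=> H; apply: ub_ereal_sup => _ [f Af <-]; rewrite lee_fin; exact: H. Qed.

Lemma intrinsic_dist_ge x y f : admissible A f ->
  ((f x - f y)%:E <= intrinsic_dist A x y)%E.
Proof. by move=> Af; apply: ereal_sup_ubound; exists f. Qed.

Lemma div_EFin (a b : R) : 0 < b -> (a%:E / b%:E)%E = (a / b)%:E.
Proof. by move=> b0; rewrite inver gt_eqF. Qed.

(** Replacing |y - x| by d_A(x, y) multiplies all difference quotients at x by c up
    to o(1), so the upper bound is the Cauchy-Schwarz inequality, and the lower
    bound is approached along the gradient. *)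
Lemma intrinsic_Lip_asymptotic f x (c : R) : (0 < n)%N -> 0 < c ->
  (forall eps, 0 < eps -> exists2 d : R, 0 < d & forall h : 'rV[R]_n, `|h| < d ->
    `|f (x + h) - f x - \sum_i partial i f x * h ord0 i| <= eps * `|h|) ->
  (forall eps, 0 < eps -> exists2 d : R, 0 < d & forall y, `|y - x| < d ->
    ((enorm (y - x) / c)%:E <= intrinsic_dist A x y <=
      ((c^-1 + eps) * enorm (y - x))%:E)%E) ->
  intrinsic_Lip A f x = (c * enorm (grad f x))%:E.
Proof.
move=> n0 c0 df asym; set p := grad f x.
have dotE (h : 'rV[R]_n) : \sum_i partial i f x * h ord0 i = dot p h.
  by apply: eq_bigr => i _; rewrite mxE.
have ratio y (D1 D2 : R) : 0 < D1 ->
    (D1%:E <= intrinsic_dist A x y <= D2%:E)%E ->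
    (((`|f y - f x| / D2)%:E <= `|f y - f x|%:E / intrinsic_dist A x y)%E *
    (`|f y - f x|%:E / intrinsic_dist A x y <= (`|f y - f x| / D1)%:E)%E)%type.
  move=> D10; case: intrinsic_dist => [D| |]; last 2 first.
  - by move=> /andP[_]; rewrite leNgt ltry.
  - by move=> /andP[]; rewrite leNgt ltNyr.
  rewrite !lee_fin => /andP[h1 h2].
  have D0 : 0 < D by exact: lt_le_trans h1.
  rewrite div_EFin// !lee_fin; split.
    by rewrite ler_wpM2l// lef_pV2 ?posrE// (lt_le_trans D0).
  by rewrite ler_wpM2l// lef_pV2 ?posrE.
apply: limf_esup_eq => eps eps0.
  have e1 : 0 < eps / c by rewrite divr_gt0.
  have [d1 d10 H1] := df _ e1; have [d2 d20 H2] := asym 1 ltr01.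
  exists (Num.min d1 d2); first by rewrite lt_min d10.
  move=> y; rewrite lt_min => /andP[yd1 yd2] yx.
  have N0 : 0 < enorm (y - x) by apply: enorm_gt0; rewrite subr_eq0.
  have D10 : 0 < enorm (y - x) / c by rewrite divr_gt0.
  have [_ /le_trans] := ratio y _ _ D10 (H2 y yd2); apply.
  rewrite lee_fin ler_pdivrMr// mulrA.
  have := H1 (y - x) yd1; rewrite [x + _]addrC subrK dotE => h1.
  have h2 := cauchy_schwarz p (y - x); have h3 := norm_le_enorm (y - x).
  have h4 : eps / c * `|y - x| <= eps / c * enorm (y - x) by rewrite ler_wpM2l// ltW.
  have h5 := ler_normD (f y - f x - dot p (y - x)) (dot p (y - x)).
  rewrite subrK in h5.
  have -> : (c * enorm p + eps) * enorm (y - x) / c =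
     enorm p * enorm (y - x) + eps / c * enorm (y - x) by field; rewrite gt_eqF.
  lra.
move=> d d0; have [p0|p0] := eqVneq p 0.
  have e0 : enorm p = 0 by rewrite p0 enorm0.
  have [d2 d20 H2] := asym 1 ltr01.
  pose t := Num.min d d2 / 2; pose e1 : 'rV[R]_n := delta_mx ord0 (Ordinal n0).
  have t0 : 0 < t by rewrite divr_gt0// lt_min d0.
  have td : t < Num.min d d2 by rewrite ltr_pdivrMr// ltr_pMr ?ltr1n// lt_min d0.
  have yE : x + t *: e1 - x = t *: e1 by rewrite addrAC subrr add0r.
  have ne : t *: e1 != 0 by rewrite -normr_gt0 norm_delta gtr0_norm.
  exists (x + t *: e1); split.
  - by rewrite yE norm_delta gtr0_norm// (lt_le_trans td)// ge_min lexx.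
  - by rewrite -subr_eq0 yE.
  - have yd2 : `|x + t *: e1 - x| < d2.
      by rewrite yE norm_delta gtr0_norm// (lt_le_trans td)// ge_min lexx orbT.
    have D10 : 0 < enorm (x + t *: e1 - x) / c by rewrite divr_gt0// yE enorm_gt0.
    have [h _] := ratio _ _ _ D10 (H2 _ yd2); apply: le_trans h.
    rewrite e0 mulr0 sub0r lee_fin; apply: (@le_trans _ _ 0); first by rewrite oppr_le0 ltW.
    by rewrite divr_ge0// mulr_ge0 ?enorm_ge0// addr_ge0// invr_ge0 ltW.
have N0 := enorm_gt0 p0; set N := enorm p in N0 *.
(* both errors, in the expansion of f and in the distance, cost eps / 2 *)
have e10 : 0 < eps / (2 * c) by rewrite divr_gt0// mulr_gt0.
have e20 : 0 < eps / (2 * c * c * N) by rewrite divr_gt0// !mulr_gt0.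
have [d1 d10 H1] := df _ e10; have [d2 d20 H2] := asym _ e20.
pose m := Num.min d (Num.min d1 d2).
have m0 : 0 < m by rewrite !lt_min d0 d10.
have np : 0 < `|p| + 1 by rewrite ltr_wpDl.
have [t t0 tp] : exists2 t : R, 0 < t & `|t *: p| < m.
  exists (m / (`|p| + 1)); first by rewrite divr_gt0.
  rewrite normrZ gtr0_norm ?divr_gt0// -mulrA gtr_pMr//.
  by rewrite mulrC ltr_pdivrMr// mul1r ltrDl.
move: tp; rewrite !lt_min => /and3P[td td1 td2].
have yE : x + t *: p - x = t *: p by rewrite addrAC subrr add0r.
have ne : t *: p != 0 by rewrite scaler_eq0 negb_or gt_eqF.
exists (x + t *: p); split; [by rewrite yE|by rewrite -subr_eq0 yE|].
have eE : enorm (t *: p) = t * N by rewrite enormZ gtr0_norm.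
have tN : 0 < t * N by rewrite mulr_gt0.
have D10 : 0 < enorm (x + t *: p - x) / c by rewrite yE eE divr_gt0.
have yd2 : `|x + t *: p - x| < d2 by rewrite yE.
have [h _] := ratio _ _ _ D10 (H2 _ yd2); apply: le_trans h; rewrite lee_fin yE eE.
have c20 : 0 < c^-1 + eps / (2 * c * c * N) by rewrite addr_gt0// invr_gt0.
rewrite ler_pdivlMr ?mulr_gt0//.
have := H1 _ td1; rewrite dotE dotZr -sqr_enorm -/N => h1.
have h3 : `|t *: p| <= t * N by rewrite -eE norm_le_enorm.
have h4 : eps / (2 * c) * `|t *: p| <= eps / (2 * c) * (t * N) by rewrite ler_wpM2l// ltW.
apply: (@le_trans _ _ (t * N * (N - eps / (2 * c)))).
  have -> : (c * N - eps) * ((c^-1 + eps / (2 * c * c * N)) * (t * N)) =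
     t * N * (N - eps / (2 * c)) - t * N * (eps * (eps / (2 * c * c * N))).
    by field; rewrite !gt_eqF.
  by rewrite lerBlDr lerDl; apply: mulr_ge0; [exact: ltW|apply: mulr_ge0; exact: ltW].
have h5 := ler_normB (f (x + t *: p) - f x) (f (x + t *: p) - f x - t * N ^+ 2).
rewrite (_ : _ - (_ - _) = t * N ^+ 2) in h5; last by ring.
have tN2 : 0 <= t * N ^+ 2 by rewrite mulr_ge0 ?sqr_ge0// ltW.
rewrite (ger0_norm tN2) in h5.
have -> : t * N * (N - eps / (2 * c)) = t * N ^+ 2 - eps / (2 * c) * (t * N) by ring.
lra.
Qed.

End intrinsic_lipschitz.

(** * The structures of the Cantor matrices *)

Section cantor_matrix_structures.
Context {R : realType} {n : nat}.
Local Notation mu := (@lebesgue_measure_rV R n).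
Local Notation e i := (delta_mx ord0 i : 'rV[R]_n).
Implicit Types (f : 'rV[R]_n -> R) (x y z v w : 'rV[R]_n).
Variables (a : nat -> R) (delta : R).
Hypotheses (a01 : forall j, 0 < a j < 1) (delta1 : delta < 1).
Local Notation C := (@cantor_product R n a).
Local Notation A := (@cantor_matrix R n a delta).
Local Notation c := (Num.sqrt (1 - delta)).

Lemma c_gt0 : 0 < c.
Proof. by rewrite sqrtr_gt0 subr_gt0. Qed.

Lemma sqr_c : c ^+ 2 = 1 - delta.
Proof. by rewrite sqr_sqrtr// subr_ge0 ltW. Qed.

Lemma cantor_product_closed : closed C.
Proof.
rewrite (_ : C = \bigcap_(i in [set: 'I_n]) (fun x : 'rV[R]_n =>
  x ord0 i) @^-1` cantor_set_of a).
  apply: closed_bigI => i _; apply: closed_comp; last exact: cantor_set_closed.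
  move=> x _; move: x; apply: (@lipschitz_rV_continuous R n (fun x => x ord0 i) 1) => x y.
  by rewrite mul1r; have := coord_le_norm (x - y) i; rewrite !mxE.
by apply/seteqP; split => x H i; [move=> _; exact: H|exact: H].
Qed.

Lemma cantor_product_measurable : measurable C.
Proof. by apply: closed_measurable_rV; exact: cantor_product_closed. Qed.

Lemma cantor_product_measure_gt0 : cvgn [normed series a] -> (0 < mu C)%E.
Proof.
move=> ca; have mC := cantor_set_measurable a.
rewrite -[X in (_ < X)%E]/(mu [set x : 'rV[R]_n | forall i, cantor_set_of a (x ord0 i)]).
rewrite (measure_box (fun=> mC)).2; elim/big_ind : _ => //.
  by move=> x y x0 y0; exact: mule_gt0.
by move=> i _; exact: cantor_set_measure_gt0.
Qed.

Lemma cantor_matrix_in x : C x -> 1 - delta * \1_C x = c ^+ 2.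
Proof. by move=> Cx; rewrite indicE mem_set// mulr1 sqr_c. Qed.

Lemma cantor_matrix_out x : ~ C x -> 1 - delta * \1_C x = 1.
Proof. by move=> Cx; rewrite indicE memNset// mulr0 subr0. Qed.

(** The bound that admissibility imposes on the gradient at z. *)
Definition speed (z : 'rV[R]_n) : R := 1 + (c^-1 - 1) * \1_C z.

Lemma speed_in z : C z -> speed z = c^-1.
Proof. by move=> Cz; rewrite /speed indicE mem_set// mulr1 addrC subrK. Qed.

Lemma speed_out z : ~ C z -> speed z = 1.
Proof. by move=> Cz; rewrite /speed indicE memNset// mulr0 addr0. Qed.

Lemma measurable_speed : measurable_fun setT speed.
Proof.
apply: measurable_funD => //; apply: measurable_funM => //.
by apply: measurable_indic; exact: cantor_product_measurable.
Qed.

Lemma speed_bounds (K : R) z : 1 <= K -> c^-1 <= K -> 0 <= speed z <= K.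
Proof.
move=> K1 Kc; have c0 := c_gt0; have [Cz|Cz] := pselect (C z).
  by rewrite speed_in// Kc invr_ge0 ltW.
by rewrite speed_out// ler01 K1.
Qed.

Lemma admissible_speed f : admissible A f -> continuous f /\
  exists g, W12loc f g /\ {ae mu, forall z, enorm (g z) <= speed z}.
Proof.
move=> [cf [g [Wg Eg]]]; split => //; exists g; split => //.
apply: (filterS _ Eg) => z; rewrite energy_scalar; have c0 := c_gt0.
have [Cz|Cz] := pselect (C z).
  rewrite cantor_matrix_in// speed_in// -exprMn => h.
  have ce : 0 <= c * enorm (g z) by rewrite mulr_ge0 ?enorm_ge0// ltW.
  have ce1 : c * enorm (g z) <= 1 by rewrite -ler_sqr ?nnegrE// expr1n.
  by rewrite -[leRHS]mulr1 ler_pdivlMl.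
rewrite cantor_matrix_out// speed_out// mul1r => h.
by rewrite -ler_sqr ?nnegrE ?enorm_ge0// expr1n.
Qed.

Lemma admissible_of_lipschitz f :
  (forall x y, `|f x - f y| <= n.+1%:R * `|x - y|) ->
  (forall z, exists2 K, 0 <= K /\ (1 - delta * \1_C z) * K ^+ 2 <= 1 &
    exists2 rho : R, 0 < rho & forall y, `|y - z| < rho ->
      `|f y - f z| <= K * enorm (y - z)) ->
  admissible A f.
Proof.
move=> fL H; apply: (lipschitz_admissible fL) => // z.
have [Cz|Cz] := pselect (C z); first by rewrite cantor_matrix_in// sqr_ge0.
by rewrite cantor_matrix_out.
Qed.

Lemma enorm_lipschitz f (K : R) : 0 <= K <= 1 ->
  (forall x y, `|f x - f y| <= K * enorm (x - y)) ->
  forall x y, `|f x - f y| <= n.+1%:R * `|x - y|.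
Proof.
move=> /andP[K0 K1] fK x y; apply: le_trans (fK x y) _.
apply: le_trans (enorm_le_norm _); rewrite -[leRHS]mul1r.
by rewrite ler_wpM2r ?enorm_ge0.
Qed.

Lemma admissible_dot w : enorm w <= 1 ->
  (forall z, (1 - delta * \1_C z) * enorm w ^+ 2 <= 1) -> admissible A (dot w).
Proof.
move=> w1 Hw; have fK x y : `|dot w x - dot w y| <= enorm w * enorm (x - y).
  by rewrite !(dotC w) -dotBl dotC cauchy_schwarz.
apply: admissible_of_lipschitz.
  by apply: (enorm_lipschitz _ fK); rewrite enorm_ge0.
move=> z; exists (enorm w); first by rewrite enorm_ge0.
by exists 1.
Qed.

(** ** The case of a positive delta *)

(** The lines parallel to e_i on which the coordinate j lies in a gap of the
    one-dimensional set stay away from C, and they are dense: moving parallel to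
    e_i costs no more than in the Euclidean metric. *)
Lemma admissible_axis_increment f x (t : R) (i j : 'I_n) : i != j -> 0 <= delta ->
  admissible A f -> `|f (x + t *: e i) - f x| <= `|t|.
Proof.
move=> ij d0 /admissible_speed[cf [g [Wg gs]]].
have c0 := c_gt0.
have c0' := ltW c0.
have c1 : c <= 1 by rewrite -ler_sqr ?nnegrE// sqr_c expr1n; lra.
have cV : 1 <= c^-1 by rewrite invf_ge1.
apply/ler_addgt0Pr => eta eta0; have eta2 : 0 < eta / 2 by rewrite divr_gt0.
have [d1 d10 H1] := continuous_near cf x eta2.
have [d2 d20 H2] := continuous_near cf (x + t *: e i) eta2.
have m0 : 0 < Num.min d1 d2 by rewrite lt_min d10.
have [s sx ns] := cantor_set_gap a01 (x ord0 j) m0.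
pose x' := x + (s - x ord0 j) *: e j.
have x'j : x' ord0 j = s by rewrite !mxE !eqxx mulr1 addrC subrK.
have x'x : `|x' - x| < Num.min d1 d2 by rewrite addrAC subrr add0r norm_delta.
have [rho rho0 Hrho] : exists2 rho : R, 0 < rho & forall r, `|r - s| < rho ->
  ~ cantor_set_of a r.
  have /nbhs_normP[rho /= rho0 H] : nbhs s (~` cantor_set_of a).
    by apply: open_nbhs_nbhs; split => //; apply: closed_openC; exact: cantor_set_closed.
  by exists rho => // r rs; apply: H; rewrite /= distrC.
have := @increment_along_segment R n f g speed c^-1 cf Wg measurable_speed
  (fun z => speed_bounds z cV (lexx _)) gs 1 rho x' (t *: e i) rho0.
have -> : enorm (t *: e i) = `|t|.
  by rewrite enormZ enorm_delta mulr1.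
rewrite mul1r => /(_ _)/wrap[].
  move=> s' w _ ws'; rewrite speed_out// => Cw; apply: (Hrho (w ord0 j)); last exact: Cw.
  apply: le_lt_trans ws'; have := coord_le_norm (w - (x' + s' *: (t *: e i))) j.
  rewrite (_ : _ ord0 j = w ord0 j - s)// -x'j; clearbody x'.
  by rewrite !mxE eqxx /= eq_sym (negbTE ij) !mulr0 addr0.
move=> H.
have k1 : `|f x' - f x| <= eta / 2.
  by apply: H1; apply: lt_le_trans x'x _; rewrite ge_min lexx.
have k2 : `|f (x' + t *: e i) - f (x + t *: e i)| <= eta / 2.
  apply: H2; rewrite (_ : _ - _ = x' - x); last by apply/rowP => k; rewrite !mxE; ring.
  by apply: lt_le_trans x'x _; rewrite ge_min lexx orbT.
rewrite (_ : f (x + t *: e i) - f x = (f (x' + t *: e i) - f x') -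
  (f (x' + t *: e i) - f (x + t *: e i)) + (f x' - f x)); last by ring.
apply: le_trans (ler_normD _ _) _; apply: le_trans (lerD (ler_normB _ _) (lexx _)) _.
lra.
Qed.

(** The coordinate function x_i contradicts the coincidence at almost every point
    of C, which has positive measure. *)
Lemma structures_differ : (2 <= n)%N -> cvgn [normed series a] -> 0 < delta ->
  ~ structures_coincide A.
Proof.
move=> n2 ca d0; pose i := Ordinal (ltn_trans (ltnSn 0) n2); pose j := Ordinal n2.
pose u := dot (e i).
have uL x y : `|u x - u y| <= 1 * `|x - y|.
  by rewrite mul1r /u !dot_delta; have := coord_le_norm (x - y) i; rewrite !mxE.
have lip_u : lipschitz u.
  apply: (@klipschitzW _ _ _ 1); first exact: (@globally_properfilter _ _ (0, 0)).
  by move=> [x y] _; exact: uL.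
move=> /(_ u lip_u) H.
have := cantor_product_measure_gt0 ca; apply/negP; rewrite -leNgt.
suff : {ae mu, forall x, ~ C x}.
  move=> [N [mN N0 CN]]; rewrite -N0; apply: le_measure; rewrite ?inE//.
    exact: cantor_product_measurable.
  by move=> x Cx; apply: CN => /=; apply.
apply: (filterS2 _ _ H (rademacher uL)) => x Lx [_ dx] Cx.
have g1 : enorm (grad u x) <= 1.
  apply: (grad_enorm_le ler01 dx); exists 1 => // y _.
  by rewrite /u !(dotC (e i)) -dotBl dotC; apply: le_trans (cauchy_schwarz _ _) _;
    rewrite enorm_delta.
have c1 : c ^+ 2 < 1 by rewrite sqr_c; lra.
have adm (s : R) : s ^+ 2 = 1 -> admissible A (dot (s *: e i)).
  move=> s2; have es : enorm (s *: e i) ^+ 2 = 1.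
    by rewrite enormZ enorm_delta mulr1 real_normK ?num_real.
  apply: admissible_dot; first by rewrite -ler_sqr ?nnegrE ?enorm_ge0// es expr1n.
  move=> z; rewrite es mulr1; have [Cz|Cz] := pselect (C z).
    by rewrite cantor_matrix_in// ltW.
  by rewrite cantor_matrix_out.
have distE (t : R) : t != 0 -> intrinsic_dist A x (x + t *: e i) = `|t|%:E.
  move=> t0; apply/eqP; rewrite eq_le; apply/andP; split.
    apply: intrinsic_dist_le => f Af; apply: le_trans (ler_norm _) _; rewrite distrC.
    by apply: (@admissible_axis_increment _ _ _ i j) => //; exact: ltW.
  have [s [s2 st]] : exists s : R, s ^+ 2 = 1 /\ `|t| = - s * t.
    have [tp|tn] := leP 0 t; first by exists (-1);
      rewrite sqrrN expr1n ger0_norm// opprK mul1r.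
    by exists 1; rewrite expr1n ltr0_norm// mulN1r.
  apply: le_trans (intrinsic_dist_ge _ _ (adm s s2)).
  rewrite lee_fin !dotZl -mulrBr !dot_delta !mxE !eqxx mulr1 opprD addrA subrr add0r st.
  by rewrite mulrN mulNr.
have L1 : (1 <= intrinsic_Lip A u x)%E.
  apply: limf_esup_ge => d d0'; pose t := d / 2.
  have t0 : 0 < t by rewrite divr_gt0.
  exists (x + t *: e i); have yE : x + t *: e i - x =
    t *: e i by rewrite addrAC subrr add0r.
  split.
  - by rewrite yE norm_delta gtr0_norm// ltr_pdivrMr// ltr_pMr// ltr1n.
  - by rewrite -subr_eq0 yE -normr_gt0 norm_delta gtr0_norm.
  - rewrite distE ?gt_eqF// div_EFin ?normr_gt0 ?gt_eqF// lee_fin.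
    rewrite /u !dot_delta !mxE !eqxx mulr1 addrAC subrr add0r divff//.
    by rewrite normr_eq0 gt_eqF.
have : (1 <= intrinsic_Lip A u x ^+ 2)%E.
  have L0 : (0 <= intrinsic_Lip A u x)%E by apply: (le_trans _ L1); rewrite lee_fin.
  rewrite expe2; apply: (le_trans L1); rewrite -[leLHS]mul1e; exact: lee_wpmul2r.
rewrite Lx energy_scalar cantor_matrix_in// lee_fin; apply/negP; rewrite -ltNge.
apply: le_lt_trans c1; rewrite -[leRHS]mulr1; apply: ler_wpM2l; first exact: sqr_ge0.
by rewrite -[leRHS](expr1n _ 2) ler_sqr ?nnegrE ?enorm_ge0.
Qed.

(** ** The case of a nonpositive delta *)

Section nonpositive.
Hypothesis d0 : delta <= 0.

Let c_ge1 : 1 <= c.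
Proof. by rewrite -ler_sqr ?nnegrE ?sqrtr_ge0// sqr_c expr1n; move: d0; lra. Qed.

Let cV_le1 : c^-1 <= 1.
Proof. by rewrite invf_le1 ?c_gt0 ?c_ge1. Qed.

Let cantor_matrix_le z : 1 - delta * \1_C z <= c ^+ 2.
Proof.
have [Cz|Cz] := pselect (C z); first by rewrite cantor_matrix_in.
by rewrite cantor_matrix_out// sqr_c; move: d0; lra.
Qed.

(** The linear function of slope 1 / c in the direction of x - y is admissible. *)
Lemma dist_ge_slow x y : ((enorm (y - x) / c)%:E <= intrinsic_dist A x y)%E.
Proof.
have c0 := c_gt0; have cV0 : 0 <= c^-1 by rewrite invr_ge0 ltW.
pose w := (c^-1 / enorm (x - y)) *: (x - y).
have [ew xy] : enorm w <= c^-1 /\ dot w (x - y) = enorm (x - y) / c.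
  have [E|/enorm_gt0 N0] := eqVneq (x - y) 0.
    by rewrite /w E scaler0 enorm0 -sqr_enorm enorm0 expr0n mul0r.
  split; last by rewrite dotZl -sqr_enorm; field; rewrite !gt_eqF.
  rewrite /w enormZ ger0_norm; last by rewrite divr_ge0 ?enorm_ge0.
  by rewrite divfK// gt_eqF.
have Aw : admissible A (dot w).
  apply: admissible_dot; first exact: le_trans ew cV_le1.
  move=> z; apply: (@le_trans _ _ (c ^+ 2 * c^-1 ^+ 2)); last first.
    by rewrite -exprMn divff ?expr1n// gt_eqF.
  apply: ler_pM; [|exact: sqr_ge0|exact: cantor_matrix_le|].
    have [Cz|Cz] := pselect (C z); first by rewrite cantor_matrix_in// sqr_ge0.
    by rewrite cantor_matrix_out.
  by rewrite ler_sqr ?nnegrE ?enorm_ge0.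
apply: le_trans (intrinsic_dist_ge _ _ Aw).
by rewrite lee_fin !(dotC w) -dotBl dotC xy enormB.
Qed.

(** The cone with vertex x, truncated at a radius at which it has not yet met C, is
    admissible: its gradient vanishes farther away. *)
Lemma dist_ge_fast x : ~ C x -> exists2 d, 0 < d & forall y, `|y - x| < d ->
  ((enorm (y - x))%:E <= intrinsic_dist A x y)%E.
Proof.
move=> nC; have /nbhs_rVP[rho rho0 Hrho] : nbhs x (~` C).
  by apply: open_nbhs_nbhs; split => //; apply: closed_openC; exact: cantor_product_closed.
pose r := rho / 2; have r0 : 0 < r by rewrite divr_gt0.
pose f z := - Num.min (enorm (z - x)) r.
have fE y z : `|f y - f z| <= enorm (y - z).
  have h1 : enorm (y - x) <= enorm (z - x) + enorm (y - z).
    by rewrite [leRHS]addrC; have := enormD (y - z) (z - x); rewrite addrA subrK.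
  have h2 : enorm (z - x) <= enorm (y - x) + enorm (y - z).
    by rewrite [leRHS]addrC (enormB y z); have := enormD (z - y) (y - x);
      rewrite addrA subrK.
  have h3 := enorm_ge0 (y - z).
  by rewrite /f; case: (leP (enorm (y - x)) r) => ?; case: (leP (enorm (z - x)) r) => ?;
    rewrite ler_norml; apply/andP; split; lra.
have fE1 y z : `|f y - f z| <= 1 * enorm (y - z) by rewrite mul1r.
have Af : admissible A f.
  apply: admissible_of_lipschitz.
    by apply: (enorm_lipschitz _ fE1); rewrite ler01 lexx.
  move=> z; have [zr|rz] := leP (enorm (z - x)) r.
    exists 1; last by exists 1.
    split=> //; rewrite expr1n mulr1 cantor_matrix_out//; apply: Hrho.
    apply: le_lt_trans (norm_le_enorm _) _; apply: le_lt_trans zr _.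
    by rewrite /r ltr_pdivrMr// ltr_pMr// ltr1n.
  exists 0; first by rewrite expr0n /= mulr0.
  exists ((enorm (z - x) - r) / n.+1%:R); first by rewrite divr_gt0// subr_gt0.
  move=> y; rewrite ltr_pdivlMr ?ltr0n// mulrC => yz.
  have h1 : enorm (z - x) <= enorm (y - x) + enorm (y - z).
    by rewrite [leRHS]addrC (enormB y z); have := enormD (z - y) (y - x);
      rewrite addrA subrK.
  have h2 := enorm_le_norm (y - z).
  have ry : r < enorm (y - x) by lra.
  by rewrite /f !min_r ?subrr ?normr0 ?mul0r// ltW.
exists (r / n.+1%:R); first by rewrite divr_gt0.
move=> y; rewrite ltr_pdivlMr ?ltr0n// mulrC => yx.
apply: le_trans (intrinsic_dist_ge _ _ Af); rewrite lee_fin /f subrr.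
have h := enorm_le_norm (y - x).
rewrite enorm0 (min_l (ltW r0)) min_l; last lra.
by rewrite oppr0 sub0r opprK.
Qed.

Lemma dist_le_euclid x y : (intrinsic_dist A x y <= (enorm (y - x))%:E)%E.
Proof.
apply: intrinsic_dist_le => f /admissible_speed[cf [g [Wg gs]]].
have := weak_lipschitz cf Wg measurable_speed (fun z =>
  speed_bounds z (lexx _) cV_le1) gs x y.
by rewrite mul1r distrC; apply: le_trans; exact: ler_norm.
Qed.

(** At a density point of C a ball of radius r around the segment from x to y
    consists of points of C up to a proportion that vanishes with |y - x|. *)
Lemma dist_le_slow : {ae mu, forall x, C x -> forall eps, 0 < eps ->
  exists2 d, 0 < d & forall y, `|y - x| < d ->
  (intrinsic_dist A x y <= ((c^-1 + eps) * enorm (y - x))%:E)%E}.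
Proof.
have mC := cantor_set_measurable a.
apply: (filterS _ (product_density n mC)) => x dens Cx eps eps0.
have {}dens := dens Cx; have c0 := c_gt0.
set kap : R := (expR (- 2) ^+ 2) ^+ n.
have kap0 : 0 < kap by rewrite !exprn_gt0// expR_gt0.
(* at the scale theta |y - x|, the oscillation of the function and the share of
   the complement of C contribute at most eps / 2 each *)
pose theta : R := eps / (4 * n.+1%:R).
have th0 : 0 < theta by rewrite divr_gt0// mulr_gt0// ltr0n.
pose beta := kap * (eps / 2).
have beta0 : 0 < beta by rewrite mulr_gt0// divr_gt0.
pose b0 := beta * (theta / (1 + theta)) ^+ n.
have th1 : 0 < 1 + theta by rewrite addr_gt0.
have b00 : 0 < b0 by rewrite mulr_gt0// exprn_gt0// divr_gt0.
have [d dd0 Hd] := dens _ b00.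
exists (d / (1 + theta)); first by rewrite divr_gt0.
move=> y; rewrite ltr_pdivlMr// => yd.
have [->|yx] := eqVneq y x.
  rewrite subrr enorm0 mulr0.
  by apply: intrinsic_dist_le => f _; rewrite subrr.
pose v := y - x; have v0 : 0 < `|v| by rewrite normr_gt0 subr_eq0.
apply: intrinsic_dist_le => f /admissible_speed[cf [g [Wg gs]]].
pose e' := theta * `|v|; have e'0 : 0 < e' by rewrite mulr_gt0.
have mE : measurable (~` C) by apply: measurableC; exact: cantor_product_measurable.
have := @increment_density R n f g speed 1 cf Wg measurable_speed
  (fun z => speed_bounds z (lexx _) cV_le1) gs c^-1 beta e' (~` C) x v e'0 _ mE.
rewrite invr_ge0 (ltW c0) => /(_ isT _ _)/wrap[].
- move=> w; rewrite mul1r; have [Cw|Cw] := pselect (C w).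
    by rewrite speed_in// lerDl.
  by rewrite speed_out// indicE mem_set// lerDr invr_ge0 ltW.
- move=> t /andP[t0 t1].
  have r0 : 0 < (1 + theta) * `|v| by rewrite mulr_gt0.
  have rd : (1 + theta) * `|v| < d by rewrite mulrC.
  apply: (@le_trans _ _ (mu (~` C `&` [set w | (`|w - x| < (1 + theta) * `|v|)%R]))).
    apply: le_measure; rewrite ?inE; try by apply: measurableI => //;
      exact: measurable_cube.
    move=> w [nCw wt]; split => //=; rewrite (_ : w - x = (w - (x + t *: v)) + t *: v);
      last first.
      by rewrite opprD addrA subrK.
    apply: le_lt_trans (ler_normD _ _) _; rewrite mulrDl mul1r addrC.
    apply: ler_ltD; last exact: wt.
    by rewrite normrZ ger0_norm// ler_piMl.
  apply: le_trans (Hd _ r0 rd) _; rewrite lee_fin /b0 -mulrA; apply: ler_wpM2l;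
    first exact: ltW.
  rewrite -exprMn (_ : theta / (1 + theta) * _ = e')//.
  by rewrite /e'; field; rewrite gt_eqF.
rewrite [x + v]addrC subrK !mul1r => H.
apply: le_trans (ler_norm _) _; rewrite distrC; apply: le_trans H _.
have h := norm_le_enorm v; rewrite -/kap /beta.
have -> : kap * (eps / 2) / kap = eps / 2 by field; rewrite gt_eqF.
have -> : n.+1%:R * e' = eps / 4 * `|v|.
  by rewrite /e' /theta; field; rewrite ?natr1 ?nat1r pnatr_eq0.
have h2 : eps / 4 * `|v| <= eps / 4 * enorm v by rewrite ler_wpM2l// divr_ge0// ltW.
rewrite -/v; move: (c^-1) (enorm v) h2 => s N; lra.
Qed.

Lemma structures_equal : (0 < n)%N -> structures_coincide A.
Proof.
move=> n0 f; rewrite /lipschitz_on => /pinfty_ex_gt0[L L0 fL].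
have {}fL x y : `|f x - f y| <= L * `|x - y| by exact: (fL (x, y)).
apply: (filterS2 _ _ (rademacher fL) dist_le_slow) => x [_ dx] slow.
have c0 := c_gt0; rewrite energy_scalar.
have [Cx|Cx] := pselect (C x).
  rewrite (@intrinsic_Lip_asymptotic _ _ _ _ _ c)//; last first.
    move=> eps eps0; have [d d0' Hd] := slow Cx _ eps0; exists d => // y yd.
    by rewrite dist_ge_slow Hd.
  by rewrite cantor_matrix_in// expe2 -EFinM -exprMn expr2.
rewrite (@intrinsic_Lip_asymptotic _ _ _ _ _ 1)//; last first.
  move=> eps eps0; have [d d0' Hd] := dist_ge_fast Cx; exists d => // y yd.
  rewrite divr1 Hd// invr1; apply: le_trans (dist_le_euclid x y) _.
  by rewrite lee_fin ler_peMl ?enorm_ge0// lerDl ltW.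
by rewrite cantor_matrix_out// expe2 -EFinM !mul1r expr2.
Qed.

End nonpositive.

End cantor_matrix_structures.

Theorem proposition3p1 (R : realType) (n : nat) (a : nat -> R) (delta : R) :
  (2 <= n)%N ->
  (forall j, 0 < a j < 1) ->
  cvgn [normed series a] ->
  delta < 1 ->
  (delta <= 0 -> structures_coincide (@cantor_matrix R n a delta)) /\
  (0 < delta -> ~ structures_coincide (@cantor_matrix R n a delta)).
Proof.
move=> n2 a01 ca d1; split=> d0.
  exact: structures_equal d1 d0 (ltnW n2).
exact: structures_differ a01 d1 n2 ca d0.
Qed.
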